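(* Let $n\ge 0$ and $m\ge 0$ be integers, let $\mathcal{D}=(0,1)\times(-1,1)^n\subset\mathbb{R}^{n+1}$, with points written $(x,z)$, $x\in\mathbb{R}$, $z\in\mathbb{R}^n$, and let $\overline{\mathcal{D}}$ be its closure. Let $f,g$ be real-valued functions of $(x,z)$ that are analytic on a compact neighbourhood of $\overline{\mathcal{D}}$. Assume that $f$ admits a unique maximum on $\overline{\mathcal{D}}$, attained at $(x,z)=(0,0)$, that the Hessian matrix $\left.\frac{\partial^2 f}{\partial z^2}\right|_{(0,0)}$ is negative definite, and that $\left.\frac{\partial f}{\partial x}\right|_{(0,0)}<0$. For $N>0$ set $$\mathcal{I}_g(N)=\int_{x\in(0,1)}\int_{z\in(-1,1)^n} x^m g(x,z)\exp\left(N f(x,z)\right)\,dx\,dz .$$ (1) If $g(0,0)\neq 0$, then as $N\to+\infty$ $$\mathcal{I}_g(N)=\frac{g(0,0)\; m!\;(2\pi)^{n/2}\, e^{N f(0,0)}\, N^{-m-n/2-1}}{\sqrt{\left|\det\left(\left.\frac{\partial^2 f}{\partial z^2}\right|_{(0,0)}\right)\right|}\;\left(-\left.\frac{\partial f}{\partial x}\right|_{(0,0)}\right)^{m+1}}+O\left(e^{N f(0,0)}N^{-m-n/2-2}\right).$$ (2) If $g(0,0)=0$, $\left.\frac{\partial g}{\partial x}\right|_{(0,0)}=0$ and $\left.\frac{\partial g}{\partial z}\right|_{(0,0)}=0$, then as $N\to+\infty$ $$\mathcal{I}_g(N)=\left(\frac{\operatorname{Tr}\left(-\left.\frac{\partial^2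 g}{\partial z^2}\right|_{(0,0)}\left(\left.\frac{\partial^2 f}{\partial z^2}\right|_{(0,0)}\right)^{-1}\right) m!\,(2\pi)^{n/2}}{2\sqrt{\left|\det\left(\left.\frac{\partial^2 f}{\partial z^2}\right|_{(0,0)}\right)\right|}\left(-\left.\frac{\partial f}{\partial x}\right|_{(0,0)}\right)^{m+1}}\right)e^{N f(0,0)}N^{-m-n/2-2}+O\left(e^{N f(0,0)}N^{-m-n/2-3}\right).$$
   Context: $\frac{\partial^2 f}{\partial z^2}$ and $\frac{\partial^2 g}{\partial z^2}$ denote the $n\times n$ Hessian matrices with respect to the variables $z=(z_1,\dots,z_n)$ only (for $n=0$ the variable $z$ is absent, the determinant is $1$ and the trace is $0$); $\frac{\partial g}{\partial z}$ denotes the gradient with respect to $z$. *)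

(* Defs.v *)
(* Over an arbitrary [R : realType].  A point (x, z) of R^(n+1) is the row vector
   [pt x z : 'rV_(1 + n)], whose coordinate x has index [xidx n] and whose
   coordinate z_i has index [zidx i]. *)
From HB Require Import structures.
From mathcomp Require Import all_boot all_order all_algebra.
From mathcomp Require Import all_classical all_reals all_analysis.

Set Implicit Arguments.
Unset Strict Implicit.
Unset Printing Implicit Defensive.

Import Order.TTheory GRing.Theory Num.Theory.
Import numFieldNormedType.Exports.

Local Open Scope classical_set_scope.
Local Open Scope ring_scope.

Section LebesgueTuple.
Variable R : realType.

Definition cons_pair n (xt : R * n.-tuple R) : n.+1.-tuple R :=
  [tuple of xt.1 :: xt.2].

Lemma measurable_cons_pair n :
  measurable_fun [set: R * n.-tuple R] (@cons_pair n).
Proof.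
by apply: measurable_cons; [exact: measurable_fst|exact: measurable_snd].
Qed.

Section Cons.
Variables (n : nat) (mu : {sigma_finite_measure set (n.-tuple R) -> \bar R}).

Definition lebesgue_cons : set (n.+1.-tuple R) -> \bar R :=
  pushforward (@lebesgue_measure R \x mu)%E (@cons_pair n).

Let lebesgue_cons0 : lebesgue_cons set0 = 0%E.
Proof. by rewrite /lebesgue_cons /pushforward preimage_set0 measure0. Qed.

Let lebesgue_cons_ge0 A : (0 <= lebesgue_cons A)%E.
Proof. by rewrite /lebesgue_cons /pushforward measure_ge0. Qed.

Let lebesgue_cons_sigma_additive : semi_sigma_additive lebesgue_cons.
Proof.
have mcp := @measurable_cons_pair n.
move=> F mF tF mUF; rewrite /lebesgue_cons /pushforward preimage_bigcup.
apply: measure_semi_sigma_additive.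
- by move=> i; rewrite -[X in measurable X]setTI; exact: mcp.
- apply/trivIsetP => /= i j _ _ ij; rewrite -preimage_setI.
  by move/trivIsetP : tF => /(_ _ _ _ _ ij) ->//; rewrite preimage_set0.
- by rewrite -preimage_bigcup -[X in measurable X]setTI; exact: mcp.
Qed.

HB.instance Definition _ := isMeasure.Build _ _ _ lebesgue_cons
  lebesgue_cons0 lebesgue_cons_ge0 lebesgue_cons_sigma_additive.

(* Not inferred from the product: for [\x], canonical inference picks the instance
   restricted to subprobabilities. *)
Let lebesgue_cons_sigma_finite : sigma_finite setT lebesgue_cons.
Proof.
pose uncons (t : n.+1.-tuple R) : R * n.-tuple R :=
  (tnth t ord0, [tuple of behead t]).
have unconsK : cancel (@cons_pair n) uncons.
  by case=> x t; congr pair; apply: val_inj.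
have muncons : measurable_fun setT uncons.
  apply/measurable_fun_pairP; split => /=.
    exact: measurable_tnth.
  exact: measurable_behead.
have /sigma_finiteP[F [TF ndF Foo]] := sigma_finiteT (@lebesgue_measure R).
have /sigma_finiteP[G [TG ndG Goo]] := sigma_finiteT mu.
exists (fun i => uncons @^-1` (F i `*` G i)).
  rewrite -preimage_bigcup; apply/esym/seteqP; split=> // t _ /=.
  have [i _ Fi] : (\bigcup_i F i) (uncons t).1 by rewrite -TF.
  have [j _ Gj] : (\bigcup_j G j) (uncons t).2 by rewrite -TG.
  exists (maxn i j) => //; split.
    by apply: (subsetPset _ _ (ndF _ _ (leq_maxl i j))).
  by apply: (subsetPset _ _ (ndG _ _ (leq_maxr i j))).
move=> i; have [mF Flty] := Foo i; have [mG Glty] := Goo i; split.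
  by rewrite -[X in measurable X]setTI; apply: muncons => //; exact: measurableX.
rewrite /lebesgue_cons /pushforward -comp_preimage.
rewrite (_ : uncons \o _ = id); last by apply/funext => xt; exact: unconsK.
by rewrite preimage_id product_measure1E// lte_mul_pinfty// ge0_fin_numE.
Qed.

HB.instance Definition _ := Measure_isSigmaFinite.Build _ _ _ lebesgue_cons
  lebesgue_cons_sigma_finite.

End Cons.

(* n-dimensional Lebesgue measure, on R^n represented as [n.-tuple R]; R^0 is a
   single point, of mass 1. *)
Fixpoint lebesgue_tuple n : {sigma_finite_measure set (n.-tuple R) -> \bar R} :=
  match n with
  | 0 => \d_ [tuple]
  | n'.+1 => lebesgue_cons (lebesgue_tuple n')
  end.

End LebesgueTuple.

(* Lets Landau's notation [_ +O_ (pinfty_nbhs R) _] be used at +oo. *)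
Canonical pinfty_filter_on (R : numFieldType) := FilterType (pinfty_nbhs R) _.

Section Defs.
Variable R : realType.

(* The sum of an absolutely convergent family of reals is the difference of the
   sums of its positive and negative parts. *)
Definition analytic_at d (f : 'rV[R]_d -> R) (p : 'rV[R]_d) : Prop :=
  exists (a : {ffun 'I_d -> nat} -> R) (r : R), 0 < r /\
    forall y, ball p r y ->
      let t k := (a k * \prod_(i < d) (y - p) 0 i ^+ k i)%:E in
      summable setT t /\
      (f y)%:E = (\esum_(k in setT) t^\+ k - \esum_(k in setT) t^\- k)%E.

Definition partial d (i : 'I_d) (f : 'rV[R]_d -> R) (p : 'rV[R]_d) : R :=
  'D_(delta_mx 0 i) f p.

Definition unique_max_at (T : Type) (A : set T) (f : T -> R) (p0 : T) : Prop :=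
  A p0 /\ forall p, A p -> p <> p0 -> f p < f p0.

Definition neg_definite n (H : 'M[R]_n) : Prop :=
  forall v : 'rV[R]_n, v != 0 -> (v *m H *m v^T) 0 0 < 0.

Variable n : nat.

Definition pt (x : R) (z : 'rV[R]_n) : 'rV[R]_(1 + n) := row_mx x%:M z.

Definition xidx : 'I_(1 + n) := lshift n ord0.
Definition zidx (i : 'I_n) : 'I_(1 + n) := rshift 1 i.

Definition dom : set 'rV[R]_(1 + n) :=
  [set p | 0 < p 0 xidx < 1 /\ forall i, -1 < p 0 (zidx i) < 1].

Definition cube : set (n.-tuple R) := [set t | forall i, -1 < tnth t i < 1].

Definition diff_x (f : 'rV[R]_(1 + n) -> R) (p : 'rV[R]_(1 + n)) : R :=
  partial xidx f p.

Definition grad_z (f : 'rV[R]_(1 + n) -> R) (p : 'rV[R]_(1 + n)) : 'rV[R]_n :=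
  \row_i partial (zidx i) f p.

Definition hess_z (f : 'rV[R]_(1 + n) -> R) (p : 'rV[R]_(1 + n)) : 'M[R]_n :=
  \matrix_(i, j) partial (zidx i) (partial (zidx j) f) p.

Definition laplace_int (m : nat) (f g : 'rV[R]_(1 + n) -> R) (N : R) : R :=
  \int[@lebesgue_measure R]_(x in `]0, 1[)
    \int[lebesgue_tuple R n]_(t in cube)
      (x ^+ m * g (pt x (\row_i tnth t i))
       * expR (N * f (pt x (\row_i tnth t i)))).

End Defs.

(* Main.v *)
(* Let phi = f - f(0), a = - df/dx(0), A = - Hess_z f(0), and rho = x +
   |z|^2. Give x weight 2 and each z_i weight 1. Near 0 the phase phi agrees
   with q = - a x - z A z^T / 2 up to a part of weight 3, which is odd in z,
   and O(rho^2); likewise g agrees with P, which is g(0) (j = 0) or z (Hess_z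
   g(0)) z^T / 2 (j = 1), up to a part odd in z and O(rho^(j+1)). Averaging
   over z -> - z therefore removes the half-integer orders: by a second-
   difference estimate on exp, the symmetrized integrand is x^m P(z) e^(N q)
   up to O(x^m N^(-j-1) e^(- c N rho)). These bounds hold on the whole domain
   and not only near 0, since away from 0 both rho and - phi are bounded
   below. The main term is then integrated exactly, as a Gamma integral in x
   times Gaussian moments in z, the Gaussian by induction on n, splitting off
   one variable with a Schur complement. *)

(* Everything is measured on the single scale [s = Num.sqrt (rho x z)]: a remainder of weight k is
   bounded by a multiple of [s ^+ k], and against the exponential only powers of [N * s ^+ 2]
   remain, which are absorbed by giving up half of the decay rate. The weight-1 part of [f] would
   spoil this count; as the maximum sits on the face x = 0, its vanishing is not the usual critical
   point argument ([grad_z_max]). The main term is integrated over the whole half-space without a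
   separate tail estimate: the integrand is extended by 0, and outside the domain, where [rho] is at
   least 1, the main term is itself within the allowed error. Integrals over tuples are iterated by
   Tonelli, hence for nonnegative integrands; so Gaussian moments are first computed for nonnegative
   weights [c + qform G z], a class stable under integrating out one variable, and reach signed
   weights by subtraction. Both parts of the theorem come from one estimate with a parameter [j],
   where the leading part of [g] has size [s ^+ (2 * j)]. *)
Require Import Defs.
From mathcomp Require Import all_boot all_order all_algebra.
From mathcomp Require Import all_classical all_reals all_analysis.
From mathcomp Require Import measurable_realfun ring lra.

Set Implicit Arguments.
Unset Strict Implicit.
Unset Printing Implicit Defensive.

Import Order.TTheory GRing.Theory Num.Theory.
Import numFieldNormedType.Exports.

Local Open Scope classical_set_scope.
Local Open Scope ring_scope.

(** * Signed sums over arbitrary index sets *)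

Section SignedSum.
Variables (R : realType) (K : choiceType).
Implicit Types (t u b : K -> R) (c : R).

Definition rsummable t := summable setT (fun k => (t k)%:E).

(** The value that [analytic_at] assigns to a family, as a real number. On a summable family both
    parts are finite and [fine] loses nothing; elsewhere the value carries no meaning, whence the
    [rsummable] hypotheses below. *)
Definition ssum t : R :=
  fine (\esum_(k in setT) (fun k => (t k)%:E)^\+ k
        - \esum_(k in setT) (fun k => (t k)%:E)^\- k)%E.

Lemma rsummableE t :
  rsummable t -> (\esum_(k in setT) `|(t k)%:E| \is a fin_num)%E.
Proof. by rewrite /rsummable summableE. Qed.

Lemma rsummable_le b t :
  rsummable b -> (forall k, `|t k| <= b k) -> rsummable t.
Proof.
move=> sb tb; apply: le_lt_trans sb; apply: le_esum => k _.
by rewrite /= !lee_fin (le_trans (tb k))// ler_norm.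
Qed.

Lemma ge0_esum_fin_num t : (forall k, 0 <= t k) -> rsummable t ->
  (\esum_(k in setT) (t k)%:E \is a fin_num)%E.
Proof.
move=> t0 /rsummableE; congr (_ \is a fin_num).
by apply: eq_esum => k _; rewrite gee0_abs ?lee_fin.
Qed.

Lemma ge0_ssum t : (forall k, 0 <= t k) ->
  ssum t = fine (\esum_(k in setT) (t k)%:E)%E.
Proof.
move=> t0; rewrite /ssum [X in (_ - X)%E]esum1 ?sube0; last first.
  by move=> k _; rewrite funenegE max_r// leeNl oppe0 lee_fin.
by congr fine; apply: eq_esum => k _; rewrite funeposE max_l// lee_fin.
Qed.

(** Any decomposition into nonnegative summable families computes the sum, not only the positive and
    negative parts. Linearity is then proved by choosing a convenient decomposition. *)
Lemma ssumE t u v : (forall k, 0 <= u k) -> (forall k, 0 <= v k) ->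
  rsummable u -> rsummable v -> (forall k, t k = u k - v k) ->
  ssum t = ssum u - ssum v.
Proof.
move=> u0 v0 su sv tE; rewrite [ssum u]ge0_ssum// [ssum v]ge0_ssum//.
rewrite -fineB ?ge0_esum_fin_num// /ssum; congr fine.
rewrite -(esumB su sv); last 2 first.
  by move=> k _; rewrite lee_fin.
  by move=> k _; rewrite lee_fin.
congr (_ - _)%E; apply: eq_esum => k _.
  by rewrite !funeposE tE.
by rewrite !funenegE tE.
Qed.

Lemma ge0_ssumD t u : (forall k, 0 <= t k) -> (forall k, 0 <= u k) ->
  rsummable t -> rsummable u -> ssum (fun k => t k + u k) = ssum t + ssum u.
Proof.
move=> t0 u0 st su; rewrite !ge0_ssum//; last by move=> k; rewrite addr_ge0.
rewrite -fineD ?ge0_esum_fin_num// -esumD.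
- by [].
- by move=> k _; rewrite lee_fin.
- by move=> k _; rewrite lee_fin.
Qed.

Lemma rsummableD t u :
  rsummable t -> rsummable u -> rsummable (fun k => t k + u k).
Proof. exact: summableD. Qed.

(** One inequality is enough: the converse is this one with [c^-1], as in [ge0_ssumZ]. *)
Lemma esumZl c t : 0 <= c -> (forall k, 0 <= t k) ->
  (\esum_(k in setT) (c * t k)%:E <= c%:E * \esum_(k in setT) (t k)%:E)%E.
Proof.
move=> c0 t0; apply: ub_ereal_sup => _ [F [finF _]] <-.
under eq_fsbigr do rewrite EFinM.
rewrite -ge0_mule_fsumr; last by move=> k; rewrite lee_fin.
rewrite lee_wpmul2l ?lee_fin//; apply: ereal_sup_ubound.
by exists F.
Qed.

Lemma rsummableZ c t : rsummable t -> rsummable (fun k => c * t k).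
Proof.
move=> st; rewrite /rsummable /summable.
under eq_esum do rewrite /= normrM.
apply: (@le_lt_trans _ _ (`|c|%:E * \esum_(k in setT) (`|t k|)%:E)%E).
  exact: esumZl.
by rewrite lte_mul_pinfty.
Qed.

Lemma ge0_ssumZ c t : 0 <= c -> (forall k, 0 <= t k) -> rsummable t ->
  ssum (fun k => c * t k) = c * ssum t.
Proof.
move=> c0 t0 st; rewrite !ge0_ssum//; last by move=> k; rewrite mulr_ge0.
have [->|cn0] := eqVneq c 0.
  by rewrite mul0r esum1// => k _; rewrite mul0r.
have cp : 0 < c by rewrite lt_def cn0.
rewrite -[c in RHS]/(fine c%:E) -fineM ?ge0_esum_fin_num//; congr fine.
apply/eqP; rewrite eq_le esumZl//=.
rewrite -[leRHS]mul1e -(divff cn0) EFinM -muleA lee_wpmul2l ?lee_fin//.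
apply: le_trans (esumZl _ _) => //.
- apply: le_esum => k _; rewrite lee_fin mulrA mulVf// mul1r.
  by [].
- by rewrite invr_ge0.
- by move=> k; rewrite mulr_ge0.
Qed.

Lemma rsummable_abs t : rsummable t -> rsummable (fun k => `|t k|).
Proof.
rewrite /rsummable /summable; congr (_ < _)%E; apply: eq_esum => k _ /=.
by rewrite normr_id.
Qed.

(** Unlike the positive and negative parts, both pieces are polynomial in [t k] and [|t k|], so
    later identities between decompositions are closed by [ring]. *)
Lemma ssum_posneg t : rsummable t ->
  ssum t = ssum (fun k => `|t k| + t k) - ssum (fun k => `|t k|).
Proof.
move=> st; apply: ssumE => [k|k|||k].
- by rewrite -lerBlDr sub0r lerNl lerNnormlW// lerNl ler_norm.
- by [].
- by apply: rsummableD => //; exact: rsummable_abs.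
- exact: rsummable_abs.
- by ring.
Qed.

Lemma ge0_normD (x : R) : 0 <= `|x| + x.
Proof. by rewrite -lerBlDr sub0r; have := ler_norm (- x); rewrite normrN. Qed.

Lemma ssumD t u : rsummable t -> rsummable u ->
  ssum (fun k => t k + u k) = ssum t + ssum u.
Proof.
move=> st su.
have sat := rsummable_abs st; have sau := rsummable_abs su.
rewrite (ssum_posneg st) (ssum_posneg su).
rewrite (@ssumE (fun k => t k + u k)
  (fun k => (`|t k| + t k) + (`|u k| + u k)) (fun k => `|t k| + `|u k|)).
- rewrite (@ge0_ssumD (fun k => `|t k| + t k) (fun k => `|u k| + u k)).
  + rewrite (@ge0_ssumD (fun k => `|t k|) (fun k => `|u k|))//; ring.
  + by move=> k; exact: ge0_normD.
  + by move=> k; exact: ge0_normD.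
  + exact: rsummableD.
  + exact: rsummableD.
- by move=> k; rewrite addr_ge0// ge0_normD.
- by move=> k; rewrite addr_ge0.
- by do 2?apply: rsummableD.
- exact: rsummableD.
- by move=> k; ring.
Qed.

Lemma ssumN t : rsummable t -> ssum (fun k => - t k) = - ssum t.
Proof.
move=> st; rewrite (ssum_posneg st) opprB.
apply: ssumE => [k|k|||k].
- by [].
- exact: ge0_normD.
- exact: rsummable_abs.
- by apply: rsummableD => //; exact: rsummable_abs.
- by ring.
Qed.

Lemma ssumZ c t : rsummable t -> ssum (fun k => c * t k) = c * ssum t.
Proof.
move=> st; wlog c0 : c / 0 <= c => [hw|].
  have [/hw//|c0] := leP 0 c.
  rewrite -[c]opprK [RHS]mulNr -hw ?oppr_ge0 ?ltW// -ssumN.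
    by congr ssum; apply/funext => k; rewrite mulNr.
  exact: rsummableZ.
have sat := rsummable_abs st.
rewrite (ssum_posneg st) mulrBr -!ge0_ssumZ//; last 2 first.
  by move=> k; exact: ge0_normD.
  exact: rsummableD.
apply: ssumE => [k|k|||k].
- by rewrite mulr_ge0// ge0_normD.
- by rewrite mulr_ge0.
- by apply: rsummableZ; exact: rsummableD.
- exact: rsummableZ.
- by ring.
Qed.

Lemma ssumB t u : rsummable t -> rsummable u ->
  ssum (fun k => t k - u k) = ssum t - ssum u.
Proof.
move=> st su; have sN : rsummable (fun k => - u k).
  by apply: (rsummable_le (rsummable_abs su)) => k; rewrite normrN.
by rewrite ssumD// ssumN.
Qed.

Lemma ler_norm_ssum b t : rsummable b -> (forall k, `|t k| <= b k) ->
  `|ssum t| <= ssum b.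
Proof.
move=> sb tb; have st := rsummable_le sb tb.
have le0 u v : rsummable u -> rsummable v -> (forall k, u k <= v k) ->
    ssum u <= ssum v.
  move=> su sv uv; rewrite -subr_ge0 -ssumB// ge0_ssum.
    by rewrite fine_ge0// esum_ge0// => k _; rewrite lee_fin subr_ge0.
  by move=> k; rewrite subr_ge0.
rewrite ler_norml -ssumN// !le0//.
- by move=> k; apply: le_trans (tb k); exact: ler_norm.
- by apply: (rsummable_le (rsummable_abs sb)) => k; rewrite normrN.
- by move=> k; move: (tb k); rewrite ler_norml => /andP[].
Qed.

Lemma rsummable0 : rsummable (fun=> 0).
Proof. by rewrite /rsummable /summable esum1// => k _ /=; rewrite normr0. Qed.

Lemma ssum0 : ssum (fun=> 0) = 0.
Proof. by rewrite ge0_ssum// esum1. Qed.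

Lemma rsummable_sum (I : finType) (t : I -> K -> R) :
  (forall i, rsummable (t i)) -> rsummable (fun k => \sum_i t i k).
Proof.
move=> st; elim: (index_enum I) => [|i s ih].
  by under eq_fun do rewrite big_nil; exact: rsummable0.
by under eq_fun do rewrite big_cons; exact: rsummableD.
Qed.

Lemma ssum_sum (I : finType) (t : I -> K -> R) :
  (forall i, rsummable (t i)) ->
  ssum (fun k => \sum_i t i k) = \sum_i ssum (t i).
Proof.
move=> st; have aux (s : seq I) : rsummable (fun k => \sum_(i <- s) t i k) /\
    ssum (fun k => \sum_(i <- s) t i k) = \sum_(i <- s) ssum (t i).
  elim: s => [|i s [ih1 ih2]].
    under eq_fun do rewrite big_nil.
    by rewrite big_nil ssum0; split; first exact: rsummable0.
  under eq_fun do rewrite big_cons.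
  by rewrite big_cons ssumD// ih2; split; first exact: rsummableD.
exact: (aux (index_enum I)).2.
Qed.

End SignedSum.

(** * Multivariate power series *)

Section Monomials.
Variables (R : realType) (d : nat).
Implicit Types (e : 'I_d -> nat) (y v : 'rV[R]_d).

Definition mono e y : R := \prod_i y 0 i ^+ e i.
Definition mdeg e : nat := (\sum_i e i)%N.
(** The exponents left after differentiating in direction [j]. The truncated subtraction at
    [e j = 0] is harmless, since the derived coefficient carries the factor [(e j)%:R]. *)
Definition dec e (j : 'I_d) : 'I_d -> nat := fun i => (e i - (i == j))%N.

Lemma monoD1 e y j : mono e y = y 0 j ^+ e j * \prod_(i | i != j) y 0 i ^+ e i.
Proof. by rewrite /mono (bigD1 j). Qed.

Lemma mono_dec e y j :
  mono (dec e j) y = y 0 j ^+ (e j).-1 * \prod_(i | i != j) y 0 i ^+ e i.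
Proof.
rewrite (monoD1 _ _ j) /dec eqxx subn1; congr (_ * _); apply: eq_bigr => i ij.
by rewrite (negbTE ij) subn0.
Qed.

Lemma mono_decK e y j :
  (e j)%:R * (y 0 j * mono (dec e j) y) = (e j)%:R * mono e y.
Proof.
rewrite mono_dec (monoD1 _ _ j).
by case: (e j) => [|n]; rewrite ?mul0r// exprS !mulrA.
Qed.

Lemma mdegD1 e j : mdeg e = (e j + \sum_(i | i != j) e i)%N.
Proof. by rewrite /mdeg (bigD1 j). Qed.

Lemma mdeg_dec e j : mdeg (dec e j) = ((e j).-1 + \sum_(i | i != j) e i)%N.
Proof.
rewrite (mdegD1 _ j) /dec eqxx subn1; congr (_ + _)%N; apply: eq_bigr => i ij.
by rewrite (negbTE ij) subn0.
Qed.

Lemma mdeg_decS e j : (0 < e j)%N -> mdeg e = (mdeg (dec e j)).+1.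
Proof. by rewrite mdeg_dec (mdegD1 _ j) => e0; rewrite -addSn prednK. Qed.

Lemma mono_norm e y (r : 'I_d -> R) : (forall i, `|y 0 i| <= r i) ->
  `|mono e y| <= \prod_i r i ^+ e i.
Proof.
move=> yr; rewrite normr_prod; apply: ler_prod => i _.
by rewrite normr_ge0 normrX lerXn2r// nnegrE// (le_trans (normr_ge0 _) (yr i)).
Qed.

Lemma mono_le e y (r : R) : (forall i, `|y 0 i| <= r) ->
  `|mono e y| <= r ^+ mdeg e.
Proof.
move=> yr; rewrite (le_trans (@mono_norm e y (fun=> r) yr))//.
by rewrite /mdeg (big_morph _ (fun m n => exprD r m n) (expr0 r)).
Qed.

Lemma mono_deg0 e y : mdeg e = 0%N -> mono e y = 1.
Proof.
move/eqP; rewrite /mdeg sum_nat_eq0 => /forallP e0.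
by rewrite /mono big1// => i _; rewrite (eqP (e0 i)) expr0.
Qed.

Lemma mono0 e : mono e 0 = (mdeg e == 0)%:R.
Proof.
have [/mono_deg0 ->//|] := eqVneq (mdeg e) 0%N.
rewrite /mdeg sum_nat_eq0 negb_forall => /existsP[i] /= ei.
by rewrite (monoD1 _ _ i) mxE expr0n (negbTE ei) mul0r.
Qed.

End Monomials.

Section TaylorBound.
Variable R : realType.
Implicit Types (Y s t r : R) (n : nat).

Let rem Y s n := (Y + s) ^+ n - Y ^+ n - n%:R * s * Y ^+ n.-1.

(** The remainder obeys a recurrence in [n] whose coefficients are nonnegative for nonnegative [Y]
    and [s]; sign and size both propagate by induction. *)
Let remS Y s n :
  rem Y s n.+1 = (Y + s) * rem Y s n + n%:R * s ^+ 2 * Y ^+ n.-1.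
Proof.
rewrite /rem; case: n => [|n] /=; first by ring.
by rewrite -[n.+2%:R]natr1 !exprS; ring.
Qed.

Let rem_ge0 Y t n : 0 <= Y -> 0 <= t -> 0 <= rem Y t n.
Proof.
move=> Y0 t0; elim: n => [|n ih].
  by rewrite /rem !expr0 mul0r mul0r subrr subr0.
by rewrite remS addr_ge0// !mulr_ge0// ?addr_ge0// exprn_ge0.
Qed.

(** Every term of the remainder contains [s ^+ 2]. Replacing all other factors by absolute values,
    and [|s|] there by [t], leaves the factor [(s / t) ^+ 2]. *)
Let rem_le Y s t n : 0 < t -> `|s| <= t ->
  `|rem Y s n| <= (s / t) ^+ 2 * rem `|Y| t n.
Proof.
move=> t0 st; elim: n => [|n ih].
  by rewrite /rem !expr0 !mul0r subrr subr0 normr0 mulr0.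
rewrite !remS (le_trans (ler_normD _ _))// [leRHS]mulrDr lerD//.
  rewrite normrM mulrCA ler_pM// (le_trans (ler_normD _ _))// lerD2l.
  exact: st.
rewrite !normrM normr_nat !normrX.
rewrite -(expr2 `|s|) real_normK ?num_real// mulrA ler_wpM2r ?exprn_ge0//.
by rewrite [leRHS]mulrCA expr_div_n divfK// expf_neq0// gt_eqF.
Qed.

(** The exponent enters the bound only through [r ^+ n], so it can be summed against coefficients
    that converge absolutely at radius [r]. This is what allows termwise differentiation. *)
Lemma expr_taylor2 Y s t r n : 0 < t -> `|s| <= t -> `|Y| + t <= r ->
  `|(Y + s) ^+ n - Y ^+ n - n%:R * s * Y ^+ n.-1| <= (s / t) ^+ 2 * r ^+ n.
Proof.
move=> t0 st Yr; rewrite (le_trans (rem_le _ _ t0 st))// ler_wpM2l ?sqr_ge0//.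
apply: (@le_trans _ _ ((`|Y| + t) ^+ n)).
  by rewrite /rem -addrA -opprD gerBl// addr_ge0// !mulr_ge0 ?exprn_ge0// ltW.
by rewrite lerXn2r// nnegrE ?(le_trans _ Yr)// addr_ge0// ltW.
Qed.

(** A Cauchy estimate: the nonnegative remainder at [|Y|] and [t] says that [n * t * |Y| ^+ n.-1] is
    at most [(|Y| + t) ^+ n]. *)
Lemma expr_deriv_le Y t r n : 0 < t -> `|Y| + t <= r ->
  `|n%:R * Y ^+ n.-1| <= r ^+ n / t.
Proof.
move=> t0 Yr; rewrite ler_pdivlMr// normrM normr_nat normrX mulrAC.
have := rem_ge0 n (normr_ge0 Y) (ltW t0); rewrite /rem -addrA -opprD subr_ge0.
move=> h; apply: (@le_trans _ _ ((`|Y| + t) ^+ n)); last first.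
  by rewrite lerXn2r// nnegrE ?(le_trans _ Yr)// addr_ge0// ltW.
by apply: le_trans h; rewrite lerDr exprn_ge0.
Qed.

End TaylorBound.

Section PowerSeries.
Variables (R : realType) (d : nat) (K : choiceType).
Implicit Types (h : 'rV[R]_d -> R) (a : K -> R) (e : K -> 'I_d -> nat) (r : R).

(* The family of exponents is arbitrary (and may repeat), so that a partial
   derivative keeps the index set of the series and needs no reindexing. *)
Definition psum_on r h a e :=
  [/\ 0 < r, rsummable (fun k => a k * r ^+ mdeg (e k)) &
    forall y : 'rV[R]_d, (forall i, `|y 0 i| < r) ->
      h y = ssum (fun k => a k * mono (e k) y)].

Lemma rsummable_mono r a e (y : 'rV[R]_d) :
  rsummable (fun k => a k * r ^+ mdeg (e k)) -> (forall i, `|y 0 i| <= r) ->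
  rsummable (fun k => a k * mono (e k) y).
Proof.
move=> sa yr; apply: (rsummable_le (rsummable_abs sa)) => k.
rewrite !normrM ler_wpM2l// (le_trans (mono_le _ yr))//.
by rewrite ler_norm.
Qed.

(** A quadratic error bound identifies the derivative, so that no limit is ever exchanged with an
    infinite sum. *)
Lemma derive_quadratic h (v y : 'rV[R]_d) (L C t : R) : 0 < t ->
  (forall s, `|s| < t -> `|h (s *: v + y) - h y - s * L| <= C * s ^+ 2) ->
  'D_v h y = L.
Proof.
move=> t0 hL; apply/cvg_lim => //; apply/cvgrPdist_le => eps eps0.
have C0 : 0 < `|C| + 1 by rewrite ltr_pwDr.
near=> s.
have s0 : s != 0 by near: s; exact: nbhs_dnbhs_neq.
rewrite distrC /= -(ler_pM2l (_ : 0 < `|s|)) ?normr_gt0//.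
rewrite -normrM mulrBr [_ *: _]/(_ * _) mulrA divff// mul1r.
rewrite (le_trans (hL s _))//.
  near: s; apply: dnbhs0_lt => //.
rewrite (le_trans (ler_norm _))// normrM normrX expr2 mulrCA ler_wpM2l//.
rewrite (@le_trans _ _ ((`|C| + 1) * `|s|))// ?ler_wpM2r ?lerDl//.
rewrite mulrC -ler_pdivlMr//; near: s; apply: dnbhs0_le => //.
by rewrite divr_gt0.
Unshelve. all: by end_near. Qed.

Lemma mono_shift (s : R) (e : 'I_d -> nat) (y : 'rV[R]_d) j :
  mono e (s *: delta_mx 0 j + y)
  = (y 0 j + s) ^+ e j * \prod_(i | i != j) y 0 i ^+ e i.
Proof.
rewrite (monoD1 _ _ j) !mxE !eqxx mulr1 [s + _]addrC; congr (_ * _).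
apply: eq_bigr => i ij; rewrite !mxE (negbTE ij) andbF mulr0 add0r.
by [].
Qed.

Lemma prodr_le_expr (e : 'I_d -> nat) (y : 'rV[R]_d) j r :
  (forall i, `|y 0 i| <= r) ->
  `|\prod_(i | i != j) y 0 i ^+ e i| <= r ^+ (\sum_(i | i != j) e i).
Proof.
move=> yr; rewrite normr_prod.
rewrite (big_morph _ (fun m n => exprD r m n) (expr0 r));
  apply: ler_prod => i _.
by rewrite normr_ge0 normrX lerXn2r// nnegrE// (le_trans (normr_ge0 _) (yr i)).
Qed.

(** Termwise differentiation. Half of the radius is given up to serve as the increment [t] of the
    Cauchy and Taylor bounds. *)
Lemma psum_on_partial r h a e j : psum_on r h a e ->
  psum_on (r / 2) (partial j h)
    (fun k => a k * (e k j)%:R) (fun k => dec (e k) j).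
Proof.
move=> [r0 sa hE].
have dle (t rho : R) (y : 'rV[R]_d) k : 0 < t -> rho + t <= r ->
    (forall i, `|y 0 i| <= rho) ->
    `|(e k j)%:R * mono (dec (e k) j) y| <= t^-1 * r ^+ mdeg (e k).
  move=> t0 tr yr; have rho_ge0 : 0 <= rho := le_trans (normr_ge0 _) (yr j).
  rewrite mono_dec mulrA normrM (mdegD1 _ j) exprD mulrA ler_pM//.
    by rewrite [leRHS]mulrC expr_deriv_le// (le_trans _ tr)// lerD2r.
  apply: prodr_le_expr => i; rewrite (le_trans (yr i))//.
  by rewrite (le_trans _ tr)// lerDl ltW.
have sd (t rho : R) (y : 'rV[R]_d) : 0 < t -> rho + t <= r ->
    (forall i, `|y 0 i| <= rho) ->
    rsummable (fun k => a k * (e k j)%:R * mono (dec (e k) j) y).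
  move=> t0 tr yr.
  apply: (rsummable_le (rsummable_abs (rsummableZ t^-1 sa))) => k.
  rewrite -mulrA [leLHS]normrM (mulrCA t^-1) [leRHS]normrM ler_wpM2l//.
  by rewrite (le_trans (dle _ _ _ _ t0 tr yr))// ler_norm.
split => [||y yr]; first by rewrite divr_gt0.
  (* At the constant vector [r / 2] a monomial becomes [(r / 2) ^+ mdeg], which is the summability
     that [psum_on] requires. *)
  have := sd (r / 2) (r / 2) (const_mx (r / 2)).
  rewrite -splitr lexx divr_gt0// => /(_ erefl erefl).
  under eq_fun => k.
    rewrite /mono; under eq_bigr do rewrite mxE.
    rewrite -(big_morph _ (fun m n => exprD (r / 2) m n) (expr0 (r / 2))).
    over.
  by apply => i; rewrite mxE ger0_norm// divr_ge0// ltW.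
have yr2 i : `|y 0 i| <= r / 2 by exact: ltW.
have r20 : 0 < r / 2 by rewrite divr_gt0.
have yrr i : `|y 0 i| < r by rewrite (lt_le_trans (yr i))// ler_pdivrMr//
  ler_peMr ?ltW// ltr1n.
(* [expr_taylor2] with [t = r / 2], applied to the [j]-th coordinate of each term and summed, gives
   the quadratic error [S / (r / 2) ^+ 2 * s ^+ 2]. *)
pose S := ssum (fun k => `|a k * r ^+ mdeg (e k)|).
apply: (@derive_quadratic _ _ _ _ (S / (r / 2) ^+ 2) (r / 2)) => // s sr.
have ysr i : `|(s *: delta_mx 0 j + y) 0 i| < r.
  rewrite !mxE; apply: (le_lt_trans (ler_normD _ _)).
  rewrite [r]splitr ltr_leD// normrM eqxx/=.
  by case: eqP => _; rewrite ?normr1 ?mulr1// normr0 mulr0.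
rewrite !hE//.
have s1 := rsummable_mono sa (fun i => ltW (ysr i)).
have s2 := rsummable_mono sa (fun i => ltW (yrr i)).
have s3 : rsummable (fun k => a k * (e k j)%:R * mono (dec (e k) j) y).
  by apply: (sd (r / 2) (r / 2)) => //; rewrite -splitr.
rewrite -ssumB// -ssumZ// -ssumB//; last 2 first.
- have -> : (fun k => a k * mono (e k) (s *: delta_mx 0 j
  + y) - a k * mono (e k) y) = (fun k => a k * mono (e k) (s *: delta_mx 0 j
  + y) + (-1) * (a k * mono (e k) y)).
    by apply/funext => k; rewrite mulN1r.
  by apply: rsummableD => //; exact: rsummableZ.
- exact: rsummableZ.
rewrite mulrAC [S * _]mulrC mulrAC -expr_div_n -ssumZ;
  last exact: rsummable_abs.
apply: ler_norm_ssum; first by apply: rsummableZ; exact: rsummable_abs.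
move=> k; rewrite mono_shift (monoD1 _ _ j) mono_dec.
set P := \prod_(i | _) _; set Y := y 0 j; set n := e k j.
have -> : a k * ((Y + s) ^+ n * P) - a k * (Y ^+ n * P) - s * (a k * n%:R * (Y
  ^+ n.-1 * P))
  = a k * (((Y + s) ^+ n - Y ^+ n - n%:R * s * Y ^+ n.-1) * P) by ring.
rewrite normrM [`|a k * r ^+ _|]normrM mulrCA ler_wpM2l// normrM.
rewrite (mdegD1 _ j) exprD normrM mulrA ler_pM//.
  rewrite [`|_ ^+ e k j|]ger0_norm ?exprn_ge0 ?(ltW r0)//.
  apply: expr_taylor2 => //; first exact: ltW.
  by rewrite [leRHS]splitr lerD2r yr2.
rewrite [leRHS]ger0_norm ?exprn_ge0 ?(ltW r0)//.
by apply: prodr_le_expr => i; exact: ltW.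
Qed.

End PowerSeries.

Section Analytic.
Variables (R : realType) (d : nat).
Implicit Types (f : 'rV[R]_d -> R) (p : 'rV[R]_d).

(** Absolute convergence on the polydisc is convergence at the constant vector [r / 2]. That vector
    lies in the ball of radius [r] because balls of row vectors are taken entrywise, whence the
    halved radius. *)
Lemma analytic_psum f p : analytic_at f p ->
  exists (a : {ffun 'I_d -> nat} -> R) (r : R),
    psum_on r (fun y => f (y + p)) a (fun k i => k i).
Proof.
move=> [a [r [r0 hf]]]; exists a, (r / 2).
have r20 : 0 < r / 2 by rewrite divr_gt0.
have r2r : r / 2 < r by rewrite [ltRHS]splitr ltrDl.
have inb (y : 'rV[R]_d) : (forall i, `|y 0 i| <= r / 2) -> ball p r (y + p).
  move=> yr; split=> // i j; rewrite ord1 /ball/= !mxE.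
  by rewrite opprD addrCA subrr addr0 normrN (le_lt_trans (yr j)).
split => // [|y yr].
  have /inb/hf : forall i, `|(const_mx (r / 2) : 'rV[R]_d) 0 i| <= r / 2.
    by move=> i; rewrite mxE ger0_norm// ltW.
  move=> [+ _]; rewrite addrK; congr (summable _ _).
  apply/funext => k; congr (_ * _)%:E.
  under eq_bigr do rewrite mxE.
  by rewrite -(big_morph _ (fun m n => exprD (r / 2) m n) (expr0 (r / 2))).
have /inb/hf : forall i, `|y 0 i| <= r / 2 by move=> i; exact: ltW.
by move=> [_]; rewrite addrK => h; rewrite -[LHS]/(fine (f (y + p))%:E) h.
Qed.

End Analytic.

(** * Taylor expansion at the origin, ordered by weight *)

Section Expansion.
Variables (R : realType) (n : nat).
Implicit Types (h : 'rV[R]_(1 + n) -> R) (k : 'I_(1 + n) -> nat).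
Implicit Types (x s : R) (z : 'rV[R]_n).

Definition qform (A : 'M[R]_n) z : R := (z *m A *m z^T) 0 0.

Lemma qformE A z : qform A z = \sum_i \sum_j z 0 i * z 0 j * A i j.
Proof.
rewrite /qform mxE exchange_big; apply: eq_bigr => j _.
rewrite !mxE big_distrl/=; apply: eq_bigr => i _.
by rewrite mulrAC.
Qed.

Lemma qformN A z : qform A (- z) = qform A z.
Proof. by rewrite /qform mulNmx linearN/= mulmxN mulNmx opprK. Qed.

Lemma pt00 : pt 0 (0 : 'rV[R]_n) = 0.
Proof. by rewrite /pt -scalemx1 scale0r row_mx0. Qed.

Lemma pt_x x z : pt x z 0 (xidx n) = x.
Proof. by rewrite /pt /xidx row_mxEl mxE eqxx mulr1n. Qed.

Lemma pt_z x z i : pt x z 0 (zidx i) = z 0 i.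
Proof. by rewrite /pt /zidx row_mxEr. Qed.

Lemma idxP (P : 'I_(1 + n) -> Prop) :
  P (xidx n) -> (forall i, P (zidx i)) -> forall i, P i.
Proof.
move=> Px Pz i; case: (split_ordP i) => [j ->|j ->]; last exact: Pz.
by rewrite ord1.
Qed.

Definition zdeg k : nat := (\sum_(i < n) k (zidx i))%N.
(* The Laplace scaling: x is of order 1/N and each z_i of order N^(-1/2), so x
   has weight 2 and z_i weight 1; N^(-j) is the size of weight 2j. *)
Definition wdeg k : nat := (2 * k (xidx n) + zdeg k)%N.

Lemma mdeg_split k : mdeg k = (k (xidx n) + zdeg k)%N.
Proof. by rewrite /mdeg big_split_ord big_ord1. Qed.

Lemma mono_split k x z :
  mono k (pt x z) = x ^+ k (xidx n) * \prod_(i < n) z 0 i ^+ k (zidx i).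
Proof.
rewrite /mono big_split_ord big_ord1 pt_x; congr (_ * _).
by apply: eq_bigr => i _; rewrite pt_z.
Qed.

Lemma mono_opp k x z : mono k (pt x (- z)) = (-1) ^+ zdeg k * mono k (pt x z).
Proof.
rewrite !mono_split [RHS]mulrCA; congr (_ * _).
rewrite /zdeg expr_sum -big_split/=.
by apply: eq_bigr => i _; rewrite mxE -exprNn.
Qed.

Lemma mono_wdeg_le k x z s : 0 <= x <= s ^+ 2 -> (forall i, `|z 0 i| <= s) ->
  `|mono k (pt x z)| <= s ^+ wdeg k.
Proof.
move=> /andP[x0 xs] zs; rewrite mono_split normrM /wdeg exprD exprM ler_pM//.
  by rewrite normrX ger0_norm// lerXn2r// nnegrE// sqr_ge0.
rewrite /zdeg expr_sum normr_prod.
apply: ler_prod => i _; rewrite normr_ge0 normrX lerXn2r// nnegrE//.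
by rewrite (le_trans _ (zs i)).
Qed.

(** A derived monomial survives at the origin only if the monomial was linear; multiplying by
    [y 0 j] then restores it, by Euler's identity. *)
Lemma mono_dec0 (d : nat) (k : 'I_d -> nat) (y : 'rV[R]_d) j :
  y 0 j * ((k j)%:R * mono (dec k j) 0)
  = (mdeg k == 1%N)%:R * ((k j)%:R * mono k y).
Proof.
have [kj0|kj] := posnP (k j); first by rewrite kj0 !mul0r !mulr0.
rewrite mono0 (mdeg_decS kj) eqSS.
case: eqP => [d0|_]; last by rewrite !mulr0 mul0r.
by rewrite mul1r -mono_decK mono_deg0// !mulr1 mulrC.
Qed.

Lemma mono_dec2 (d : nat) (k : 'I_d -> nat) (y : 'rV[R]_d) i j :
  y 0 i * y 0 j * ((k j)%:R * (dec k j i)%:R * mono (dec (dec k j) i) 0)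
  = (mdeg k == 2)%:R * ((k j)%:R * (dec k j i)%:R * mono k y).
Proof.
transitivity ((k j)%:R * y 0 j
    * (y 0 i * ((dec k j i)%:R * mono (dec (dec k j) i) 0))); first by ring.
rewrite mono_dec0.
have [kj0|kj] := posnP (k j); first by rewrite kj0 !mul0r !(mulr0, mul0r).
rewrite [in RHS](mdeg_decS kj) eqSS.
transitivity ((mdeg (dec k j) == 1%N)%:R * (dec k j i)%:R
    * ((k j)%:R * (y 0 j * mono (dec k j) y))); first by ring.
by rewrite mono_decK; ring.
Qed.

Lemma dec_sum_z k j : (0 < k (zidx j))%N ->
  (\sum_(i < n) dec k (zidx j) (zidx i) = (zdeg k).-1)%N.
Proof.
move=> kj; rewrite /zdeg (bigD1 j)//= [in RHS](bigD1 j)//=.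
rewrite /dec eqxx subn1; have -> : (k (zidx j)
  + \sum_(i < n | i != j) k (zidx i)).-1%N = ((k (zidx j)).-1
  + \sum_(i < n | i != j) k (zidx i))%N.
  by case: (k (zidx j)) kj.
congr (_ + _)%N; apply: eq_bigr => i ij.
by rewrite (inj_eq (@rshift_inj _ _)) (negbTE ij) subn0.
Qed.

Lemma dec_sum_zz k :
  (\sum_(i < n) \sum_(j < n) k (zidx j) * dec k (zidx j) (zidx i)
    = zdeg k * (zdeg k).-1)%N.
Proof.
rewrite exchange_big /= [X in (X * _)%N]/zdeg big_distrl/=;
  apply: eq_bigr => j _.
rewrite -big_distrr/=; have [->//|kj] := posnP (k (zidx j)).
by rewrite dec_sum_z.
Qed.

(** The monomials of weight at most 2 are 1, x, the z_i and the products of two z_i; they are picked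
    out by the value, the derivative in x, the gradient and the Hessian in z at the origin. *)
Lemma mono_taylor2 k x z :
  (if (wdeg k <= 2)%N then mono k (pt x z) else 0)
  = mono k 0
    + x * ((k (xidx n))%:R * mono (dec k (xidx n)) 0)
    + \sum_(i < n) z 0 i * ((k (zidx i))%:R * mono (dec k (zidx i)) 0)
    + (\sum_(i < n) \sum_(j < n) z 0 i * z 0 j
         * ((k (zidx j))%:R * (dec k (zidx j) (zidx i))%:R
            * mono (dec (dec k (zidx j)) (zidx i)) 0)) / 2.
Proof.
set y := pt x z.
have e1 : x * ((k (xidx n))%:R * mono (dec k (xidx n)) 0)
    = (mdeg k == 1%N)%:R * ((k (xidx n))%:R * mono k y).
  by rewrite -mono_dec0 pt_x.
have e2 : \sum_(i < n) z 0 i * ((k (zidx i))%:R * mono (dec k (zidx i)) 0)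
    = (mdeg k == 1%N)%:R * ((zdeg k)%:R * mono k y).
  rewrite natr_sum mulr_suml mulr_sumr; apply: eq_bigr => i _.
  by rewrite -mono_dec0 pt_z.
have e3 : \sum_(i < n) \sum_(j < n) z 0 i * z 0 j
         * ((k (zidx j))%:R * (dec k (zidx j) (zidx i))%:R
            * mono (dec (dec k (zidx j)) (zidx i)) 0)
    = (mdeg k == 2)%:R * ((zdeg k * (zdeg k).-1)%:R * mono k y).
  rewrite -dec_sum_zz natr_sum mulr_suml mulr_sumr; apply: eq_bigr => i _.
  rewrite natr_sum mulr_suml mulr_sumr; apply: eq_bigr => j _.
  by rewrite natrM -mono_dec2 !pt_z.
rewrite e1 e2 e3 mono0 mdeg_split /wdeg.
have [k0|k1|k2|] : [\/ (k (xidx n) + zdeg k = 0)%N, (k (xidx n) + zdeg k = 1)%N,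
    (k (xidx n) + zdeg k = 2)%N | (2 < k (xidx n) + zdeg k)%N].
  case: (k (xidx n) + zdeg k)%N => [|[|[|m]]];
    by [constructor 1|constructor 2|constructor 3|constructor 4].
- move/eqP: k0; rewrite addn_eq0 => /andP[/eqP k0 /eqP k1].
  rewrite k0 k1 /= mono_deg0; last by rewrite mdeg_split k0 k1.
  by rewrite !mul0r !addr0.
- rewrite k1 /= !mul0r add0r addr0.
  case: (k (xidx n)) (zdeg k) k1 => [|[|u]] [|[|v]]//= _.
    by rewrite !mul1r !mul0r add0r.
  by rewrite !mul1r !mul0r addr0.
(* In degree 2, the monomials x^2 and x z_i have weight 4 and 3, and the factor
   [zdeg k * (zdeg k).-1] kills them on the right. Quadratics in z get 2 / 2 = 1. *)
- rewrite k2 /= !mul0r !add0r.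
  case: (k (xidx n)) (zdeg k) k2 => [|[|[|u]]] [|[|[|v]]]//= _;
    rewrite ?mul0r ?mulr0 ?mul0r//.
  by rewrite mul1r mulrAC divff// mul1r.
- move=> k3; rewrite leqNgt (leq_trans k3) ?leq_add2r ?leq_pmull//=.
  by case: (_ + _)%N k3 => [|[|[|m]]]// _; rewrite /= !mul0r !addr0.
Qed.

(** The Taylor polynomial cut by weight rather than by degree, hence without terms in x^2 or x
    z_i. *)
Definition taylor2 h x z : R :=
  h 0 + x * diff_x h 0 + \sum_(i < n) z 0 i * grad_z h 0 0 i
    + qform (hess_z h 0) z / 2.

Lemma taylor2N h x z : taylor2 h x z + taylor2 h x (- z)
  = 2 * (h 0 + x * diff_x h 0 + qform (hess_z h 0) z / 2).
Proof.
rewrite /taylor2 qformN.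
have -> : \sum_(i < n) (- z) 0 i * grad_z h 0 0 i
    = - \sum_(i < n) z 0 i * grad_z h 0 0 i.
  by rewrite -sumrN; apply: eq_bigr => i _; rewrite mxE mulNr.
by ring.
Qed.

Section Coefficients.
Variables (h : 'rV[R]_(1 + n) -> R) (r : R).
Variable a : {ffun 'I_(1 + n) -> nat} -> R.
Hypothesis ha : psum_on r h a (fun m i => m i).

Let ha1 j : psum_on (r / 2) (partial j h)
  (fun m : {ffun 'I_(1 + n) -> nat} => a m * (m j)%:R) (fun m => dec m j).
Proof. exact: psum_on_partial. Qed.

Let ha2 i j : psum_on (r / 2 / 2) (partial i (partial j h))
  (fun m : {ffun 'I_(1 + n) -> nat} => a m * (m j)%:R * (dec m j i)%:R)
  (fun m => dec (dec m j) i).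
Proof. exact: (psum_on_partial i (ha1 j)). Qed.

Let at0 (K : choiceType) (h' : 'rV[R]_(1 + n) -> R) r' (a' : K -> R) (e : K
  -> 'I_(1 + n) -> nat) :
  psum_on r' h' a' e ->
  h' 0 = ssum (fun m => a' m * mono (e m) 0) /\
  rsummable (fun m => a' m * mono (e m) 0).
Proof.
move=> [r0 sa hE]; have y0 i : `|(0 : 'rV[R]_(1 + n)) 0 i| < r'.
  by rewrite mxE normr0.
by split; [exact: hE|apply: (rsummable_mono sa) => i; exact: ltW].
Qed.

(** The two orders of differentiation give the same series term by term, because the decrements
    commute and so do the integer factors they produce. *)
Lemma hess_z_sym : (hess_z h 0)^T = hess_z h 0.
Proof.
apply/matrixP => i j; rewrite !mxE.
have [-> _] := at0 (ha2 (zidx i) (zidx j)).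
have [-> _] := at0 (ha2 (zidx j) (zidx i)).
congr ssum; apply/funext => k; rewrite -!mulrA; congr (_ * _).
rewrite !mulrA -!natrM; congr (_ * _); last congr (mono _ _).
  congr (_%:R).
  rewrite /dec; have [->//|ij] := eqVneq i j.
  rewrite !(inj_eq (@rshift_inj _ _)) eq_sym (negbTE ij) !subn0 mulnC.
  by [].
by apply/funext => l; rewrite /dec subnAC.
Qed.

(** Written this way, the Taylor polynomial can be subtracted under the sum, leaving the subseries
    of weight at least 3, to which termwise bounds apply. *)
Lemma taylor2_ssum x z :
  rsummable (fun k : {ffun 'I_(1 + n) -> nat} =>
    a k * (if (wdeg k <= 2)%N then mono k (pt x z) else 0)) /\
  taylor2 h x z = ssum (fun k : {ffun 'I_(1 + n) -> nat} =>
    a k * (if (wdeg k <= 2)%N then mono k (pt x z) else 0)).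
Proof.
under eq_fun do rewrite mono_taylor2 !mulrDr.
have [h0 s0] := at0 ha.
have [hx sx] := at0 (ha1 (xidx n)).
pose tx (k : {ffun 'I_(1 + n) -> nat}) := x * (a k * (k (xidx n))%:R * mono
  (dec k (xidx n)) 0).
pose tz i (k : {ffun 'I_(1 + n) -> nat}) := z 0 i * (a k * (k (zidx i))%:R *
  mono (dec k (zidx i)) 0).
pose tzz i j (k : {ffun 'I_(1 + n) -> nat}) := z 0 i * z 0 j * (a k * (k (zidx
  j))%:R
   * (dec k (zidx j) (zidx i))%:R * mono (dec (dec k (zidx j)) (zidx i)) 0).
have -> : (fun k : {ffun 'I_(1 + n) -> nat} => a k * mono k 0
    + a k * (x * ((k (xidx n))%:R * mono (dec k (xidx n)) 0))
    + a k * \sum_(i < n) z 0 i * ((k (zidx i))%:R * mono (dec k (zidx i)) 0)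
    + a k * ((\sum_(i < n) \sum_(j < n) z 0 i * z 0 j
         * ((k (zidx j))%:R * (dec k (zidx j) (zidx i))%:R
            * mono (dec (dec k (zidx j)) (zidx i)) 0)) / 2))
  = (fun m => a m * mono m 0 + tx m + \sum_i tz i m
       + 2^-1 * \sum_i \sum_j tzz i j m).
  apply/funext => k; congr (_ + _ + _ + _).
  - by rewrite /tx; ring.
  - by rewrite mulr_sumr; apply: eq_bigr => i _; rewrite /tz; ring.
  - rewrite mulrCA mulrA mulrC; congr (_ * _).
    rewrite mulr_suml; apply: eq_bigr => i _.
    by rewrite mulr_suml; apply: eq_bigr => j _; rewrite /tzz; ring.
have stx : rsummable tx by exact: rsummableZ.
have stz i : rsummable (tz i).
  by apply: rsummableZ; have [] := at0 (ha1 (zidx i)).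
have stzz i j : rsummable (tzz i j).
  by apply: rsummableZ; have [] := at0 (ha2 (zidx i) (zidx j)).
have stz' := rsummable_sum stz.
have stzz' i := rsummable_sum (stzz i).
have stzz'' := rsummable_sum stzz'.
have s3 := rsummableZ 2^-1 stzz''.
have s12 := rsummableD s0 stx.
have s123 := rsummableD s12 stz'.
split; first exact: rsummableD.
rewrite (ssumD s123 s3) (ssumD s12 stz') (ssumD s0 stx) (ssumZ _ stzz'').
rewrite (ssum_sum stz) (ssum_sum stzz') /taylor2 h0 (ssumZ _ sx) -hx.
congr (_ + _ + _).
  apply: eq_bigr => i _; rewrite mxE ssumZ;
    last by have [] := at0 (ha1 (zidx i)).
  by have [<-] := at0 (ha1 (zidx i)).
rewrite mulrC qformE; congr (_ * _); apply: eq_bigr => i _.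
rewrite (ssum_sum (stzz i)); apply: eq_bigr => j _.
rewrite mxE ssumZ; last by have [] := at0 (ha2 (zidx i) (zidx j)).
by have [<-] := at0 (ha2 (zidx i) (zidx j)).
Qed.

(** A term of weight at least p is bounded by [(s / r1) ^+ p] times its size at radius [r]. The
    plain remainder starts at p = 3, the symmetrized one at p = 4. *)
Lemma psum_on_expansion : exists C r1 : R, 0 < r1 /\
  forall x z s, 0 <= x <= s ^+ 2 -> (forall i, `|z 0 i| <= s) -> 0 <= s <= r1 ->
    `|h (pt x z) - taylor2 h x z| <= C * s ^+ 3 /\
    `|h (pt x z) + h (pt x (- z)) - (taylor2 h x z + taylor2 h x (- z))|
      <= C * s ^+ 4.
Proof.
have [r0 sa hE] := ha.
(* [r1 <= 1] yields both [s ^+ 2 <= s], which keeps x inside the polydisc, and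
   [r1 ^+ wdeg k <= r1 ^+ mdeg k], which passes from weight to degree. *)
pose r1 := Num.min 1 (r / 2).
have r10 : 0 < r1 by rewrite lt_min ltr01 divr_gt0.
have r1le1 : r1 <= 1 by rewrite ge_min lexx.
have r1r : r1 < r.
  rewrite gt_min; apply/orP; right.
  by rewrite ltr_pdivrMr// ltr_pMr// ltr1n.
pose S := ssum (fun m => `|a m * r ^+ mdeg (fun i => m i)|).
have ssa := rsummable_abs sa.
have S0 : 0 <= S by apply: le_trans (ler_norm_ssum ssa (fun=> lexx _)).
pose C := 2 * S / r1 ^+ 3 + 2 * S / r1 ^+ 4.
exists C, r1; split=> // x z s xs zs sr1.
move: (sr1) => /andP[s0 sr].
have s1 : s <= 1 by exact: le_trans r1le1.
have bnd p (k : {ffun 'I_(1 + n) -> nat}) (w : 'rV[R]_n) :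
    (forall i, `|w 0 i| <= s) -> (p <= wdeg k)%N ->
    `|a k * mono k (pt x w)| <= (s / r1) ^+ p * `|a k * r ^+ mdeg k|.
  move=> ws pk; rewrite !normrM mulrCA ler_wpM2l//.
  rewrite (le_trans (mono_wdeg_le k xs ws))//.
  rewrite (@le_trans _ _ ((s / r1) ^+ p * r1 ^+ wdeg k))//.
    rewrite -(subnK pk) addnC !exprD mulrA -exprMn divfK ?gt_eqF//.
    by rewrite ler_wpM2l ?exprn_ge0// lerXn2r ?nnegrE ?(ltW r10).
  rewrite ler_wpM2l ?exprn_ge0 ?divr_ge0 ?(ltW r10)//.
  rewrite ger0_norm ?exprn_ge0 ?(ltW r0)//.
  apply: (@le_trans _ _ (r1 ^+ mdeg k)); last first.
    by rewrite lerXn2r ?nnegrE ?ltW.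
  by rewrite ler_wiXn2l ?(ltW r10)// mdeg_split leq_add2r leq_pmull.
have [Cs Cs'] : (s / r1) ^+ 3 * S <= C * s ^+ 3
    /\ 2 * (s / r1) ^+ 4 * S <= C * s ^+ 4.
  have i3 : 0 <= S / r1 ^+ 3 by rewrite divr_ge0// exprn_ge0// ltW.
  have i4 : 0 <= S / r1 ^+ 4 by rewrite divr_ge0// exprn_ge0// ltW.
  rewrite /C -!(mulrA 2 S); split.
    have -> : (s / r1) ^+ 3 * S = S / r1 ^+ 3 * s ^+ 3.
      by rewrite expr_div_n [LHS]mulrC mulrCA [LHS]mulrC.
    by rewrite ler_wpM2r ?exprn_ge0//; lra.
  have -> : 2 * (s / r1) ^+ 4 * S = 2 * (S / r1 ^+ 4) * s ^+ 4.
    by field; rewrite gt_eqF.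
  by rewrite ler_wpM2r ?exprn_ge0//; lra.
have pts (w : 'rV[R]_n) : (forall i, `|w 0 i| <= s) ->
    forall i, `|pt x w 0 i| < r.
  move=> ws; apply: idxP => [|i].
    rewrite pt_x; move: xs => /andP[x0 xs]; rewrite ger0_norm//.
    rewrite (le_lt_trans xs)// (le_lt_trans _ r1r)// (le_trans _ sr)//.
    by rewrite expr2 ler_piMr.
  by rewrite pt_z (le_lt_trans (ws i))// (le_lt_trans sr).
have zNs i : `|(- z) 0 i| <= s by rewrite mxE normrN.
have sm (w : 'rV[R]_n) (ws : forall i, `|w 0 i| <= s) :=
  rsummable_mono sa (fun i => ltW (pts w ws i)).
have dE (w : 'rV[R]_n) : (forall i, `|w 0 i| <= s) ->
    h (pt x w) - taylor2 h x w
    = ssum (fun k : {ffun 'I_(1 + n) -> nat} =>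
        if (wdeg k <= 2)%N then 0 else a k * mono k (pt x w)).
  move=> ws; rewrite (hE _ (pts w ws)); have [st ->] := taylor2_ssum x w.
  rewrite -ssumB//; last exact: sm.
  congr ssum; apply/funext => k; case: ifP => _; first by rewrite subrr.
  by rewrite mulr0 subr0.
split.
  rewrite dE// (le_trans _ Cs)// -ssumZ//.
  apply: ler_norm_ssum => [|k]; first exact: rsummableZ.
  case: leqP => [_|wk]; last exact: bnd.
  by rewrite normr0 mulr_ge0// exprn_ge0// divr_ge0// ltW.
rewrite opprD addrACA !dE// -ssumD; last 2 first.
  apply: (rsummable_le (rsummable_abs (sm _ zs))) => k.
  by case: ifP; rewrite ?normr0.
  apply: (rsummable_le (rsummable_abs (sm _ zNs))) => k.
  by case: ifP; rewrite ?normr0.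
rewrite (le_trans _ Cs')// -ssumZ//.
apply: ler_norm_ssum => [|k]; first exact: rsummableZ.
have p4 : 0 <= 2 * (s / r1) ^+ 4 * `|a k * r ^+ mdeg k|.
  by rewrite mulr_ge0// mulr_ge0// exprn_ge0// divr_ge0// ltW.
have [_|wk] := leqP; first by rewrite addr0 normr0.
case: (leqP 4 (wdeg k)) => [wk4|].
  rewrite -mulrA (le_trans (ler_normD _ _))// [leRHS]mulr_natl mulr2n lerD//
    bnd//.
rewrite ltnS => wk3; have {}wk3 : wdeg k = 3 by apply/eqP; rewrite eqn_leq wk3.
(* As x has even weight, the parity of the weight is the parity in z: weight-3 monomials are odd in
   z and cancel. *)
have zk : odd (zdeg k) by have /= := congr1 odd wk3; rewrite /wdeg oddD oddM /=.
by rewrite mono_opp -signr_odd zk expr1 mulN1r mulrN subrr normr0.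
Qed.

End Coefficients.
End Expansion.

(** * Continuity and measurability of analytic functions *)

Section RowContinuity.
Variables (R : realType) (d : nat).
Implicit Types (f : 'rV[R]_d -> R) (p : 'rV[R]_d).

Lemma continuous_rVP f p : {for p, continuous f} <->
  forall e : R, 0 < e -> exists2 r : R, 0 < r &
    forall y : 'rV[R]_d, (forall i, `|y 0 i - p 0 i| < r) -> `|f y - f p| < e.
Proof.
split => [cf e e0|cf].
  move/cvgrPdist_lt : cf => /(_ _ e0)/nbhs_ballP[r r0 rP]; exists r => // y yr.
  rewrite distrC; apply: rP; split=> // i j.
  by rewrite ord1 /ball/= distrC.
apply/(@cvgrPdist_lt _ _ _ (nbhs p) (nbhs_filter p)) => e /cf[r r0 rP];
  apply/nbhs_ballP; exists r => //= y [_ yr].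
by rewrite distrC; apply: rP => i; rewrite distrC; exact: yr.
Qed.

Lemma analytic_continuous f p : analytic_at f p -> {for p, continuous f}.
Proof.
move=> /analytic_psum[a [r [r0 sa hE]]].
pose S := ssum (fun m => `|a m * r ^+ mdeg (fun i => m i)|).
have ssa := rsummable_abs sa.
have S0 : 0 <= S by apply: le_trans (ler_norm_ssum ssa (fun=> lexx _)).
apply/continuous_rVP => e e0.
(* All terms of positive degree together are at most [dl / r * S], which this choice puts below [e];
   the summand 1 makes the inequality strict and the divisor positive. *)
pose dl := Num.min (r / 2) (e / (S / r + 1)).
have Sr0 : 0 < S / r + 1 by rewrite ltr_wpDl// divr_ge0// ltW.
have dl0 : 0 < dl by rewrite lt_min !divr_gt0.
have dlr : dl < r.
  by rewrite gt_min [X in _ < X]splitr ltrDl divr_gt0.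
exists dl => // y yd.
have yd' i : `|(y - p) 0 i| <= dl by rewrite !mxE ltW.
have [yr zr] : (forall i, `|(y - p) 0 i| < r) /\
    (forall i, `|(0 : 'rV[R]_d) 0 i| < r).
  by split => i; [exact: le_lt_trans dlr|rewrite mxE normr0].
have -> : f y - f p = ssum (fun m => a m * mono m (y - p) - a m * mono m 0).
  rewrite ssumB.
  - by rewrite -!hE// subrK add0r.
  - by apply: (rsummable_mono sa) => i; exact: ltW.
  - by apply: (rsummable_mono sa) => i; exact: ltW.
apply: (@le_lt_trans _ _ (dl / r * S)).
  rewrite -ssumZ//; apply: ler_norm_ssum => [|m]; first exact: rsummableZ.
  have [m0|m0] := eqVneq (mdeg m) 0%N.
    by rewrite !mono_deg0// subrr normr0 mulr_ge0// divr_ge0// ltW.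
  rewrite mono0 (negbTE m0) mulr0 subr0 !normrM mulrCA ler_wpM2l//.
  rewrite (le_trans (mono_le _ yd'))// ger0_norm ?exprn_ge0 ?(ltW r0)//.
  move: m0; case: (mdeg m) => // q _.
  rewrite !exprS mulrA divfK ?gt_eqF// ler_wpM2l ?(ltW dl0)//.
  by rewrite lerXn2r ?nnegrE ?(ltW dl0) ?(ltW r0)// ltW.
have : dl <= e / (S / r + 1) by rewrite ge_min lexx orbT.
rewrite ler_pdivlMr// => h; apply: lt_le_trans h.
by rewrite mulrDr mulr1 mulrAC -mulrA ltrDl.
Qed.

(* Row vectors carry no sigma-algebra; an open set of rows is instead covered by
   countably many rational boxes, whose preimages are measurable. *)
Lemma measurable_fun_continuous_rV d0 (T : measurableType d0) (D : set T)
    (u : T -> 'rV[R]_d) f :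
  measurable D -> (forall i, measurable_fun [set: T] (fun t => u t 0 i)) ->
  (forall t, D t -> {for u t, continuous f}) ->
  measurable_fun D (fun t => f (u t)).
Proof.
move=> mD mu cf.
apply: (measurability _ (RGenOInfty.measurableE R)) => _ [_ [c ->]] <-.
pose box (s : {ffun 'I_d -> rat} * rat) :=
  [set t | forall i, `|u t 0 i - ratr (s.1 i)| < ratr s.2].
pose good s := forall t, D t -> box s t -> c < f (u t).
have mbox s : measurable (box s).
  have -> : box s = \bigcap_(i in [set: 'I_d])
      ((fun t => u t 0 i) @^-1`
        `]ratr (s.1 i) - ratr s.2, ratr (s.1 i) + ratr s.2[).
    apply/seteqP; split => t bt i; first by move=> _ /=;
      rewrite in_itv/= -ltr_distl.
    by have := bt i I; rewrite /= in_itv/= -ltr_distl.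
  apply: fin_bigcap_measurable => [|i _]; first exact: finite_finset.
  by rewrite -[X in measurable X]setTI; apply: mu.
have -> : D `&` (fun t => f (u t)) @^-1` `]c, +oo[
    = D `&` \bigcup_(s in [set s | good s]) box s.
  apply/seteqP; split => t [Dt]; last first.
    by move=> [s gs bs]; split => //; rewrite /= in_itv/= andbT; exact: gs.
  rewrite /= in_itv/= andbT => cft; split => //.
  have /(continuous_rVP _ _).1 /(_ (f (u t) - c)) := cf t Dt.
  rewrite subr_gt0 => /(_ cft)[r r0 rP].
  (* The box has half-width [q < r / 2]: one half of [r] pays for moving the centre to a rational
     point, the other for the points of the box. *)
  have [q] := rat_in_itvoo (divr_gt0 r0 (ltr0Sn R 1)).
  rewrite in_itv/= => /andP[q0 qr].
  have cq i : exists q' : rat, `|u t 0 i - ratr q'| < ratr q.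
    have [|q'] := @rat_in_itvoo R (u t 0 i - ratr q) (u t 0 i + ratr q).
      by rewrite ltrD2l gtrN.
    by rewrite in_itv/= -ltr_distlC => ?; exists q'.
  pose s : {ffun 'I_d -> rat} * rat := ([ffun i => xchoose (cq i)], q).
  have bs : box s t by move=> i; rewrite /= ffunE; exact: (xchooseP (cq i)).
  exists s => //= t' Dt' bs'.
  have : `|f (u t') - f (u t)| < f (u t) - c.
    apply: rP => i; rewrite -(subrK (ratr (s.1 i)) (u t' 0 i)) -addrA.
    rewrite (le_lt_trans (ler_normD _ _))// [ltRHS]splitr ltrD//.
      exact: lt_trans (bs' i) qr.
    by rewrite distrC; exact: lt_trans (bs i) qr.
  by rewrite ltr_distl opprB addrC subrK => /andP[].
apply: measurableI => //; rewrite bigcup_mkcond.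
apply: countable_bigcupT_measurable => [|s]; first exact: countableP.
by case: ifP => _.
Qed.

End RowContinuity.

(** * One-dimensional integrals *)

Section OneDim.
Variable R : realType.
Local Notation mu := (@lebesgue_measure R).
Implicit Types (x s a b c p q r : R).

(** A single term of the exponential series at [b * s] already dominates the power. *)
Lemma exprn_expRN_bounded (k : nat) b : 0 < b ->
  exists2 C, 0 < C & forall s, 0 <= s -> s ^+ k * expR (- (b * s)) <= C.
Proof.
move=> b0; case: k => [|k].
  by exists 1 => // s s0; rewrite expr0 mul1r -expR0 ler_expR lerNl oppr0
    mulr_ge0// ltW.
have bk0 : 0 < b ^+ k.+1 by rewrite exprn_gt0.
exists (k.+1`!%:R / b ^+ k.+1); first by rewrite divr_gt0// ltr0n fact_gt0.
move=> s s0; rewrite expRN ler_pdivrMr ?expR_gt0// mulrAC ler_pdivlMr//.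
rewrite mulrC -exprMn -ler_pdivrMl ?ltr0n ?fact_gt0// mulrC.
rewrite (le_trans _ (expR_ge1Dxn k _)) ?mulr_ge0 ?(ltW b0)//.
by rewrite lerDr.
Qed.

Lemma exprn_expRN_cvg0 (k : nat) b : 0 < b ->
  x ^+ k * expR (- (b * x)) @[x --> +oo] --> (0 : R).
Proof.
move=> b0; have [C C0 hC] := exprn_expRN_bounded k.+1 b0.
apply/cvgrPdist_le => e e0; near=> x.
have x0 : 0 < x by near: x; exact: nbhs_pinfty_gt.
rewrite sub0r normrN ger0_norm; last first.
  by rewrite mulr_ge0 ?expR_ge0// exprn_ge0// ltW.
rewrite (@le_trans _ _ (C / x))//.
  by rewrite ler_pdivlMr// mulrC mulrA -exprS; apply: hC; exact: ltW.
rewrite ler_pdivrMr; last exact: x0.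
rewrite mulrC -ler_pdivrMr; last exact: e0.
by near: x; apply: nbhs_pinfty_ge; exact: num_real.
Unshelve. all: by end_near. Qed.

Lemma ge0_integral_opp (f : R -> \bar R) : measurable_fun [set: R] f ->
  (forall x, 0 <= f x)%E -> (\int[mu]_x f (- x)%R = \int[mu]_x f x)%E.
Proof.
move=> mf f0.
rewrite -[in LHS](preimage_setT (-%R : R -> measurableTypeR R)).
rewrite -(@ge0_integral_pushforward _ _ (measurableTypeR R) (measurableTypeR R)
  _ -%R (@oppr_measurable R setT) mu setT f)//.
by apply: eq_measure_integral => A mA _; exact: lebesgue_measureN.
Qed.

Lemma ge0_integral_affine (G : R -> R) c d : 0 < c -> continuous G ->
  (forall x, 0 <= G x) ->
  (\int[mu]_x (G x)%:E = c%:E * \int[mu]_x (G (c * x + d))%:E)%E.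
Proof.
move=> c0 cG G0; pose F := fun x : R => c * x + d.
have dF x : is_derive x 1 F c.
  apply: (is_derive_eq (is_deriveD (is_deriveZ c (is_derive_id x 1))
    (is_derive_cst d x 1))).
  by rewrite addr0 [_ *: _]mulr1.
have F'E : F^`()%classic = cst c.
  by apply/funext => x; rewrite derive1E derive_val.
rewrite (@increasing_ge0_integration_by_substitutionT R F G)//.
- rewrite -ge0_integralZl//=.
  + apply: eq_integral => x _; rewrite F'E /= -EFinM; congr (_%:E).
    by rewrite [LHS]mulrC.
  + apply/measurable_EFinP; apply: continuous_measurable_fun => x.
    apply: continuous_comp; last exact: cG.
    exact/differentiable_continuous/derivable1_diffP/(@ex_derive _ _ _ _ _ _ _
      (dF x)).
  + by move=> x _; rewrite lee_fin.
  + by rewrite lee_fin ltW.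
- by move=> x y xy; rewrite /F ltrD2r ltr_pM2l.
- by rewrite F'E; exact: cst_continuous.
- by rewrite F'E; exact: is_cvg_cst.
- by rewrite F'E; exact: is_cvg_cst.
- by apply/cvgrNyPle => M; near=> x; rewrite /F -lerBrDr -ler_pdivlMl//;
  near: x; exact: nbhs_ninfty_le.
- by apply/cvgryPge => M; near=> x; rewrite /F -lerBlDr -ler_pdivrMl//;
  near: x; exact: nbhs_pinfty_ge.
Unshelve. all: by end_near. Qed.

(* The antiderivative of x^m e^(-ax) that vanishes at +oo. *)
Fixpoint gamma_primitive (a : R) (m : nat) (x : R) : R :=
  if m is m'.+1 then m%:R / a * gamma_primitive a m' x
    - a^-1 * (x ^+ m * expR (- (a * x)))
  else - (a^-1 * expR (- (a * x))).

Lemma is_derive_exprn (n : nat) x :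
  is_derive x 1 (fun x : R => x ^+ n) (n%:R * x ^+ n.-1).
Proof.
apply: DeriveDef; first exact: exprn_derivable.
by rewrite exp_derive; exact: mulr1.
Qed.

Lemma is_derive_expRN a x :
  is_derive x 1 (fun x : R => expR (- (a * x))) (- a * expR (- (a * x))).
Proof.
have -> : (fun x : R => expR (- (a * x))) = expR \o (fun x => - a * x).
  by apply/funext => y /=; rewrite mulNr.
have h : is_derive x 1 (fun x => - a * x) (- a).
  apply: (is_derive_eq (is_deriveZ (- a) (is_derive_id x 1))).
  by rewrite [_ *: _]mulr1.
rewrite -[X in expR X]mulNr mulrC.
exact: (@is_derive1_comp _ expR (fun x => - a * x)).
Qed.

Lemma is_derive_gamma_primitive a m x : a != 0 ->
  is_derive x 1 (gamma_primitive a m) (x ^+ m * expR (- (a * x))).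
Proof.
move=> a0; have hE := is_derive_expRN a x.
elim: m => [|m ih] /=.
  apply: (is_derive_eq (is_deriveN (is_deriveZ a^-1 hE))).
  transitivity (- (a^-1 * (- a * expR (- (a * x))))); first by [].
  by rewrite expr0; field.
have hX : is_derive x 1 (fun x : R => x ^+ m.+1) (m.+1%:R * x ^+ m).
  exact: is_derive_exprn.
apply: (is_derive_eq (is_deriveB (is_deriveZ (m.+1%:R / a) ih)
  (is_deriveZ a^-1 (is_deriveM hX hE)))).
transitivity (m.+1%:R / a * (x ^+ m * expR (- (a * x)))
  - a^-1 * (x ^+ m.+1 * (- a * expR (- (a * x)))
            + expR (- (a * x)) * (m.+1%:R * x ^+ m))); first by [].
by rewrite exprS; move: (m.+1%:R : R) => c; field.
Qed.

Lemma gamma_primitive_cvg0 a m : 0 < a ->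
  gamma_primitive a m x @[x --> +oo] --> (0 : R).
Proof.
move=> a0; elim: m => [|m ih] /=.
  rewrite -oppr0; apply: cvgN; rewrite -(mulr0 a^-1); apply: cvgMr.
  by have := exprn_expRN_cvg0 0 a0; under eq_fun do rewrite expr0 mul1r.
have -> : (0 : R) = m.+1%:R / a * 0 - a^-1 * 0 by rewrite !mulr0 subr0.
by apply: cvgB; apply: cvgMr => //; exact: exprn_expRN_cvg0.
Qed.

Lemma gamma_primitive0 a m : 0 < a ->
  gamma_primitive a m 0 = - (m`!%:R / a ^+ m.+1).
Proof.
move=> a0; elim: m => [|m ih] /=.
  by rewrite mulr0 oppr0 expR0 fact0 expr1 mulr1 mul1r.
rewrite ih expr0n /= mul0r mulr0 subr0 factS natrM [a ^+ m.+2]exprS.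
by rewrite mulrN; congr (- _); rewrite invfM !mulrA; congr (_ * _);
  rewrite mulrAC.
Qed.

Lemma integral_exprn_expRN m a : 0 < a ->
  (\int[mu]_(x in `]0%R, +oo[) (x ^+ m * expR (- (a * x)))%:E
   = (m`!%:R / a ^+ m.+1)%:E)%E.
Proof.
move=> a0; have an0 : a != 0 by rewrite gt_eqF.
have dG x := is_derive_gamma_primitive m x an0.
have cf : continuous (fun x : R => x ^+ m * expR (- (a * x))).
  move=> x; apply: cvgM; first exact: exprn_continuous.
  have := is_derive_expRN a x => -[+ _].
  by move=> /derivable1_diffP/differentiable_continuous.
rewrite integral_itv_obnd_cbnd; last first.
  apply/measurable_EFinP; apply: measurable_funTS.
  exact: continuous_measurable_fun.
rewrite (@ge0_continuous_FTC2y _ _ (gamma_primitive a m) 0 0).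
- by rewrite gamma_primitive0// sub0e -EFinN opprK.
- by move=> x x0; rewrite mulr_ge0 ?expR_ge0// exprn_ge0.
- exact: continuous_subspaceT.
- exact: gamma_primitive_cvg0.
- by move=> x _; have [] := dG x.
- apply: cvg_at_right_filter; have [+ _] := dG 0.
  by move=> /derivable1_diffP/differentiable_continuous.
- by move=> x _; rewrite derive1E; have [_ ->] := dG x.
Qed.

Import gauss_integral_proof.

Lemma cvg_integral0_gauss :
  integral0_gauss x @[x --> +oo] --> (Num.sqrt pi / 2 : R).
Proof.
have : Num.sqrt (integral0_gauss x ^+ 2) @[x --> +oo] --> Num.sqrt (pi / 4 : R).
  by apply: continuous_cvg; [exact: sqrt_continuous|exact:
    cvg_integral0_gauss_sqr].
have -> : Num.sqrt (pi / 4) = Num.sqrt pi / 2 :> R.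
  rewrite sqrtrM ?pi_ge0// sqrtrV//; congr (_ / _).
  by rewrite (_ : 4 = 2 ^+ 2) ?sqrtr_sqr ?ger0_norm//; ring.
rewrite (_ : (fun _ => Num.sqrt _) = integral0_gauss)//.
by apply/funext => x; rewrite sqrtr_sqr ger0_norm// integral0_gauss_ge0.
Qed.

Lemma gauss_moment2 :
  (\int[mu]_x (x ^+ 2 * gauss_fun x)%:E = (Num.sqrt pi / 2)%:E)%E.
Proof.
(* Integration by parts: the derivative of [x * gauss_fun x] is [gauss_fun x - 2 * f x], so [F] is a
   primitive of [f] on x > 0. *)
pose F x : R := (integral0_gauss x - x * gauss_fun x) / 2.
pose f x : R := x ^+ 2 * gauss_fun x.
have cg := @continuous_gauss_fun R.
have gaussE x : gauss_fun x = expR (- x ^+ 2) :> R by [].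
have cf : continuous f by move=> x; apply: cvgM;
  [exact: exprn_continuous|exact: cg].
have f0 x : 0 <= f x by rewrite mulr_ge0 ?sqr_ge0// gauss_fun_ge0.
have dI x : 0 < x -> is_derive x 1 (@integral0_gauss R) (gauss_fun x).
  move=> x0; have xx1 : x < x + 1 by rewrite ltrDl.
  have [|d1 d2] := continuous_FTC1_closed xx1 _ x0 (cg x).
    apply: continuous_compact_integrable; first exact: segment_compact.
    exact: continuous_subspaceT.
  by apply: DeriveDef => //; rewrite -derive1E.
have dg x : is_derive x 1 (@gauss_fun R) (- 2 * x * gauss_fun x).
  have h : is_derive x 1 (fun x : R => - x ^+ 2) (- 2 * x).
    by apply: (is_derive_eq (is_deriveN (is_derive_exprn 2 x)));
      rewrite expr1 mulNr.
  rewrite mulrC; exact: (@is_derive1_comp _ expR (fun x => - x ^+ 2)).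
have dxg x : is_derive x 1 (fun x : R => x * gauss_fun x) (gauss_fun x - 2 * f
  x).
  apply: (is_derive_eq (is_deriveM (is_derive_id x 1) (dg x))).
  transitivity (x * (- 2 * x * gauss_fun x) + gauss_fun x * 1); first by [].
  by rewrite /f; ring.
have dF x : 0 < x -> is_derive x 1 F (f x).
  move=> x0; have -> : F = (fun x => 2^-1 *: (integral0_gauss x - x * gauss_fun
    x)).
    by apply/funext => y; rewrite /F [RHS]mulrC.
  apply: (is_derive_eq (is_deriveZ 2^-1 (is_deriveB (dI x x0) (dxg x)))).
  transitivity (2^-1 * (gauss_fun x - (gauss_fun x - 2 * f x))); first by [].
  by field.
rewrite (ge0_symfun_integralT f0 cf); last by move=> x;
  rewrite /f /= !gaussE !sqrrN.
rewrite -set_itvcy (@ge0_continuous_FTC2y _ f F 0 (Num.sqrt pi / 4)).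
- rewrite /F mul0r subr0 /integral0_gauss set_itv1 Rintegral_set1 mul0r sube0.
  by rewrite -EFinM; congr (_%:E); field.
- by move=> x _.
- exact: continuous_subspaceT.
- have -> : Num.sqrt pi / 4 = (Num.sqrt pi / 2 - 0) / 2 :> R by field.
  apply: cvgMl; apply: cvgB; first exact: cvg_integral0_gauss.
  apply/cvgrPdist_le => e e0; near=> x.
  have x1 : 1 < x by near: x; exact: nbhs_pinfty_gt.
  have x0 : 0 < x := lt_trans ltr01 x1.
  rewrite sub0r normrN ger0_norm ?mulr_ge0 ?gauss_fun_ge0 ?(ltW x0)//.
  rewrite gaussE expRN ler_pdivrMr ?expR_gt0//.
  rewrite (@le_trans _ _ (e * x ^+ 2)) ?ler_wpM2l ?(ltW e0)//; last first.
    by rewrite (le_trans _ (expR_ge1Dx _))// lerDr.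
  rewrite expr2 mulrA ler_peMl ?(ltW x0)// mulrC -ler_pdivrMr; last exact: e0.
  by near: x; apply: nbhs_pinfty_ge; exact: num_real.
- by move=> x x0; have [] := dF x x0.
- have -> : F 0 = (0 - 0 * gauss_fun 0) / 2.
    by rewrite /F /integral0_gauss set_itv1 Rintegral_set1.
  apply: cvg_at_right_filter; apply: cvgMl; apply: cvgB.
    apply: (@parameterized_integral_cvg_left _ 0 1) => //.
    apply: continuous_compact_integrable; first exact: segment_compact.
    exact: continuous_subspaceT.
  by apply: cvgM; [exact: cvg_id|exact: cg].
- by move=> x; rewrite in_itv/= andbT => x0; rewrite derive1E;
  have [_ ->] := dF x x0.
Unshelve. all: by end_near. Qed.

Lemma quadratic_ge0_coef p q r :
  (forall x, 0 <= p + q * x + r * x ^+ 2) -> 0 <= p /\ 0 <= r.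
Proof.
move=> h0; have p0 : 0 <= p by have := h0 0; rewrite mulr0 expr0n mulr0 !addr0.
split=> //.
  have h2 x : 0 <= p + r * x ^+ 2.
    have := addr_ge0 (h0 x) (h0 (- x)); rewrite sqrrN.
    have -> : p + q * x + r * x ^+ 2 + (p + q * - x + r * x ^+ 2)
      = 2 * (p + r * x ^+ 2) by ring.
    by rewrite pmulr_rge0.
  rewrite leNgt; apply/negP => r0.
  (* Chosen so that [p + r * x = r]. As [x >= 1] and [r < 0], squaring [x] only decreases the value,
     which is then negative. *)
  pose x := p / - r + 1.
  have x1 : 1 <= x by rewrite lerDr divr_ge0// oppr_ge0 ltW.
  have := h2 x; rewrite leNgt => /negP; apply.
  apply: (@le_lt_trans _ _ (p + r * x)).
    by rewrite lerD2l ler_nM2l// expr2 ler_peMr// (le_trans _ x1).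
  suff -> : p + r * x = r by [].
  by rewrite /x; field; rewrite lt_eqF.
Qed.

(** The integral is added to its reflection, which cancels the odd term [q * x] without leaving
    nonnegative integrands. *)
Lemma ge0_integral_gauss_quadratic p q r :
  (forall x, 0 <= p + q * x + r * x ^+ 2) ->
  (\int[mu]_x ((p + q * x + r * x ^+ 2) * gauss_fun x)%:E
   = ((p + r / 2) * Num.sqrt pi)%:E)%E.
Proof.
move=> h0; pose h x := (p + q * x + r * x ^+ 2) * gauss_fun x.
have [p0 r0] := quadratic_ge0_coef h0.
have mh : measurable_fun setT h.
  apply: measurable_funM; last exact: measurable_gauss_fun.
  by apply: measurable_funD; [apply: measurable_funD => //;
    exact: measurable_funM
    |apply: measurable_funM => //; exact: exprn_measurable].
have hh0 x : 0 <= h x by rewrite mulr_ge0 ?h0 ?gauss_fun_ge0.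
have mEh : measurable_fun setT (EFin \o h) by exact/measurable_EFinP.
have E1 : (\int[mu]_x (h x)%:E + \int[mu]_x (h x)%:E
    = \int[mu]_x (2 * p * gauss_fun x + 2 * r * (x ^+ 2 * gauss_fun x))%:E)%E.
  rewrite -{2}(@ge0_integral_opp (EFin \o h))//=.
  rewrite -ge0_integralD//=.
  - apply: eq_integral => x _; rewrite -EFinD; congr (_%:E).
    by rewrite /h /gauss_fun sqrrN; ring.
  - by move=> x _; rewrite lee_fin.
  - by move=> x _; rewrite lee_fin.
  - by apply: (@measurableT_comp _ _ _ _ _ _ (EFin \o h)) => //;
    exact: oppr_measurable.
have mx2 : measurable_fun setT (fun x : R => (x ^+ 2 * gauss_fun x)%:E).
  apply/measurable_EFinP; apply: measurable_funM;
    last exact: measurable_gauss_fun.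
  exact: exprn_measurable.
have mg : measurable_fun setT (fun x : R => (gauss_fun x)%:E).
  by apply/measurable_EFinP; exact: measurable_gauss_fun.
have E2 : (\int[mu]_x (2 * p * gauss_fun x + 2 * r * (x ^+ 2 * gauss_fun x))%:E
    = (2 * ((p + r / 2) * Num.sqrt pi))%:E)%E.
  under eq_integral do rewrite EFinD !(EFinM (2 * _)).
  rewrite ge0_integralD//=.
  - rewrite !ge0_integralZl//=.
    + rewrite integralT_gauss gauss_moment2 -!EFinM -EFinD; congr (_%:E).
      by field.
    + by move=> x _; rewrite lee_fin mulr_ge0 ?sqr_ge0 ?gauss_fun_ge0.
    + by rewrite lee_fin mulr_ge0.
    + by move=> x _; rewrite lee_fin gauss_fun_ge0.
    + by rewrite lee_fin mulr_ge0.
  - by move=> x _; rewrite -EFinM lee_fin !mulr_ge0 ?gauss_fun_ge0.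
  - exact: measurable_funeM.
  - by move=> x _; rewrite -EFinM lee_fin (mulr_ge0 _ (mulr_ge0 (sqr_ge0 _)
    (gauss_fun_ge0 _)))// mulr_ge0.
  - exact: measurable_funeM.
move: E1; rewrite E2.
(* Twice the integral is a real number, which excludes infinite values before dividing by 2. *)
move: (\int[mu]_x (h x)%:E)%E => [t| |]//= [] tE.
by congr (_%:E); lra.
Qed.

Lemma ge0_integral_gaussian_quadratic a p q r : 0 < a ->
  (forall x, 0 <= p + q * x + r * x ^+ 2) ->
  (\int[mu]_x ((p + q * x + r * x ^+ 2) * expR (- (a * x ^+ 2) / 2))%:E
   = ((p + r / a) * Num.sqrt (2 * pi / a))%:E)%E.
Proof.
move=> a0 h0; pose c := Num.sqrt (2 / a).
(* The substitution by [c] turns [a * x ^+ 2 / 2] into [x ^+ 2]. *)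
have c0 : 0 < c by rewrite sqrtr_gt0 divr_gt0.
have c2 : c ^+ 2 = 2 / a by rewrite sqr_sqrtr// divr_ge0// ltW.
rewrite (@ge0_integral_affine _ c 0)//.
- under eq_integral => x _.
    rewrite addr0 !exprMn c2 (mulrA q) (mulrA r).
    have -> : - (a * (2 / a * x ^+ 2)) / 2 = - x ^+ 2.
      by field; rewrite gt_eqF.
    over.
  rewrite (@ge0_integral_gauss_quadratic p (q * c) (r * (2 / a))).
    rewrite -EFinM -[2 * pi / a]mulrAC sqrtrM ?divr_ge0 ?(ltW a0)// -/c.
    by congr (_%:E); field; rewrite gt_eqF.
  move=> x; have := h0 (c * x); rewrite exprMn c2.
  by rewrite !mulrA.
- move=> x; apply: cvgM.
    apply: cvgD; last by apply: cvgMr; exact: exprn_continuous.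
    by apply: cvgD; [exact: cvg_cst|apply: cvgMr; exact: cvg_id].
  apply: (@continuous_comp _ _ _ (fun x : R => - (a * x ^+ 2) / 2) expR).
    by apply: cvgMl; apply: cvgN; apply: cvgMr; exact: exprn_continuous.
  exact: continuous_expR.
- by move=> x; rewrite mulr_ge0 ?h0 ?expR_ge0.
Qed.

Lemma ge0_integral_gaussian_shift a p q r s : 0 < a ->
  (forall x, 0 <= p + q * x + r * x ^+ 2) ->
  (\int[mu]_x ((p + q * (x + s) + r * (x + s) ^+ 2) * expR (- (a * (x
    + s) ^+ 2) / 2))%:E
   = ((p + r / a) * Num.sqrt (2 * pi / a))%:E)%E.
Proof.
move=> a0 h0; rewrite -(@ge0_integral_gaussian_quadratic a p q r)//.
rewrite [RHS](@ge0_integral_affine _ 1 s)//.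
- by rewrite mul1e; apply: eq_integral => x _; rewrite mul1r.
- move=> x; apply: cvgM.
    apply: cvgD; last by apply: cvgMr; exact: exprn_continuous.
    by apply: cvgD; [exact: cvg_cst|apply: cvgMr; exact: cvg_id].
  apply: (@continuous_comp _ _ _ (fun x : R => - (a * x ^+ 2) / 2) expR).
    by apply: cvgMl; apply: cvgN; apply: cvgMr; exact: exprn_continuous.
  exact: continuous_expR.
- by move=> x; rewrite mulr_ge0 ?h0 ?expR_ge0.
Qed.

End OneDim.

(** * Gaussian integrals *)

Section TupleIntegral.
Variable R : realType.
Local Notation mu := (@lebesgue_measure R).

Definition rowt n (t : n.-tuple R) : 'rV[R]_n := \row_i tnth t i.

Lemma rowt_cons n (x : R) (t : n.-tuple R) :
  rowt (cons_pair (x, t)) = pt x (rowt t).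
Proof.
apply/rowP; apply: idxP => [|i]; first by rewrite pt_x mxE (tnth_nth x).
by rewrite pt_z !mxE !(tnth_nth x).
Qed.

Lemma measurable_rowt n i : measurable_fun [set: n.-tuple R] (fun t => rowt t 0
  i).
Proof. by under eq_fun do rewrite mxE; exact: measurable_tnth. Qed.

Section Cons.
Variables (n : nat) (h : n.+1.-tuple R -> \bar R).
Hypotheses (mh : measurable_fun [set: n.+1.-tuple R] h).
Hypotheses (h0 : forall s, (0 <= h s)%E).

Let mhc : measurable_fun [set: R * n.-tuple R] (h \o @cons_pair R n).
Proof. by apply: measurableT_comp => //; exact: measurable_cons_pair. Qed.

Let integral_cons : (\int[lebesgue_tuple R n.+1]_s h s
  = \int[mu \x lebesgue_tuple R n]_xt (h \o @cons_pair R n) xt)%E.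
Proof.
rewrite -[in RHS](preimage_setT (@cons_pair R n)).
pose m : {measure set (measurableTypeR R * n.-tuple R)
  -> \bar R} := (mu \x lebesgue_tuple R n)%E.
have mcp : @measurable_fun _ _ (measurableTypeR R * n.-tuple R)%type _ setT
  (@cons_pair R n) := @measurable_cons_pair R n.
by rewrite -[RHS](@ge0_integral_pushforward _ _ _ _ _ _ mcp m setT h).
Qed.

Lemma ge0_integral_tupleS1 :
  (\int[lebesgue_tuple R n.+1]_s h s
   = \int[mu]_x \int[lebesgue_tuple R n]_t h (cons_pair (x, t)))%E.
Proof.
rewrite integral_cons.
by apply: (@fubini_tonelli1 _ _ (measurableTypeR R) _ R mu (lebesgue_tuple R n)
  (h \o @cons_pair R n)) => // x; exact: h0.
Qed.

Lemma ge0_integral_tupleS2 :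
  (\int[lebesgue_tuple R n.+1]_s h s
   = \int[lebesgue_tuple R n]_t \int[mu]_x h (cons_pair (x, t)))%E.
Proof.
rewrite integral_cons.
by apply: (@fubini_tonelli2 _ _ (measurableTypeR R) _ R mu (lebesgue_tuple R n)
  (h \o @cons_pair R n)) => // x; exact: h0.
Qed.

End Cons.

Lemma measurable_qform n (A : 'M[R]_n) :
  measurable_fun [set: n.-tuple R] (fun t => qform A (rowt t)).
Proof.
under eq_fun do rewrite qformE.
apply: measurable_sum => i; apply: measurable_sum => j.
by do 2?[apply: measurable_funM => //]; exact: measurable_rowt.
Qed.

Lemma qform_mul n (L A : 'M[R]_n) z : qform (L *m A *m L^T) z
  = qform A (z *m L).
Proof. by rewrite /qform trmx_mul !mulmxA. Qed.

Lemma qform_block n (p : R) (B : 'rV[R]_n) (C : 'cV[R]_n) (D : 'M[R]_n) y z :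
  qform (block_mx p%:M B C D) (pt y z)
  = p * y ^+ 2 + ((B *m z^T) 0 0 + (z *m C) 0 0) * y + qform D z.
Proof.
rewrite /qform /pt mul_row_block tr_row_mx mul_row_col tr_scalar_mx.
rewrite !mul_scalar_mx mul_mx_scalar mulmxDl !mxE mulr1n.
have -> : \sum_j (y *: B) 0 j * z^T j 0 = y * \sum_j B 0 j * z^T j 0.
  by rewrite mulr_sumr; apply: eq_bigr => j _; rewrite mxE mulrA.
by ring.
Qed.

Lemma ulsubmx_xidx n (M : 'M[R]_(1 + n)) : ulsubmx M = (M (xidx n) (xidx n))%:M.
Proof. by rewrite [LHS]mx11_scalar; congr (_%:M); rewrite !mxE. Qed.

Section Shear.
Variables (n : nat) (A : 'M[R]_(1 + n)).
Hypotheses (As : A^T = A) (Apos : forall z, z != 0 -> 0 < qform A z).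

Definition pivot : R := A (xidx n) (xidx n).
Definition shear_col : 'cV[R]_n := - pivot^-1 *: dlsubmx A.
(** The unipotent change of variables that completes the square in the first coordinate: in the
    sheared coordinates the form is [pivot] times a square plus the Schur complement in z. *)
Definition shear : 'M[R]_(1 + n) := block_mx 1%:M 0 shear_col 1%:M.
Definition schur : 'M[R]_n := shear_col *m ursubmx A + drsubmx A.

Let ulA : ulsubmx A = pivot%:M.
Proof. exact: ulsubmx_xidx. Qed.

Let Ablock : A = block_mx pivot%:M (ursubmx A) (dlsubmx A) (drsubmx A).
Proof. by rewrite -ulA submxK. Qed.

Lemma pivot_gt0 : 0 < pivot.
Proof.
have /Apos : pt 1 0 != 0 :> 'rV[R]_(1 + n).
  by apply/eqP => /matrixP /(_ 0 (xidx n)); rewrite pt_x mxE;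
    exact/eqP/oner_neq0.
rewrite {1}Ablock qform_block trmx0 mulmx0 mul0mx !mxE addr0 mul0r addr0.
by rewrite expr1n mulr1 /qform !mul0mx mxE addr0.
Qed.

Let pivot_neq0 : pivot != 0. Proof. by rewrite gt_eqF// pivot_gt0. Qed.

Lemma shearE : shear *m A *m shear^T = block_mx pivot%:M 0 0 schur.
Proof.
have urA : ursubmx A = (dlsubmx A)^T by rewrite trmx_dlsub As.
rewrite {1}Ablock /shear tr_block_mx !mulmx_block.
rewrite !trmx1 !trmx0 !(mulmx0, mul0mx, mulmx1, mul1mx, addr0, add0r).
have dl0 : shear_col *m pivot%:M + dlsubmx A = 0.
  by rewrite mul_mx_scalar scalerA mulrN mulfV// scaleN1r addNr.
have ur0 : pivot%:M *m shear_col^T + ursubmx A = 0.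
  by rewrite urA -[pivot%:M]tr_scalar_mx -trmx_mul -linearD/= dl0 trmx0.
by rewrite dl0 mul0mx add0r ur0.
Qed.

Lemma det_shear : \det shear = 1.
Proof. by rewrite det_lblock !det1 mul1r. Qed.

Lemma det_schur : \det A = pivot * \det schur.
Proof.
have := congr1 determinant shearE.
by rewrite !det_mulmx det_tr det_shear mul1r mulr1 det_ublock det_scalar1.
Qed.

Lemma pt_shear x z : pt x z = pt (x - (z *m shear_col) 0 0) z *m shear.
Proof.
rewrite /pt /shear mul_row_block !mulmx1 mulmx0 add0r; congr row_mx.
set w := z *m _; rewrite [X in _ + X](mx11_scalar w) -raddfD/=.
by rewrite subrK.
Qed.

Lemma schur_sym : schur^T = schur.
Proof.
have : (shear *m A *m shear^T)^T = shear *m A *m shear^T.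
  by rewrite !trmx_mul trmxK As mulmxA.
by rewrite shearE tr_block_mx => /eq_block_mx[_ _ _].
Qed.

Lemma schur_pos z : z != 0 -> 0 < qform schur z.
Proof.
move=> z0; have : 0 < qform (shear *m A *m shear^T) (pt 0 z).
  rewrite qform_mul; apply: Apos; apply/eqP => h.
  have : pt 0 z = 0.
    have su : shear \in unitmx by rewrite unitmxE det_shear unitr1.
    by rewrite -[LHS](mulmxK su) h mul0mx.
  move=> /eqP; rewrite /pt row_mx_eq0 => /andP[_]; exact/negP.
by rewrite shearE qform_block expr0n !mulr0 !add0r.
Qed.

(** Congruence of both [A] and [G] by the shear leaves [\tr (G *m invmx A)] unchanged, and the
    sheared [A] is block diagonal, so the trace splits. *)
Lemma trace_shear (G : 'M[R]_(1 + n)) : schur \in unitmx ->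
  \tr (G *m invmx A)
  = (shear *m G *m shear^T) (xidx n) (xidx n) / pivot
    + \tr (drsubmx (shear *m G *m shear^T) *m invmx schur).
Proof.
move=> Su; set G' := _ *m _ *m _; pose B : 'M[R]_(1
  + n) := block_mx pivot%:M 0 0 schur.
have Bu : B \in unitmx.
  rewrite unitmxE det_ublock det_scalar1 unitrM unitfE pivot_neq0/=.
  by rewrite -unitmxE.
have su : shear \in unitmx by rewrite unitmxE det_shear unitr1.
have Au : A \in unitmx.
  by rewrite unitmxE det_schur unitrM unitfE pivot_neq0/= -unitmxE.
have sE : shear *m (A *m (shear^T *m (invmx B *m shear))) = shear.
  by rewrite !mulmxA shearE mulmxV// mul1mx.
have AE : A *m (shear^T *m (invmx B *m shear)) = 1%:M.
  by rewrite -[LHS](mulKmx su) sE mulVmx.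
have -> : invmx A = shear^T *m (invmx B *m shear).
  by rewrite -[RHS](mulKmx Au) AE mulmx1.
rewrite !mulmxA mxtrace_mulC !mulmxA -/G' invmx_block_diag//.
rewrite -[G' in LHS]submxK mulmx_block mxtrace_block.
rewrite !mulmx0 addr0 add0r invmx_scalar mul_mx_scalar mxtraceZ.
by rewrite ulsubmx_xidx mxtrace_scalar mulr1n mulrC.
Qed.

End Shear.

(** The trace is the mean of [qform G] under the Gaussian of covariance [invmx A]. The constant [c]
    makes the induction close, since integrating out a variable turns its square into a constant.
    Positivity of the determinant is proved along, as the step must invert the Schur complement. *)
Lemma ge0_integral_gaussian n (A G : 'M[R]_n) (c : R) : A^T = A ->
  (forall z, z != 0 -> 0 < qform A z) -> (forall z, 0 <= c + qform G z) ->
  0 < \det A /\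
  (\int[lebesgue_tuple R n]_t
     ((c + qform G (rowt t)) * expR (- qform A (rowt t) / 2))%:E
   = ((c + \tr (G *m invmx A)) * Num.sqrt ((2 * pi) ^+ n / \det A))%:E)%E.
Proof.
elim: n A G c => [|n IH] A G c As Apos G0.
  rewrite det_mx00; split=> //.
  rewrite integral_dirac//; last first.
    apply/measurable_EFinP; apply: measurable_funM.
      by apply: measurable_funD => //; exact: measurable_qform.
    apply: measurableT_comp => //; apply: measurable_funM => //.
    by apply: measurableT_comp => //; exact: measurable_qform.
  rewrite diracT mul1e !qformE !big_ord0 oppr0 mul0r expR0.
  by rewrite expr0 divr1 sqrtr1 /mxtrace big_ord0.
rewrite -[n.+1]/(1 + n)%N in A G As Apos G0 *.
pose G' := shear A *m G *m (shear A)^T.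
have a0 := pivot_gt0 Apos.
pose q (z : 'rV[R]_n) := (ursubmx G' *m z^T) 0 0 + (z *m dlsubmx G') 0 0.
have G'E y z : qform G' (pt y z)
    = G' (xidx n) (xidx n) * y ^+ 2 + q z * y + qform (drsubmx G') z.
  rewrite -[in LHS](submxK G') ulsubmx_xidx qform_block.
  by [].
have G'0 y z :
    0 <= c + qform (drsubmx G') z + q z * y + G' (xidx n) (xidx n) * y ^+ 2.
  have := G0 (pt y z *m shear A); rewrite -qform_mul -/G' G'E.
  by congr (_ <= _); ring.
have G'00 : 0 <= G' (xidx n) (xidx n) by have [] := quadratic_ge0_coef (G'0^~
  0).
(* Integrating out the first variable replaces its square by the variance [1 / pivot A], which moves
   its coefficient into the constant. *)
have [|Sd IHS] := IH (schur A) (drsubmx G') (c + G' (xidx n) (xidx n) / pivot A)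
    (schur_sym As Apos) (schur_pos As Apos).
  move=> z; rewrite addrAC addr_ge0//; last by rewrite divr_ge0// ltW.
  by have [] := quadratic_ge0_coef (G'0^~ z).
have Ad : 0 < \det A by rewrite (det_schur As Apos) mulr_gt0.
split=> //.
have mf : measurable_fun [set: (1 + n).-tuple R] (fun t =>
    ((c + qform G (rowt t)) * expR (- qform A (rowt t) / 2))%:E).
  apply/measurable_EFinP; apply: measurable_funM.
    by apply: measurable_funD => //; exact: measurable_qform.
  apply: measurableT_comp => //; apply: measurable_funM => //.
  by apply: measurableT_comp => //; exact: measurable_qform.
rewrite (@ge0_integral_tupleS2 n _ mf)/=; last first.
  by move=> s; rewrite lee_fin mulr_ge0 ?expR_ge0.
set k := Num.sqrt (2 * pi / pivot A).
have inner (t : n.-tuple R) : (\int[mu]_x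
    ((c + qform G (rowt (cons_pair (x, t))))
      * expR (- qform A (rowt (cons_pair (x, t))) / 2))%:E
  = k%:E * ((c + G' (xidx n) (xidx n) / pivot A + qform (drsubmx G') (rowt t))
      * expR (- qform (schur A) (rowt t) / 2))%:E)%E.
  (* For fixed z the exponent is a shifted square in x plus the Schur part; the latter leaves the
     integral as [E0], and the shift [s] does not affect the value. *)
  set z := rowt t; pose s := (z *m shear_col A) 0 0.
  pose E0 := expR (- qform (schur A) z / 2).
  pose F x := (c + qform (drsubmx G') z + q z * (x + - s)
      + G' (xidx n) (xidx n) * (x + - s) ^+ 2)
      * expR (- (pivot A * (x + - s) ^+ 2) / 2).
  have mF : measurable_fun [set: R] F.
    have ms : measurable_fun [set: R] (fun x => x + - s).
      by apply: measurable_funD.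
    have ms2 : measurable_fun [set: R] (fun x => (x + - s) ^+ 2).
      exact: measurable_funX.
    apply: measurable_funM.
      by do 2?[apply: measurable_funD => //]; apply: measurable_funM.
    apply: measurableT_comp => //; apply: measurable_funM => //.
    by apply: measurableT_comp => //; apply: measurable_funM.
  transitivity (\int[mu]_x (E0%:E * (F x)%:E))%E.
    apply: eq_integral => x _; rewrite -EFinM; congr (_%:E).
    rewrite rowt_cons (pt_shear A x z) -!qform_mul -/G' -/s G'E shearE//.
    rewrite qform_block mul0mx mulmx0 [(0 : 'M[R]_1) 0 0]mxE addr0 mul0r addr0.
    rewrite /F /E0 [RHS]mulrCA -expRD; congr (_ * expR _); by ring.
  rewrite ge0_integralZl//=; last 3 first.
  - exact/measurable_EFinP.
  - by move=> x _; rewrite lee_fin mulr_ge0 ?expR_ge0.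
  - by rewrite lee_fin expR_ge0.
  rewrite ge0_integral_gaussian_shift// -!EFinM -/k; congr (_%:E).
  by rewrite /E0; ring.
under eq_integral do rewrite inner.
have mIH : measurable_fun [set: n.-tuple R] (fun t =>
    ((c + G' (xidx n) (xidx n) / pivot A + qform (drsubmx G') (rowt t))
      * expR (- qform (schur A) (rowt t) / 2))%:E).
  apply/measurable_EFinP; apply: measurable_funM.
    by apply: measurable_funD => //; exact: measurable_qform.
  apply: measurableT_comp => //; apply: measurable_funM => //.
  by apply: measurableT_comp => //; exact: measurable_qform.
rewrite ge0_integralZl//=; last 2 first.
- move=> t _; rewrite lee_fin mulr_ge0 ?expR_ge0// addrAC addr_ge0//.
    by have [] := quadratic_ge0_coef (G'0^~ (rowt t)).
  by rewrite divr_ge0// ltW.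
- by rewrite lee_fin sqrtr_ge0.
rewrite IHS -EFinM; congr (_%:E).
have Su : schur A \in unitmx by rewrite unitmxE unitfE gt_eqF.
rewrite (trace_shear As Apos)// -/G' addrA mulrCA; congr (_ * _).
rewrite (det_schur As Apos) /k -sqrtrM ?divr_ge0 ?mulr_ge0 ?pi_ge0//
  ?(ltW a0)//.
congr Num.sqrt; rewrite [in RHS]exprD expr1; field.
by rewrite !gt_eqF.
Qed.

End TupleIntegral.

(** * Reflection in z and Gaussian integrals with signed weights *)

Section GaussianMoments.
Variable R : realType.
Local Notation mu := (@lebesgue_measure R).
Local Notation leb := (lebesgue_tuple R).

Definition oppt n (t : n.-tuple R) : n.-tuple R := [tuple of map -%R t].

Lemma rowt_oppt n (t : n.-tuple R) : rowt (oppt t) = - rowt t.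
Proof. by apply/rowP => i; rewrite !mxE tnth_map. Qed.

Lemma measurable_oppt n : measurable_fun [set: n.-tuple R] (@oppt n).
Proof.
apply/measurable_fun_tnthP => i /=.
rewrite (_ : _ \o _ = -%R \o (fun t : n.-tuple R => tnth t i)); last first.
  by apply/funext => t /=; rewrite tnth_map.
by apply: measurableT_comp; [exact: oppr_measurable|exact: measurable_tnth].
Qed.

Lemma ge0_integral_oppt n (h : n.-tuple R -> \bar R) :
  measurable_fun [set: n.-tuple R] h -> (forall t, 0 <= h t)%E ->
  (\int[leb n]_t h (oppt t) = \int[leb n]_t h t)%E.
Proof.
elim: n h => [|n IH] h mh h0.
  by apply: eq_integral => t _; rewrite [oppt t]tuple0 [t in RHS]tuple0.
have mho : measurable_fun [set: n.+1.-tuple R] (fun t => h (oppt t)).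
  by apply: measurableT_comp => //; exact: measurable_oppt.
rewrite !ge0_integral_tupleS1//.
have mhc : measurable_fun [set: R * n.-tuple R] (h \o @cons_pair R n).
  by apply: measurableT_comp => //; exact: measurable_cons_pair.
transitivity (\int[mu]_x \int[leb n]_t h (cons_pair ((- x)%R, t)))%E.
  apply: eq_integral => x _.
  rewrite -[RHS](IH (fun t => h (cons_pair ((- x)%R, t))))//.
    by apply: eq_integral => t _; congr h; exact: val_inj.
  exact: (measurableT_comp mhc (measurable_pair1 (- x))).
apply: (@ge0_integral_opp R (fun x => \int[leb n]_t h (cons_pair (x, t)))%E).
  apply: (@measurable_fun_fubini_tonelli_F _ _ _ _ R (leb n) (h \o @cons_pair R
    n)) => // x; exact: h0.
by move=> x; exact: integral_ge0.
Qed.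

Lemma integral_oppt n (h : n.-tuple R -> \bar R) :
  measurable_fun [set: n.-tuple R] h ->
  (\int[leb n]_t h (oppt t) = \int[leb n]_t h t)%E.
Proof.
move=> mh; rewrite [LHS]integralE [RHS]integralE; congr (_ - _)%E.
  rewrite -[RHS]ge0_integral_oppt//; last exact: measurable_funepos.
  by apply: eq_integral => t _; rewrite !funeposE.
rewrite -[RHS]ge0_integral_oppt//; last exact: measurable_funeneg.
by apply: eq_integral => t _; rewrite !funenegE.
Qed.

Definition normsq n (z : 'rV[R]_n) : R := \sum_i z 0 i ^+ 2.

Lemma normsq_ge0 n (z : 'rV[R]_n) : 0 <= normsq z.
Proof. by apply: sumr_ge0 => i _; rewrite sqr_ge0. Qed.

Lemma normsqN n (z : 'rV[R]_n) : normsq (- z) = normsq z.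
Proof. by apply: eq_bigr => i _; rewrite mxE sqrrN. Qed.

Lemma le_normsq n (z : 'rV[R]_n) i : z 0 i ^+ 2 <= normsq z.
Proof. by rewrite /normsq (bigD1 i)//= lerDl sumr_ge0// => j _;
  rewrite sqr_ge0. Qed.

Lemma qform_scalar n (a : R) (z : 'rV[R]_n) : qform a%:M z = a * normsq z.
Proof.
rewrite /qform mul_mx_scalar -scalemxAl mxE; congr (_ * _).
by rewrite mxE; apply: eq_bigr => i _; rewrite mxE.
Qed.

Lemma qformD n (A B : 'M[R]_n) z : qform (A + B) z = qform A z + qform B z.
Proof. by rewrite /qform mulmxDr mulmxDl mxE. Qed.

Lemma qformZ n (a : R) (A : 'M[R]_n) z : qform (a *: A) z = a * qform A z.
Proof. by rewrite /qform -scalemxAr -scalemxAl mxE. Qed.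

Definition abs_sum n (G : 'M[R]_n) : R := \sum_i \sum_j `|G i j|.

Lemma abs_sum_ge0 n (G : 'M[R]_n) : 0 <= abs_sum G.
Proof. by apply: sumr_ge0 => i _; apply: sumr_ge0. Qed.

Lemma normr_qform_le n (G : 'M[R]_n) z : `|qform G z| <= abs_sum G * normsq z.
Proof.
rewrite qformE /abs_sum mulr_suml (le_trans (ler_norm_sum _ _ _))//.
apply: ler_sum => i _; rewrite mulr_suml (le_trans (ler_norm_sum _ _ _))//.
apply: ler_sum => j _; rewrite !normrM mulrC ler_wpM2l//.
have := le_normsq z i; have := le_normsq z j.
rewrite -[z 0 i ^+ 2]real_normK ?num_real// -[z 0 j ^+ 2]real_normK ?num_real//.
(* By this inequality [|z_i| * |z_j|] is at most half the sum of the two squares, each of which is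
   at most [normsq z]. *)
have : 0 <= (`|z 0 i| - `|z 0 j|) ^+ 2 by exact: sqr_ge0.
by rewrite sqrrB; nra.
Qed.

Section Gaussian.
Variables (n : nat) (A : 'M[R]_n).
Hypotheses (As : A^T = A) (Apos : forall z, z != 0 -> 0 < qform A z).

Definition gaussian (c : R) (G : 'M[R]_n) (t : n.-tuple R) : R :=
  (c + qform G (rowt t)) * expR (- qform A (rowt t) / 2).

Definition gaussian_mass : R := Num.sqrt ((2 * pi) ^+ n / \det A).

Lemma measurable_gaussian c G : measurable_fun [set: n.-tuple R] (gaussian c G).
Proof.
apply: measurable_funM.
  by apply: measurable_funD => //; exact: measurable_qform.
apply: measurableT_comp => //; apply: measurable_funM => //.
by apply: measurableT_comp => //; exact: measurable_qform.
Qed.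

Lemma det_posdef : 0 < \det A.
Proof.
have [] // := @ge0_integral_gaussian R n A 0 0 As Apos.
by move=> z; rewrite /qform mulmx0 mul0mx mxE addr0.
Qed.

(** A signed weight becomes nonnegative after adding [|c| + abs_sum G * normsq z], which is itself
    an admissible nonnegative weight; the result follows by subtraction, the formula being linear in
    [c] and [G]. *)
Lemma integral_gaussian c G :
  (leb n).-integrable [set: n.-tuple R] (EFin \o gaussian c G) /\
  \int[leb n]_t gaussian c G t = (c + \tr (G *m invmx A)) * gaussian_mass.
Proof.
have ge0 c' G' : (forall z, 0 <= c' + qform G' z) ->
    (leb n).-integrable [set: n.-tuple R] (EFin \o gaussian c' G') /\
    \int[leb n]_t gaussian c' G' t = (c' + \tr (G' *m invmx A)) * gaussian_mass.
  move=> h0; have [_ E] := ge0_integral_gaussian As Apos h0.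
  split; last by rewrite /Rintegral /gaussian E.
  apply/integrableP; split.
    by apply/measurable_EFinP; exact: measurable_gaussian.
  under eq_integral.
    move=> t _; rewrite /= /gaussian ger0_norm;
      last by rewrite mulr_ge0 ?expR_ge0.
    over.
  by rewrite E ltry.
pose l := (abs_sum G)%:M : 'M[R]_n.
have [i1 e1] : (leb n).-integrable [set: n.-tuple R] (EFin \o gaussian (`|c|
  + c) (G + l)) /\
    \int[leb n]_t gaussian (`|c| + c) (G + l) t
      = (`|c| + c + \tr ((G + l) *m invmx A)) * gaussian_mass.
  apply: ge0 => z; rewrite addr_ge0 ?ge0_normD//.
  rewrite qformD qform_scalar; have := normr_qform_le G z.
  by rewrite ler_norml => /andP[]; lra.
have [i2 e2] : (leb n).-integrable [set: n.-tuple R] (EFin \o gaussian `|c| l)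
  /\
    \int[leb n]_t gaussian `|c| l t = (`|c| + \tr (l *m invmx A)) *
      gaussian_mass.
  apply: ge0 => z; rewrite addr_ge0// qform_scalar mulr_ge0 ?abs_sum_ge0//.
  exact: normsq_ge0.
have gE : gaussian c G = (fun t => gaussian (`|c| + c) (G
  + l) t - gaussian `|c| l t).
  by apply/funext => t; rewrite /gaussian qformD; ring.
split; last first.
  rewrite gE RintegralB// e1 e2 mulmxDl mxtraceD; ring.
rewrite gE; exact: (integrableB measurableT i1 i2).
Qed.

End Gaussian.

Lemma scalar_posdef n (b : R) : 0 < b -> forall z : 'rV[R]_n, z != 0
  -> 0 < qform b%:M z.
Proof.
move=> b0 z z0; rewrite qform_scalar mulr_gt0// lt_neqAle normsq_ge0 andbT.
apply: contra z0; rewrite eq_sym /normsq psumr_eq0; last by move=> i _;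
  rewrite sqr_ge0.
move=> /allP h; apply/eqP/rowP => i; rewrite mxE.
by have /= := h i; rewrite mem_index_enum sqrf_eq0 => /(_ isT)/eqP.
Qed.

Lemma integral_exp_normsq n (b : R) : 0 < b ->
  (leb n).-integrable [set: n.-tuple R] (fun t => (expR (- (b * normsq (rowt
    t))))%:E) /\
  \int[leb n]_t expR (- (b * normsq (rowt t))) = Num.sqrt ((pi / b) ^+ n).
Proof.
move=> b0; have b20 : 0 < 2 * b by rewrite mulr_gt0.
have [] := @integral_gaussian n (2 * b)%:M (tr_scalar_mx _ _) (scalar_posdef
  b20) 1 0.
have -> : gaussian (2 * b)%:M 1 0 = (fun t : n.-tuple R => expR (- (b * normsq
  (rowt t)))).
  apply/funext => t; rewrite /gaussian qform_scalar /qform mulmx0 mul0mx mxE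
    addr0 mul1r.
  by congr expR; field.
rewrite mul0mx mxtrace0 addr0 mul1r /gaussian_mass det_scalar -expr_div_n.
by rewrite -mulf_div divff ?mul1r.
Qed.

(** [F] and its reflection have the same integral, so only their sum has to be close to twice the
    Gaussian. The bound by [M] serves integrability alone and does not enter the estimate. *)
Lemma symmetrized_gaussian_estimate n (A G : 'M[R]_n) (F : n.-tuple R -> R)
    (c k b B M : R) :
  A^T = A -> (forall z, z != 0 -> 0 < qform A z) -> 0 < b ->
  measurable_fun [set: n.-tuple R] F ->
  (forall t, `|F t| <= M * expR (- (b * normsq (rowt t)))) ->
  (forall t, `|F t + F (oppt t) - 2 * (k * gaussian A c G t)|
     <= 2 * (B * expR (- (b * normsq (rowt t))))) ->
  (leb n).-integrable [set: n.-tuple R] (EFin \o F) /\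
  `|\int[leb n]_t F t - k * ((c + \tr (G *m invmx A)) * gaussian_mass A)|
    <= B * Num.sqrt ((pi / b) ^+ n).
Proof.
move=> As Apos b0 mF FM FB.
have [iE eE] := integral_exp_normsq n b0.
have [ig eg] := integral_gaussian As Apos c G.
have iEZ a : (leb n).-integrable [set: n.-tuple R] (EFin \o (fun t => a * expR
  (- (b * normsq (rowt t))))).
  by rewrite (_ : _ \o _ = fun t => a%:E * (expR (- (b * normsq (rowt
    t))))%:E)%E//; exact: integrableZl.
have iF : (leb n).-integrable [set: n.-tuple R] (EFin \o F).
  apply: le_integrable (iEZ M) => //; first exact/measurable_EFinP.
  by move=> t _ /=; rewrite lee_fin (le_trans (FM t))// ler_norm.
have mFo : measurable_fun [set: n.-tuple R] (fun t => F (oppt t)).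
  by apply: measurableT_comp => //; exact: measurable_oppt.
have iFo : (leb n).-integrable [set: n.-tuple R] (EFin \o (fun t => F (oppt
  t))).
  apply: le_integrable (iEZ M) => //; first exact/measurable_EFinP.
  move=> t _ /=; rewrite lee_fin (le_trans (FM _))// rowt_oppt normsqN.
  by rewrite ler_norm.
have eFo : \int[leb n]_t F (oppt t) = \int[leb n]_t F t.
  congr fine; apply: (@integral_oppt n (EFin \o F)); exact/measurable_EFinP.
have ikg : (leb n).-integrable [set: n.-tuple R] (EFin \o (fun t => 2 * (k *
  gaussian A c G t))).
  rewrite (_ : _ \o _ = fun t => (2 * k)%:E * (gaussian A c G t)%:E)%E;
    first exact: integrableZl.
  by apply/funext => t; rewrite /= -EFinM mulrA.
have iD : (leb n).-integrable [set: n.-tuple R] (EFin \o (fun t => F t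
  + F (oppt t))).
  exact: (integrableD measurableT iF iFo).
have iDB : (leb n).-integrable [set: n.-tuple R] (EFin \o (fun t => F t
  + F (oppt t) - 2 * (k * gaussian A c G t))).
  exact: (integrableB measurableT iD ikg).
split=> //.
have E : \int[leb n]_t (F t + F (oppt t) - 2 * (k * gaussian A c G t))
    = 2 * (\int[leb n]_t F t - k * ((c + \tr (G *m invmx A)) * gaussian_mass
      A)).
  rewrite RintegralB// RintegralD// eFo.
  under [X in _ - X]eq_Rintegral do rewrite mulrA.
  by rewrite RintegralZl// eg; ring.
rewrite -(ler_pM2l (_ : 0 < 2))// -[2 in leLHS]gtr0_norm// -normrM -E.
rewrite (le_trans (le_normr_Rintegral _ iDB))// -eE.
apply: (@le_trans _ _ (\int[leb n]_t (2 * B * expR (- (b * normsq (rowt t)))))).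
  apply: le_Rintegral => //.
    have := integrable_abse iDB; congr (_.-integrable _ _).
  by move=> t _; rewrite -mulrA.
by rewrite RintegralZl// mulrA.
Qed.

End GaussianMoments.

(** * The amplitude and the phase on the whole domain *)

Section Coercive.
Variable R : realType.

(** Induction by completing the square: the sheared form controls [x - t] and z, and [t] is linear
    in z, so x itself is controlled. *)
Lemma qform_coercive n (A : 'M[R]_n) : A^T = A ->
  (forall z, z != 0 -> 0 < qform A z) ->
  exists2 c, 0 < c & forall z, c * normsq z <= qform A z.
Proof.
elim: n A => [|n IH] A As Apos.
  by exists 1 => // z; rewrite /normsq qformE !big_ord0 mulr0.
rewrite -[n.+1]/(1 + n)%N in A As Apos *.
have [s s0 hs] := IH _ (schur_sym As Apos) (schur_pos As Apos).
have a0 := pivot_gt0 Apos.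
pose k := abs_sum (shear_col A *m (shear_col A)^T).
have k0 : 0 <= k by exact: abs_sum_ge0.
have k1 : 0 < 2 * k + 1 by rewrite ltr_wpDl// mulr_ge0.
(* From [x ^+ 2 <= 2 * (x - t) ^+ 2 + 2 * t ^+ 2] and [t ^+ 2 <= k * normsq z], one needs
   [2 * c <= pivot A] and [c * (2 * k + 1) <= s]. *)
pose c := Num.min (pivot A / 2) (s / (2 * k + 1)).
have c0 : 0 < c by rewrite lt_min !divr_gt0.
have ca : 2 * c <= pivot A.
  by rewrite mulrC -ler_pdivlMr// ge_min lexx.
have cs : c * (2 * k + 1) <= s by rewrite -ler_pdivlMr// ge_min lexx orbT.
exists c => // y.
have -> : y = pt (y 0 (xidx n)) (\row_i y 0 (zidx i)).
  by apply/rowP; apply: idxP => [|i]; rewrite ?pt_x ?pt_z ?mxE.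
set x := y 0 _; set z := \row_i _.
have -> : normsq (pt x z) = x ^+ 2 + normsq z.
  rewrite /normsq big_split_ord big_ord1 pt_x; congr (_ + _).
  by apply: eq_bigr => i _; rewrite pt_z.
rewrite [in leRHS](pt_shear A x z) -qform_mul (shearE As Apos) qform_block.
rewrite mul0mx mulmx0 [(0 : 'M[R]_1) 0 0]mxE addr0 mul0r addr0.
set t := (z *m shear_col A) 0 0.
have tk : t ^+ 2 <= k * normsq z.
  have -> : t ^+ 2 = qform (shear_col A *m (shear_col A)^T) z.
    rewrite /qform mulmxA -mulmxA -trmx_mul [z *m _]mx11_scalar -/t
      tr_scalar_mx.
    by rewrite -scalar_mxM mxE eqxx mulr1n expr2.
  by apply: le_trans (normr_qform_le _ _); exact: ler_norm.
have z0 := normsq_ge0 z; have := hs z.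
have xt : x ^+ 2 <= 2 * (x - t) ^+ 2 + 2 * t ^+ 2.
  have : 0 <= (x - 2 * t) ^+ 2 by exact: sqr_ge0.
  rewrite !sqrrB !expr2; nra.
have h1 : 2 * c * (x - t) ^+ 2 <= pivot A * (x - t) ^+ 2.
  by rewrite ler_wpM2r ?sqr_ge0.
have h2 : c * (2 * k + 1) * normsq z <= s * normsq z by rewrite ler_wpM2r.
have h3 : c * x ^+ 2 <= c * (2 * (x - t) ^+ 2 + 2 * t ^+ 2)
  by rewrite ler_wpM2l// ltW.
have h4 : c * t ^+ 2 <= c * (k * normsq z) by rewrite ler_wpM2l// ltW.
rewrite mulrDr; move: h1 h2 h3 h4; rewrite !(mulrDr c) !(mulrDl _ _ (normsq
  z)); lra.
Qed.

End Coercive.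

(** * Bounds on the whole domain: expansion, vanishing gradient, decay *)

Section GlobalBounds.
Variables (R : realType) (n : nat).
Implicit Types (h : 'rV[R]_(1 + n) -> R) (x : R) (z : 'rV[R]_n).

Definition rho x z : R := x + normsq z.

Lemma pt_dom x z : 0 < x < 1 -> (forall i, -1 < z 0 i < 1) -> dom (pt x z).
Proof. by move=> x01 z01; split => [|i]; rewrite ?pt_x ?pt_z. Qed.

Lemma normsq_le z : (forall i, `|z 0 i| <= 1) -> normsq z <= n%:R.
Proof.
move=> z1; rewrite /normsq -[n in leRHS]card_ord -[leRHS]sumr_const.
apply: ler_sum => i _; rewrite -[X in X <= _]real_normK ?num_real//.
by rewrite expr_le1.
Qed.

Lemma rho_ge0 x z : 0 <= x -> 0 <= rho x z.
Proof. by move=> x0; rewrite addr_ge0// normsq_ge0. Qed.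

Variable K : set 'rV[R]_(1 + n).
Hypothesis K_compact : compact K.
Hypothesis K_nbhd : closure (@dom R n) `<=` interior K.

Let KD p : closure (@dom R n) p -> K p.
Proof. by move/K_nbhd; exact: interior_subset. Qed.

Let compact_dom : compact (closure (@dom R n)).
Proof. by apply: subclosed_compact K_compact KD; exact: closed_closure. Qed.

Lemma analytic_max_on h (A : set 'rV[R]_(1 + n)) :
  (forall p, K p -> analytic_at h p) -> A !=set0 -> closed A ->
  A `<=` closure (@dom R n) ->
  exists2 p, A p & forall q, A q -> h q <= h p.
Proof.
move=> ha A0 Acl AD.
have Ac : compact A by exact: subclosed_compact compact_dom AD.
have [|c /set_mem Ac' hc] := @compact_EVT_max _ R h A A0 Ac.
  by apply: continuous_in_subspaceT => p /set_mem /AD/KD/ha;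
    exact: analytic_continuous.
by exists c => // q Aq; apply: hc; exact: mem_set.
Qed.

Hypothesis D0 : closure (@dom R n) 0.

Lemma analytic_bounded h : (forall p, K p -> analytic_at h p) ->
  exists M, forall p, closure (@dom R n) p -> `|h p| <= M.
Proof.
move=> ha; have D0' : closure (@dom R n) !=set0 by exists 0.
have [|c /set_mem _ hc] := @compact_EVT_max _ R (fun p => `|h p|) _ D0'
  compact_dom.
  apply: continuous_in_subspaceT => p /set_mem /KD/ha/analytic_continuous hp.
  apply/continuous_rVP => e e0.
  have [r r0 hr] := (continuous_rVP _ _).1 hp e e0.
  by exists r => // y /hr; exact: le_lt_trans (ler_dist_dist _ _).
by exists `|h c| => p Dp; apply: hc; exact: mem_set.
Qed.

Lemma taylor2_bounded h : exists M, forall x z, 0 < x < 1 ->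
  (forall i, `|z 0 i| <= 1) -> `|taylor2 h x z| <= M.
Proof.
exists (`|h 0| + `|diff_x h 0| + \sum_i `|grad_z h 0 0 i|
  + abs_sum (hess_z h 0) * n%:R).
move=> x z /andP[x0 x1] z1; rewrite /taylor2.
rewrite (le_trans (ler_normD _ _))// lerD//; last first.
  rewrite normrM (ger0_norm (_ : 0 <= 2^-1))// ler_pdivrMr//.
  rewrite (le_trans (normr_qform_le _ _))// -mulrA ler_wpM2l ?abs_sum_ge0//.
  have := normsq_le z1; have : 0 <= n%:R :> R by []. lra.
rewrite (le_trans (ler_normD _ _))// lerD//; last first.
  rewrite (le_trans (ler_norm_sum _ _ _))// ler_sum// => i _.
  by rewrite normrM ler_piMl.
rewrite (le_trans (ler_normD _ _))// lerD// normrM ler_piMl//.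
by rewrite ger0_norm ltW.
Qed.

Lemma global_expansion h : (forall p, K p -> analytic_at h p) ->
  exists2 C, 0 <= C & forall x z, 0 < x < 1 -> (forall i, -1 < z 0 i < 1) ->
    `|h (pt x z) - taylor2 h x z| <= C * Num.sqrt (rho x z) ^+ 3 /\
    `|h (pt x z) + h (pt x (- z)) - (taylor2 h x z + taylor2 h x (- z))|
      <= C * Num.sqrt (rho x z) ^+ 4.
Proof.
move=> ha; have [a [r hs]] := analytic_psum (ha 0 (KD D0)).
have {}hs : psum_on r h a (fun m i => m i).
  by move: hs; under eq_fun do rewrite addr0.
have [C0 [r1 [r10 hr]]] := psum_on_expansion hs.
have [M1 hM1] := analytic_bounded ha.
have [M2 hM2] := taylor2_bounded h.
pose M := `|M1| + `|M2|.
have M0 : 0 <= M by rewrite addr_ge0.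
(* [C0] serves for [s <= r1]. Beyond [r1] the two remainders are at most [M] and [2 * M], and
   [s ^+ k / r1 ^+ k >= 1] supplies the power of [s]. *)
pose C := `|C0| + M / r1 ^+ 3 + 2 * M / r1 ^+ 4.
have C3 : 0 <= M / r1 ^+ 3 by rewrite divr_ge0// exprn_ge0// ltW.
have C4 : 0 <= 2 * M / r1 ^+ 4 by rewrite divr_ge0 ?exprn_ge0 ?(ltW r10)//
  mulr_ge0.
exists C => [|x z /[dup] x01 /andP[x0 x1] z01]; first by rewrite !addr_ge0.
set s := Num.sqrt _.
have s2 : s ^+ 2 = rho x z by rewrite sqr_sqrtr// rho_ge0// ltW.
have s0 : 0 <= s := sqrtr_ge0 _.
have z1 i : `|z 0 i| <= 1 by rewrite ler_norml; have /andP[] := z01 i; lra.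
have z1N i : `|(- z) 0 i| <= 1 by rewrite mxE normrN.
have Nz01 i : -1 < (- z) 0 i < 1 by rewrite mxE; have := z01 i; lra.
have [sr|rs] := leP s r1.
  have [|||h1 h2] := hr x z s.
  - by rewrite s2 (ltW x0)/= lerDl normsq_ge0.
  - move=> i; rewrite -(ler_pXn2r (_ : 0 < 2)%N)// ?nnegrE//.
    rewrite real_normK ?num_real// s2 (le_trans (le_normsq z i))//.
    by rewrite lerDr ltW.
  - by rewrite s0.
  have CC : C0 <= C by rewrite (le_trans (ler_norm _))//
    /C -addrA lerDl addr_ge0.
  split; [apply: (le_trans h1)|apply: (le_trans h2)];
    by rewrite ler_wpM2r ?exprn_ge0.
have hT (w : 'rV[R]_n) : (forall i, `|w 0 i| <= 1) -> (forall i,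
  -1 < w 0 i < 1) ->
    `|h (pt x w) - taylor2 h x w| <= M.
  move=> w1 w01; rewrite (le_trans (ler_normB _ _))// lerD//.
    rewrite (le_trans _ (ler_norm _))// hM1//.
    by apply: subset_closure; exact: pt_dom.
  by rewrite (le_trans _ (ler_norm _))// hM2.
have pw k : 1 <= s ^+ k / r1 ^+ k.
  by rewrite -expr_div_n exprn_ege1// ler_pdivlMr// mul1r ltW.
split.
  rewrite (le_trans (hT _ z1 z01))// (@le_trans _ _ (M / r1 ^+ 3 * s ^+ 3))//.
    by rewrite mulrAC -mulrA ler_peMr.
  by rewrite ler_wpM2r ?exprn_ge0// /C; have := normr_ge0 C0; lra.
rewrite opprD addrACA (le_trans (ler_normD _ _))//.
rewrite (@le_trans _ _ (2 * M))//.
  by rewrite [leRHS]mulr_natl mulr2n lerD// hT.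
rewrite (@le_trans _ _ (2 * M / r1 ^+ 4 * s ^+ 4))//.
  by rewrite mulrAC -mulrA ler_peMr// mulr_ge0.
by rewrite ler_wpM2r ?exprn_ge0// /C; have := normr_ge0 C0; lra.
Qed.

Variable f : 'rV[R]_(1 + n) -> R.
Hypothesis f_analytic : forall p, K p -> analytic_at f p.
Hypothesis f_max : unique_max_at (closure (@dom R n)) f 0.
Hypothesis f_hess : neg_definite (hess_z f 0).
Hypothesis f_dx : diff_x f 0 < 0.

Lemma hess_sym : (hess_z f 0)^T = hess_z f 0.
Proof.
have [a [r hs]] := analytic_psum (f_analytic (KD D0)).
apply: (@hess_z_sym _ _ f r a).
by move: hs; under eq_fun do rewrite addr0.
Qed.

(* The origin lies on the face x = 0 of the domain, so it is tested against the
   points (t^2, +-t e_j), where the x-derivative contributes at order t^2. *)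
Lemma grad_z_max : grad_z f 0 = 0.
Proof.
have [C C0 hC] := global_expansion f_analytic.
apply/rowP => j; rewrite [RHS]mxE; set b := grad_z f 0 0 j.
pose M := `|diff_x f 0| + `|hess_z f 0 j j| + 4 * C.
have M0 : 0 <= M by rewrite !addr_ge0// mulr_ge0.
(* At the test point the gradient contributes [e * t * b], first order in [t], while all other terms
   are bounded by [t ^+ 2 * M]; maximality at 0 then bounds [e * b]. *)
have key (e t : R) : (e = 1) \/ (e = -1) -> 0 < t < 1 -> e * b <= t * M.
  move=> e1 /andP[t0 t1]; pose z : 'rV[R]_n := (e * t) *: delta_mx 0 j.
  have zj i : z 0 i = if i == j then e * t else 0.
    by rewrite !mxE eqxx /=; case: eqP; rewrite ?mulr1 ?mulr0.
  have e2 : (e * t) ^+ 2 = t ^+ 2.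
    by case: e1 => ->; rewrite ?mul1r// mulN1r sqrrN.
  have x01 : 0 < t ^+ 2 < 1 by rewrite exprn_gt0//= expr_lt1// ltW.
  have z01 i : -1 < z 0 i < 1.
    rewrite zj; case: eqP => _; last by rewrite ltr01 ltrN10.
    by case: e1 => ->; rewrite ?mul1r ?mulN1r; lra.
  have nz : normsq z = t ^+ 2.
    rewrite /normsq (bigD1 j)//= zj eqxx e2 big1 ?addr0// => i ij.
    by rewrite zj (negbTE ij) expr0n.
  have gz : \sum_(i < n) z 0 i * grad_z f 0 0 i = e * t * b.
    rewrite (bigD1 j)//= zj eqxx big1 ?addr0// => i ij.
    by rewrite zj (negbTE ij) mul0r.
  have hz : qform (hess_z f 0) z = t ^+ 2 * hess_z f 0 j j.
    rewrite qformE (bigD1 j)//= [X in _ + X]big1 ?addr0 => [|i ij]; last first.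
      by rewrite big1// => k _; rewrite zj (negbTE ij) !mul0r.
    rewrite (bigD1 j)//= zj eqxx -expr2 e2 big1 ?addr0// => i ij.
    by rewrite [z 0 i]zj (negbTE ij) mulr0 mul0r.
  have [+ _] := hC _ _ x01 z01; rewrite /rho nz.
  set s := Num.sqrt _.
  have s2 : s ^+ 2 = 2 * t ^+ 2.
    by rewrite sqr_sqrtr ?addr_ge0 ?sqr_ge0// mulr_natl mulr2n.
  have s3 : s ^+ 3 <= 4 * t ^+ 3.
    rewrite exprSr s2 (_ : 4 * _ = 2 * t ^+ 2 * (2 * t)); last by ring.
    have t22 : 0 <= 2 * t ^+ 2 by rewrite mulr_ge0// sqr_ge0.
    rewrite (ler_wpM2l t22)//.
    have t20 : 0 <= 2 * t by rewrite mulr_ge0// ltW.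
    rewrite -[leRHS]ger0_norm// -sqrtr_sqr ler_wsqrtr//.
    by have := sqr_ge0 t; nra.
  have f0 : f (pt (t ^+ 2) z) <= f 0.
    have [-> //|/eqP pn0] := eqVneq (pt (t ^+ 2) z) 0.
    apply/ltW; apply: f_max.2 => //.
    by apply: subset_closure; exact: pt_dom.
  rewrite /taylor2 gz hz ler_norml => /andP[h1 _].
  have h2 : C * s ^+ 3 <= C * (4 * t ^+ 3) by rewrite ler_wpM2l.
  have h3 : t * (e * b) <= t * (t * M).
    have d1 : t ^+ 2 * - diff_x f 0 <= t ^+ 2 * `|diff_x f 0|.
      by rewrite ler_wpM2l ?sqr_ge0// -normrN ler_norm.
    have d2 : t ^+ 2 * - hess_z f 0 j j <= t ^+ 2 * `|hess_z f 0 j j|.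
      by rewrite ler_wpM2l ?sqr_ge0// -normrN ler_norm.
    have d3 : 0 <= t ^+ 2 * `|hess_z f 0 j j| by rewrite mulr_ge0 ?sqr_ge0.
    have d4 : t ^+ 3 * C <= t ^+ 2 * C.
      by rewrite ler_wpM2r// exprSr ler_piMr ?sqr_ge0// ltW.
    by rewrite /M; move: f0 h1 h2 d1 d2 d3 d4; lra.
  by move: h3; rewrite ler_pM2l.
have le0 (e : R) : (e = 1) \/ (e = -1) -> e * b <= 0.
  move=> e1; rewrite leNgt; apply/negP => eb0.
  (* With this [t], [key] would give [2 * t * (M + 1) <= t * M], absurd for positive [t] and
     nonnegative [M]. *)
  pose t := Num.min (1 / 2) (e * b / (2 * (M + 1))).
  have M1 : 0 < 2 * (M + 1) by rewrite mulr_gt0// ltr_wpDl.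
  have t0 : 0 < t by rewrite lt_min !divr_gt0.
  have t1 : t < 1 by rewrite gt_min; apply/orP; left; lra.
  have := key e t e1; rewrite t0 t1 => /(_ isT).
  have : t * (2 * (M + 1)) <= e * b by rewrite -ler_pdivlMr// ge_min lexx orbT.
  have : 0 <= t * M by rewrite mulr_ge0// ltW.
  by have := t0; lra.
apply/eqP; rewrite eq_le; apply/andP; split.
  by have := le0 1 (or_introl erefl); rewrite mul1r.
by have := le0 (-1) (or_intror erefl); rewrite mulN1r oppr_le0.
Qed.

Lemma neg_hess_pos z : z != 0 -> 0 < qform (- hess_z f 0) z.
Proof.
by move=> /f_hess; rewrite /qform mulmxN mulNmx [X in _ -> 0 < X]mxE oppr_gt0.
Qed.

(** Near the origin the weight-2 model decays like [rho] and beats the remainder. Far from it,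
    compactness and uniqueness of the maximum give a fixed gap, while [rho] is at most [n.+1%:R] on
    the domain. *)
Lemma phase_decay : exists2 c, 0 < c &
  forall x z, 0 < x < 1 -> (forall i, -1 < z 0 i < 1) ->
    f (pt x z) - f 0 <= - (c * rho x z).
Proof.
have As : (- hess_z f 0)^T = - hess_z f 0 by rewrite linearN/= hess_sym.
have [c0 c00 hc0] := qform_coercive As neg_hess_pos.
have [C C0 hC] := global_expansion f_analytic.
pose c1 := Num.min (- diff_x f 0) (c0 / 2).
have c10 : 0 < c1 by rewrite lt_min oppr_gt0 f_dx divr_gt0.
(* For [rho x z <= e] one has [C * s <= c1 / 2], so the remainder [C * s ^+ 3] costs at most half of
   the decay rate [c1]. *)
pose e := (c1 / (2 * (C + 1))) ^+ 2.
have C1 : 0 < 2 * (C + 1) by rewrite mulr_gt0// ltr_wpDl.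
have e0 : 0 < e by rewrite exprn_gt0// divr_gt0.
have near x z : 0 < x < 1 -> (forall i, -1 < z 0 i < 1) -> rho x z <= e ->
    f (pt x z) - f 0 <= - (c1 / 2 * rho x z).
  move=> x01 z01 re; have [+ _] := hC _ _ x01 z01.
  set s := Num.sqrt _.
  have r0 : 0 <= rho x z by rewrite rho_ge0//; case/andP: x01 => /ltW.
  have s2 : s ^+ 2 = rho x z by rewrite sqr_sqrtr.
  have se : s <= c1 / (2 * (C + 1)).
    rewrite -[leRHS]ger0_norm ?divr_ge0 ?(ltW c10) ?(ltW C1)//.
    by rewrite -sqrtr_sqr ler_wsqrtr.
  rewrite ler_norml => /andP[_].
  rewrite /taylor2 grad_z_max big1 ?addr0 => [|i _]; last by rewrite mxE mulr0.
  have : C * s ^+ 3 <= c1 / 2 * rho x z.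
    rewrite exprSr s2 mulrCA mulrC ler_wpM2r// (@le_trans _ _ ((C + 1) * s))//.
      by rewrite ler_wpM2r ?sqrtr_ge0// lerDl.
    by move: se; rewrite !ler_pdivlMr//; lra.
  have : qform (hess_z f 0) z / 2 <= - (c1 * normsq z).
    have := hc0 z; rewrite /qform mulmxN mulNmx [leRHS]mxE -/(qform _ _).
    have : c1 * normsq z <= c0 / 2 * normsq z.
      by rewrite ler_wpM2r ?normsq_ge0// ge_min lexx orbT.
    by lra.
  have : x * diff_x f 0 <= - (c1 * x).
    have : c1 * x <= - diff_x f 0 * x.
      by rewrite ler_wpM2r ?(ltW (proj1 (andP x01)))// ge_min lexx.
    by lra.
  by rewrite /rho; lra.
(* If all n + 1 coordinates are below [e'], then x and each [z 0 i ^+ 2] are at most [e / n.+1%:R],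
   hence [rho x z <= e]. Points with larger [rho] thus avoid the ball. *)
pose e' := Num.min 1 (e / n.+1%:R).
have e'0 : 0 < e' by rewrite lt_min ltr01 divr_gt0.
pose A := closure (@dom R n) `&` ~` ball (0 : 'rV[R]_(1 + n)) e'.
have far x z : 0 < x < 1 -> (forall i, -1 < z 0 i < 1) -> e < rho x z
  -> A (pt x z).
  move=> x01 z01 er; split; first by apply: subset_closure; exact: pt_dom.
  move=> [_ hb].
  have xe : `|x| < e' by have := hb 0 (xidx n);
    rewrite /ball/= mxE pt_x sub0r normrN.
  have ze i : `|z 0 i| < e' by have := hb 0 (zidx i);
    rewrite /ball/= mxE pt_z sub0r normrN.
  move: er; apply/negP; rewrite -leNgt.
  have -> : e = e / n.+1%:R + \sum_(i < n) e / n.+1%:R.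
    by rewrite sumr_const card_ord -mulrS -[RHS]mulr_natr divfK// pnatr_eq0.
  rewrite lerD//.
    rewrite (le_trans (ler_norm _))// (le_trans (ltW xe))//.
    by rewrite ge_min lexx orbT.
  apply: ler_sum => i _; rewrite -[leLHS]real_normK ?num_real//.
  have := ltW (ze i); rewrite /e' le_min => /andP[z1 zen].
  by rewrite (le_trans _ zen)// expr2 ler_piMl.
have Acl : closed A.
  by apply: closedI; [exact: closed_closure|apply: open_closedC;
    exact: ball_open].
(* A maximum over [A] exists only if [A] is nonempty; otherwise the near estimate covers the whole
   domain. *)
have [A0|/set0P A0] := eqVneq A set0.
  exists (c1 / 2) => [|x z x01 z01]; first by rewrite divr_gt0.
  apply: near => //; rewrite leNgt; apply/negP => er.
  by have := far _ _ x01 z01 er; rewrite A0.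
have [p [pD pb] pmax] := analytic_max_on f_analytic A0 Acl (@subIsetl _ _ _).
have pf : f p < f 0.
  by apply: f_max.2 => // p0; apply: pb; rewrite p0; exact: ballxx.
pose c2 := (f 0 - f p) / n.+1%:R.
have c20 : 0 < c2 by rewrite divr_gt0// subr_gt0.
exists (Num.min (c1 / 2) c2); first by rewrite lt_min c20 divr_gt0.
move=> x z x01 z01.
have r0 : 0 <= rho x z by rewrite rho_ge0//; case/andP: x01 => /ltW.
have [re|er] := leP (rho x z) e.
  by rewrite (le_trans (near _ _ x01 z01 re))// lerN2 ler_wpM2r// ge_min lexx.
have fp := pmax _ (far _ _ x01 z01 er).
have rn : rho x z <= n.+1%:R.
  rewrite -natr1 addrC lerD//; first by case/andP: x01 => _ /ltW.
  by apply: normsq_le => i; rewrite ler_norml; have /andP[] := z01 i; lra.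
have h1 : Num.min (c1 / 2) c2 * rho x z <= c2 * rho x z.
  by rewrite ler_wpM2r// ge_min lexx orbT.
have h2 : c2 * rho x z <= c2 * n.+1%:R by rewrite ler_wpM2l// ltW.
have h3 : c2 * n.+1%:R = f 0 - f p by rewrite divfK// pnatr_eq0.
by lra.
Qed.

End GlobalBounds.

(** * Pointwise estimates on exponentials and the integral in x *)

Section Pointwise.
Variable R : realType.
Implicit Types (u v w s C N r c : R).

(** Convexity of the exponential, in the form [1 + t <= expR t] at [u - w] and at [w - u]. *)
Lemma expR_diff_bounds u w :
  (u - w) * expR w <= expR u - expR w <= (u - w) * expR u.
Proof.
have e (x y : R) : expR x = expR y * expR (x - y) by rewrite -expRD addrC subrK.
have h1 := expR_ge1Dx (u - w); have h2 := expR_ge1Dx (w - u).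
have h3 : expR w * (1 + (u - w)) <= expR u by rewrite [leRHS](e u w) ler_wpM2l
  ?expR_ge0.
have h4 : expR u * (1 + (w - u)) <= expR w by rewrite [leRHS](e w u) ler_wpM2l
  ?expR_ge0.
by apply/andP; split; lra.
Qed.

Lemma expR_lipschitz u w s : u <= - s -> w <= - s ->
  `|expR u - expR w| <= `|u - w| * expR (- s).
Proof.
move=> us ws; have /andP[h1 h2] := expR_diff_bounds u w.
have a1 : `|u - w| * expR u <= `|u - w| * expR (- s) by rewrite ler_wpM2l//
  ler_expR.
have a2 : `|u - w| * expR w <= `|u - w| * expR (- s) by rewrite ler_wpM2l//
  ler_expR.
have b1 : (u - w) * expR u <= `|u - w| * expR u
  by rewrite ler_wpM2r ?expR_ge0// ler_norm.
have b2 : - (u - w) * expR w <= `|u - w| * expR w.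
  by rewrite ler_wpM2r ?expR_ge0// -normrN ler_norm.
by rewrite ler_norml; apply/andP; split; lra.
Qed.

(** The remainder lies between 0 and [(u - w) * (expR u - expR w)]; the Lipschitz bound supplies the
    second factor [u - w]. *)
Lemma expR_taylor1 u w s : u <= - s -> w <= - s ->
  `|expR u - expR w - (u - w) * expR w| <= (u - w) ^+ 2 * expR (- s).
Proof.
move=> us ws; have /andP[h1 h2] := expR_diff_bounds u w.
rewrite ger0_norm ?subr_ge0// (@le_trans _ _ ((u - w) * (expR u - expR w)))//.
  by lra.
rewrite (le_trans (ler_norm _))// normrM -[(u - w) ^+ 2]real_normK ?num_real//.
by rewrite expr2 -mulrA ler_wpM2l// expR_lipschitz.
Qed.

(** The first-order terms combine into [u + v - 2 * w]. For reflected phases this is of order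
    [s ^+ 4], one better than each difference alone. *)
Lemma expR_second_difference u v w s : u <= - s -> v <= - s -> w <= - s ->
  `|expR u + expR v - 2 * expR w|
  <= (`|u + v - 2 * w| + (u - w) ^+ 2 + (v - w) ^+ 2) * expR (- s).
Proof.
move=> us vs ws.
have -> : expR u + expR v - 2 * expR w = (u + v - 2 * w) * expR w
    + (expR u - expR w - (u - w) * expR w) + (expR v - expR w - (v - w) * expR
      w).
  by ring.
rewrite (le_trans (ler_normD _ _))// [leRHS]mulrDl lerD ?expR_taylor1//.
rewrite (le_trans (ler_normD _ _))// [leRHS]mulrDl lerD ?expR_taylor1//.
by rewrite normrM (ger0_norm (expR_ge0 w)) ler_wpM2l// ler_expR.
Qed.

(* Here u, v are the phases at (x, z) and (x, -z), gp, gm the amplitudes there,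
   w the quadratic model and P the leading part of the amplitude; the sum is
   P(e^u + e^v - 2e^w) + (gp + gm - 2P)e^w + (gp - P)(e^u - e^w)
     + (gm - P)(e^v - e^w). *)
Lemma weighted_exp_difference (j : nat) C N s c (u v w gp gm P : R) :
  0 <= C -> 0 < N -> 0 <= s ->
  u <= - (c * (N * s ^+ 2)) -> v <= - (c * (N * s ^+ 2)) -> w
    <= - (c * (N * s ^+ 2)) ->
  `|u - w| <= N * (C * s ^+ 3) -> `|v - w| <= N * (C * s ^+ 3) ->
  `|u + v - 2 * w| <= N * (C * s ^+ 4) ->
  `|P| <= C * s ^+ (2 * j) ->
  `|gp - P| <= C * s ^+ (2 * j).+1 -> `|gm - P| <= C * s ^+ (2 * j).+1 ->
  `|gp + gm - 2 * P| <= C * s ^+ (2 * j).+2 ->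
  `|gp * expR u + gm * expR v - 2 * (P * expR w)|
  <= (C * (N * s ^+ 2) ^+ j.+1 + 3 * C ^+ 2 * (N * s ^+ 2) ^+ j.+2
      + 2 * C ^+ 3 * (N * s ^+ 2) ^+ j.+3) / N ^+ j.+1
     * expR (- (c * (N * s ^+ 2))).
Proof.
move=> C0 N0 s0 us vs ws uw vw uvw PC gpC gmC gC.
set E := expR (- _).
have E0 : 0 <= E := expR_ge0 _.
have -> : gp * expR u + gm * expR v - 2 * (P * expR w)
    = P * (expR u + expR v - 2 * expR w) + (gp + gm - 2 * P) * expR w
      + (gp - P) * (expR u - expR w) + (gm - P) * (expR v - expR w) by ring.
have Ns0 : 0 <= N * (C * s ^+ 3) by rewrite mulr_ge0 ?(ltW N0)// mulr_ge0//
  exprn_ge0.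
have sq (x : R) : `|x| <= N * (C * s ^+ 3) -> x ^+ 2 <= (N * (C * s ^+ 3)) ^+ 2.
  by move=> h; rewrite -[leLHS]real_normK ?num_real// lerXn2r// nnegrE.
have t1 : `|P * (expR u + expR v - 2 * expR w)|
    <= C * s ^+ (2 * j) * ((N * (C * s ^+ 4) + (N * (C * s ^+ 3)) ^+ 2
         + (N * (C * s ^+ 3)) ^+ 2) * E).
  rewrite normrM ler_pM// (le_trans (expR_second_difference us vs ws))//.
  by rewrite ler_wpM2r// lerD ?sq// lerD ?sq.
have t2 : `|(gp + gm - 2 * P) * expR w| <= C * s ^+ (2 * j).+2 * E.
  by rewrite normrM (ger0_norm (expR_ge0 w)) ler_pM// ?expR_ge0// ler_expR.
have t3 : `|(gp - P) * (expR u - expR w)|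
    <= C * s ^+ (2 * j).+1 * (N * (C * s ^+ 3) * E).
  rewrite normrM ler_pM// (le_trans (expR_lipschitz us ws))//.
  by rewrite ler_wpM2r.
have t4 : `|(gm - P) * (expR v - expR w)|
    <= C * s ^+ (2 * j).+1 * (N * (C * s ^+ 3) * E).
  rewrite normrM ler_pM// (le_trans (expR_lipschitz vs ws))//.
  by rewrite ler_wpM2r.
rewrite (le_trans (ler_normD _ _))//.
rewrite (le_trans (lerD (ler_normD _ _) t4))//.
rewrite (le_trans (lerD (lerD (ler_normD _ _) t3) (lexx _)))//.
rewrite (le_trans (lerD (lerD (lerD t1 t2) (lexx _)) (lexx _)))//.
(* The four bounds add up to the right-hand side exactly: its coefficient 3 is 1 from [t1] and 2
   from [t3] and [t4]. *)
rewrite le_eqVlt; apply/orP; left; apply/eqP.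
have -> : s ^+ (2 * j).+2 = s * (s * (s ^+ 2) ^+ j) by rewrite 2!exprS exprM.
have -> : s ^+ (2 * j).+1 = s * (s ^+ 2) ^+ j by rewrite exprS exprM.
have -> : s ^+ (2 * j) = (s ^+ 2) ^+ j by rewrite exprM.
rewrite ![(N * s ^+ 2) ^+ _.+1]exprS [(N * s ^+ 2) ^+ j]exprMn [N ^+ j.+1]exprS.
have : N ^+ j != 0 by rewrite expf_neq0// gt_eqF.
move: (N ^+ j) ((s ^+ 2) ^+ j) => Nj Sj Nj0.
by field; rewrite Nj0 gt_eqF.
Qed.

(** Half of the exponential absorbs the polynomial, the other half is kept for the integration. *)
Lemma sum_expr_expRN_bounded (j : nat) C c : 0 < c -> 0 <= C ->
  exists2 M, 0 < M & forall s, 0 <= s ->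
    (C * s ^+ j.+1 + 3 * C ^+ 2 * s ^+ j.+2 + 2 * C ^+ 3 * s ^+ j.+3)
      * expR (- (c * s)) <= M * expR (- (c / 2 * s)).
Proof.
move=> c0 C0; have c20 : 0 < c / 2 by rewrite divr_gt0.
have [M1 M10 h1] := exprn_expRN_bounded j.+1 c20.
have [M2 M20 h2] := exprn_expRN_bounded j.+2 c20.
have [M3 M30 h3] := exprn_expRN_bounded j.+3 c20.
exists (C * M1 + 3 * C ^+ 2 * M2 + 2 * C ^+ 3 * M3 + 1).
  by rewrite ltr_wpDl// !addr_ge0// !mulr_ge0 ?exprn_ge0 ?(ltW M10) ?(ltW M20)
    ?(ltW M30).
move=> s s0; have -> : - (c * s) = - (c / 2 * s) + - (c / 2 * s) by field.
rewrite expRD mulrA ler_wpM2r ?expR_ge0// !mulrDl.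
have k1 : C * s ^+ j.+1 * expR (- (c / 2 * s)) <= C * M1.
  by rewrite -mulrA ler_wpM2l// h1.
have k2 : 3 * C ^+ 2 * s ^+ j.+2 * expR (- (c / 2 * s)) <= 3 * C ^+ 2 * M2.
  by rewrite -mulrA ler_wpM2l ?h2// mulr_ge0// exprn_ge0.
have k3 : 2 * C ^+ 3 * s ^+ j.+3 * expR (- (c / 2 * s)) <= 2 * C ^+ 3 * M3.
  by rewrite -mulrA ler_wpM2l ?h3// mulr_ge0// exprn_ge0.
by lra.
Qed.

(** Both comparison functions are Gamma integrands; they dominate [J], which yields its
    integrability together with the estimate. *)
Lemma outer_estimate (J : R -> R) m (a b Z B : R) : 0 < a -> 0 < b ->
  measurable_fun [set: R] J ->
  (forall x, 0 < x -> `|J x - Z * (x ^+ m * expR (- (a * x)))|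
     <= B * (x ^+ m * expR (- (b * x)))) ->
  `|\int[@lebesgue_measure R]_(x in `]0, +oo[) J x - Z * (m`!%:R / a ^+ m.+1)|
     <= B * (m`!%:R / b ^+ m.+1).
Proof.
move=> a0 b0 mJ hJ; set mu := @lebesgue_measure R;
  set D : set R := `]0, +oo[%classic.
have mD : measurable D by exact: measurable_itv.
pose e (k : R) x := x ^+ m * expR (- (k * x)).
have me k : measurable_fun [set: R] (e k).
  apply: measurable_funM; first exact: exprn_measurable.
  by apply: measurableT_comp => //; apply: measurableT_comp => //.
have cv (u : R -> R) : measurable_fun [set: R] u ->
    @measurable_fun _ _ (measurableTypeR R) R D u.
  by move=> mfu; exact: (@measurable_funTS _ _ (measurableTypeR R) R _ _ mfu).
have ie k : 0 < k -> mu.-integrable D (EFin \o e k).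
  move=> k0; apply/integrableP; split.
    by apply/measurable_EFinP; apply: cv; exact: me.
  have -> : (\int[mu]_(x in D) `|(EFin \o e k) x|
    = \int[mu]_(x in D) (e k x)%:E)%E.
    apply: eq_integral => x /set_mem; rewrite /D /= in_itv/= andbT => x0.
    by rewrite ger0_norm// mulr_ge0 ?expR_ge0// exprn_ge0// ltW.
  by rewrite integral_exprn_expRN// ltry.
have Ie k : 0 < k -> \int[mu]_(x in D) e k x = m`!%:R / k ^+ m.+1.
  by move=> k0; rewrite /Rintegral integral_exprn_expRN.
have iZ k y : 0 < k -> mu.-integrable D (EFin \o (fun x => y * e k x)).
  move=> k0; rewrite (_ : _ \o _ = (fun x => y%:E * (e k x)%:E)%E)//.
  by apply: integrableZl => //; exact: ie.
have iDf : mu.-integrable D (EFin \o (fun x => J x - Z * e a x)).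
  apply: le_integrable (iZ b B b0) => //.
    apply/measurable_EFinP; apply: cv; apply: measurable_funB => //.
    exact: measurable_funM.
  move=> x; rewrite /D /= in_itv/= andbT => x0.
  by rewrite lee_fin (le_trans (hJ x x0))// ler_norm.
have iJ : mu.-integrable D (EFin \o J).
  have -> : EFin \o J = (fun x => (J x - Z * e a x)%:E + (Z * e a x)%:E)%E.
    by apply/funext => x; rewrite -EFinD subrK.
  by apply: integrableD => //; exact: iZ.
rewrite -(Ie a)// -RintegralZl//; last exact: ie.
rewrite -RintegralB//; last exact: iZ.
rewrite (le_trans (le_normr_Rintegral _ iDf))//.
rewrite -(Ie b)// -RintegralZl//; last exact: ie.
apply: le_Rintegral => //.
- exact: (integrable_abse iDf).
- exact: iZ.
- by move=> x; rewrite /D /= in_itv/= andbT; exact: hJ.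
Qed.

End Pointwise.

(** * The Laplace estimate *)

Section Core.
Variables (R : realType) (n m : nat) (f g : 'rV[R]_(1 + n) -> R).
Variable K : set 'rV[R]_(1 + n).
Hypothesis K_compact : compact K.
Hypothesis K_nbhd : closure (@dom R n) `<=` interior K.
Hypothesis f_analytic : forall p, K p -> analytic_at f p.
Hypothesis g_analytic : forall p, K p -> analytic_at g p.
Hypothesis f_max : unique_max_at (closure (@dom R n)) f 0.
Hypothesis f_hess : neg_definite (hess_z f 0).
Hypothesis f_dx : diff_x f 0 < 0.
Local Notation mu := (@lebesgue_measure R).
Local Notation leb := (lebesgue_tuple R).
Implicit Types (N x : R) (z : 'rV[R]_n) (t : n.-tuple R).

Let D0 : closure (@dom R n) 0 := f_max.1.

Definition tdom : set (R * n.-tuple R) := [set xt | 0 < xt.1 < 1 /\ cube xt.2].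

Definition integrand N (xt : R * n.-tuple R) : R :=
  xt.1 ^+ m * g (pt xt.1 (rowt xt.2)) * expR (N * f (pt xt.1 (rowt xt.2))).

(** Extending by 0 outside the domain gives one measurable function on the full product, directly
    comparable with a Gaussian on all of R^n. *)
Definition fiber N x : R := \int[leb n]_t (integrand N \_ tdom) (x, t).

Lemma cubeP t : cube t <-> forall i, -1 < rowt t 0 i < 1.
Proof. by split => h i; have := h i; rewrite !mxE. Qed.

Lemma cube_oppt t : cube t -> cube (oppt t).
Proof.
move=> /cubeP h; apply/cubeP => i; rewrite rowt_oppt mxE; have := h i.
by rewrite ltrNr opprK andbC ltrNl.
Qed.

Lemma measurable_tdom : measurable tdom.
Proof.
have -> : tdom = (fst @^-1` `]0, 1[) `&`
    \bigcap_(i in [set: 'I_n]) ((fun xt : R * n.-tuple R => tnth xt.2 i) @^-1`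
      `]-1, 1[).
  apply/seteqP; split => xt.
    by move=> [h1 h2]; split => [|i _]; rewrite /= in_itv/=; [|exact: h2].
  move=> [h1 h2]; split; first by move: h1; rewrite /= in_itv.
  by move=> i; have := h2 i I; rewrite /= in_itv.
apply: measurableI.
  by rewrite -[X in measurable X]setTI; exact: measurable_fst.
apply: fin_bigcap_measurable => [|i _]; first exact: finite_finset.
rewrite -[X in measurable X]setTI.
by apply: (measurableT_comp (measurable_tnth i) measurable_snd).
Qed.

Lemma measurable_on_tdom (h : 'rV[R]_(1 + n) -> R) :
  (forall p, K p -> analytic_at h p) ->
  measurable_fun tdom (fun xt => h (pt xt.1 (rowt xt.2))).
Proof.
move=> ha.
apply: (@measurable_fun_continuous_rV _ _ _ _ tdom (fun xt => pt xt.1 (rowt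
  xt.2))).
- exact: measurable_tdom.
- apply: idxP => [|i].
    by under eq_fun do rewrite pt_x; exact: measurable_fst.
  under eq_fun do rewrite pt_z mxE.
  by apply: (measurableT_comp (measurable_tnth i) measurable_snd).
- move=> xt [x01 /cubeP z01]; apply: analytic_continuous; apply: ha.
  apply: (@interior_subset _ K); apply: K_nbhd; apply: subset_closure.
  exact: pt_dom.
Qed.

Lemma measurable_integrand N :
  measurable_fun [set: R * n.-tuple R] (integrand N \_ tdom).
Proof.
apply/(measurable_restrictT _ measurable_tdom).
apply: measurable_funM.
  apply: measurable_funM; last exact: measurable_on_tdom.
  by apply: measurable_funTS; apply: measurable_funX; exact: measurable_fst.
apply: measurableT_comp => //; apply: measurable_funM => //.
exact: measurable_on_tdom.
Qed.

Lemma measurable_fiber N : measurable_fun [set: R] (fiber N).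
Proof.
have mE : measurable_fun [set: R * n.-tuple R] (EFin \o (integrand N \_ tdom)).
  by apply/measurable_EFinP; exact: measurable_integrand.
have mp := measurable_funepos mE; have mn := measurable_funeneg mE.
have -> : fiber N = fine \o (fun x =>
    \int[leb n]_t (EFin \o (integrand N \_ tdom))^\+ (x, t)
    - \int[leb n]_t (EFin \o (integrand N \_ tdom))^\- (x, t))%E.
  apply/funext => x; rewrite /fiber /Rintegral /= integralE;
    congr (fine (_ - _)).
    by apply: eq_integral => t _; rewrite !funeposE.
  by apply: eq_integral => t _; rewrite !funenegE.
apply: measurableT_comp => //; apply: emeasurable_funB.
  by apply: (@measurable_fun_fubini_tonelli_F _ _ _ _ R (leb n) _ mp) => xt;
    exact: funepos_ge0.
by apply: (@measurable_fun_fubini_tonelli_F _ _ _ _ R (leb n) _ mn) => xt;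
  exact: funeneg_ge0.
Qed.

Lemma laplace_int_fiber N :
  laplace_int m f g N = \int[mu]_(x in `]0, +oo[) fiber N x.
Proof.
rewrite /laplace_int [LHS]Rintegral_mkcond [RHS]Rintegral_mkcond.
congr Rintegral; apply/funext => x; rewrite !patchE !mem_setE !in_itv/= andbT.
have [x01|x01] := boolP (0 < x < 1).
  rewrite (proj1 (andP x01)) Rintegral_mkcond; congr Rintegral.
  apply/funext => t; rewrite !patchE; congr (if _ then _ else _).
  by apply/idP/idP => /set_mem h; apply/mem_set; [split|case: h].
case: ifP => // x0; rewrite /fiber [RHS](_ : _ = \int[leb n]_t (cst 0 t)).
  by rewrite Rintegral_cst// mul0r.
apply: eq_Rintegral => t _; rewrite patchE memNset// => -[].
by move=> /=; rewrite (negbTE x01).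
Qed.

Variables (j : nat) (c0 : R) (G : 'M[R]_n) (C : R).
Hypothesis C_ge0 : 0 <= C.
Hypothesis g_lead : forall x z, 0 < x ->
  `|c0 + qform G z| <= C * Num.sqrt (rho x z) ^+ (2 * j).
Hypothesis g_approx : forall x z, 0 < x < 1 -> (forall i, -1 < z 0 i < 1) ->
  `|g (pt x z) - (c0 + qform G z)| <= C * Num.sqrt (rho x z) ^+ (2 * j).+1.
Hypothesis g_sym : forall x z, 0 < x < 1 -> (forall i, -1 < z 0 i < 1) ->
  `|g (pt x z) + g (pt x (- z)) - 2 * (c0 + qform G z)|
    <= C * Num.sqrt (rho x z) ^+ (2 * j).+2.

Let a := - diff_x f 0.
Let A := - hess_z f 0.

Let a0 : 0 < a. Proof. by rewrite oppr_gt0. Qed.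
Let As : A^T = A. Proof. by rewrite linearN/= (hess_sym K_nbhd D0 f_analytic).
  Qed.
Let Apos z : z != 0 -> 0 < qform A z. Proof. exact: neg_hess_pos. Qed.

Let As_scale N : (N *: A)^T = N *: A. Proof. by rewrite linearZ/= As. Qed.
Let Apos_scale N : 0 < N -> forall z, z != 0 -> 0 < qform (N *: A) z.
Proof. by move=> N0 z z0; rewrite qformZ mulr_gt0// Apos. Qed.

Definition phase x (z : 'rV[R]_n) : R := - (a * x) - qform A z / 2.

Lemma phase_coercive : exists2 c, 0 < c &
  forall x z, 0 <= x -> phase x z <= - (c * rho x z).
Proof.
have [c c_gt0 hc] := qform_coercive As Apos.
exists (Num.min a (c / 2)); first by rewrite lt_min a0 divr_gt0.
move=> x z x0; rewrite /phase /rho mulrDr.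
have : Num.min a (c / 2) * x <= a * x by rewrite ler_wpM2r// ge_min lexx.
have : Num.min a (c / 2) * normsq z <= c / 2 * normsq z.
  by rewrite ler_wpM2r ?normsq_ge0// ge_min lexx orbT.
by have := hc z; lra.
Qed.

Lemma phase_taylor2 x z : taylor2 f x z = f 0 + phase x z.
Proof.
rewrite /taylor2 (grad_z_max K_compact K_nbhd D0 f_analytic f_max).
rewrite big1 ?addr0 => [|i _]; last by rewrite mxE mulr0.
have AE : qform A z = - qform (hess_z f 0) z.
  by rewrite /qform /A mulmxN mulNmx mxE.
by rewrite /phase AE /a; ring.
Qed.

Lemma phaseN x z : phase x (- z) = phase x z.
Proof. by rewrite /phase qformN. Qed.

Lemma rhoN x (z : 'rV[R]_n) : rho x (- z) = rho x z.
Proof. by rewrite /rho normsqN. Qed.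

(** Outside the domain some coordinate has absolute value at least 1. This lets the error term cover
    the main term there. *)
Lemma rho_out x t : 0 < x -> ~ tdom (x, t) -> 1 <= rho x (rowt t).
Proof.
move=> x0 nD; rewrite leNgt; apply/negP => r1; apply: nD; split => /=.
  by rewrite x0 (le_lt_trans _ r1)// lerDl normsq_ge0.
apply/cubeP => i; rewrite -ltr_norml -(@ltr_pXn2r _ 2)// ?nnegrE//.
rewrite real_normK ?num_real// expr1n (le_lt_trans (le_normsq _ i))//.
by rewrite (le_lt_trans _ r1)// lerDr ltW.
Qed.

(** The first bound provides integrability in z, the second the estimate proper. The rate [b] is
    half of the common decay rate [c] of the phase and of its model, the rest being spent on powers
    of [N * s ^+ 2]. *)
Lemma fiber_estimate : exists B b M : R, 0 < b /\ forall N, 1 <= N ->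
  forall x, 0 < x ->
    (forall t, `|(integrand N \_ tdom) (x, t)|
      <= M * (x ^+ m * expR (N * f 0)) * expR (- (N * b * normsq (rowt t)))) /\
    (forall t, `|(integrand N \_ tdom) (x, t) + (integrand N \_ tdom) (x,
      oppt t)
       - 2 * (expR (N * f 0) * (x ^+ m * expR (- (N * a * x)))
              * gaussian (N *: A) c0 G t)|
     <= 2 * (expR (N * f 0) * (B / N ^+ j.+1) * (x ^+ m * expR (- (N * b * x)))
             * expR (- (N * b * normsq (rowt t))))).
Proof.
have [cf cf0 fdecay] := phase_decay K_compact K_nbhd D0 f_analytic f_max f_hess
  f_dx.
have [cq cq0 qdecay] := phase_coercive.
have [Cf Cf0 fexp] := global_expansion K_compact K_nbhd D0 f_analytic.
have [Mg hMg] := analytic_bounded K_compact K_nbhd D0 g_analytic.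
pose c := Num.min cf cq.
have c_gt0 : 0 < c by rewrite lt_min cf0.
pose CC := Cf + C.
have CC0 : 0 <= CC by rewrite addr_ge0.
have [B B0 hB] := sum_expr_expRN_bounded j c_gt0 CC0.
exists B, (c / 2), `|Mg|; split; first by rewrite divr_gt0.
move=> N N1 x x0.
have N0 : 0 < N := lt_le_trans ltr01 N1.
have xm0 : 0 <= x ^+ m by rewrite exprn_ge0// ltW.
pose s t := Num.sqrt (rho x (rowt t)).
have s0 t : 0 <= s t by exact: sqrtr_ge0.
have s2 t : s t ^+ 2 = rho x (rowt t) by rewrite sqr_sqrtr// rho_ge0// ltW.
have sN t : s (oppt t) = s t by rewrite /s rowt_oppt rhoN.
have CE k t : C * s t ^+ k <= CC * s t ^+ k by rewrite ler_wpM2r ?exprn_ge0//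
  lerDr.
have CfE k t : Cf * s t ^+ k <= CC * s t ^+ k by rewrite ler_wpM2r ?exprn_ge0//
  lerDl.
pose w t := N * phase x (rowt t).
have wle t : w t <= - (c * (N * s t ^+ 2)).
  rewrite /w mulrCA -mulrN ler_wpM2l ?(ltW N0)// s2.
  rewrite (le_trans (qdecay _ _ (ltW x0)))// lerN2 ler_wpM2r ?rho_ge0 ?(ltW
    x0)//.
  by rewrite ge_min lexx orbT.
pose u t := N * (f (pt x (rowt t)) - f 0).
pose P t := c0 + qform G (rowt t).
have kE t : expR (N * f 0) * (x ^+ m * expR (- (N * a * x))) * gaussian (N *:
  A) c0 G t
    = expR (N * f 0) * x ^+ m * (P t * expR (w t)).
  have -> : expR (w t) = expR (- (N * a * x)) * expR (- qform (N *: A) (rowt t)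
    / 2).
    by rewrite -expRD; congr expR; rewrite /w /phase qformZ; ring.
  by rewrite /gaussian /P; ring.
have FE t : tdom (x, t) -> (integrand N \_ tdom) (x, t)
    = expR (N * f 0) * x ^+ m * (g (pt x (rowt t)) * expR (u t)).
  move=> Dt; rewrite patchE mem_set// /integrand /=.
  have -> : N * f (pt x (rowt t)) = N * f 0 + u t by rewrite /u; ring.
  by rewrite expRD; ring.
have F0 t : ~ tdom (x, t) -> (integrand N \_ tdom) (x, t) = 0.
  by move=> Dt; rewrite patchE memNset.
have DN t : tdom (x, t) -> tdom (x, oppt t).
  by move=> [h1 h2]; split => //; exact: cube_oppt.
have opptK t : oppt (oppt t) = t.
  by apply: eq_from_tnth => i; rewrite !tnth_map opprK.
have ule t : tdom (x, t) -> u t <= - (c * (N * s t ^+ 2)).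
  move=> [x01 /cubeP z01]; rewrite /u mulrCA -mulrN ler_wpM2l ?(ltW N0)// s2.
  rewrite (le_trans (fdecay _ _ x01 z01))// lerN2 ler_wpM2r ?rho_ge0 ?(ltW
    x0)//.
  by rewrite ge_min lexx.
(* As [rho] is a sum, the decay factors into a part in x and a part in z, the form required by the
   two successive integrations. *)
have finish t : expR (- (c / 2 * (N * s t ^+ 2)))
    = expR (- (N * (c / 2) * x)) * expR (- (N * (c / 2) * normsq (rowt t))).
  by rewrite -expRD s2 /rho; congr expR; ring.
split => t.
  have [Dt|Dt] := pselect (tdom (x, t)); last first.
    by rewrite F0// normr0 !mulr_ge0 ?expR_ge0.
  rewrite FE// !normrM (ger0_norm xm0) !(ger0_norm (expR_ge0 _)).
  have gM : `|g (pt x (rowt t))| <= `|Mg|.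
    rewrite (le_trans _ (ler_norm _))// hMg//; apply: subset_closure.
    by case: Dt => x01 /cubeP; exact: pt_dom.
  have ue : expR (u t) <= expR (- (N * (c / 2) * normsq (rowt t))).
    rewrite ler_expR (le_trans (ule t Dt))// lerN2 s2 /rho.
    have n0 := normsq_ge0 (rowt t).
    rewrite -mulrA [leRHS]mulrCA ler_wpM2l ?(ltW N0)//.
    have : 0 <= c * x by rewrite mulr_ge0 ?(ltW c_gt0)// ltW.
    have : 0 <= c * normsq (rowt t) by rewrite mulr_ge0// ltW.
    by lra.
  rewrite [expR (N * f 0) * _]mulrC.
  have -> : `|Mg| * (x ^+ m * expR (N * f 0)) * expR (- (N * (c / 2) * normsq
    (rowt t)))
    = x ^+ m * expR (N * f 0) * (`|Mg| * expR (- (N * (c / 2) * normsq (rowt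
      t)))) by ring.
  by rewrite ler_wpM2l ?mulr_ge0 ?expR_ge0// ler_pM ?expR_ge0.
have Ex0 : 0 <= expR (N * f 0) * x ^+ m by rewrite mulr_ge0 ?expR_ge0.
have -> : 2 * (expR (N * f 0) * (B / N ^+ j.+1) * (x ^+ m * expR (- (N * (c /
  2) * x)))
             * expR (- (N * (c / 2) * normsq (rowt t))))
    = expR (N * f 0) * x ^+ m * (2 * (B / N ^+ j.+1 * expR (- (c / 2 * (N * s t
      ^+ 2))))).
  by rewrite finish; ring.
have Nj0 : 0 < N ^+ j.+1 by rewrite exprn_gt0.
have S0 : 0 <= N * s t ^+ 2 by rewrite mulr_ge0 ?(ltW N0) ?sqr_ge0.
have hBt : (CC * (N * s t ^+ 2) ^+ j.+1 + 3 * CC ^+ 2 * (N * s t ^+ 2) ^+ j.+2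
      + 2 * CC ^+ 3 * (N * s t ^+ 2) ^+ j.+3) / N ^+ j.+1
     * expR (- (c * (N * s t ^+ 2)))
    <= B / N ^+ j.+1 * expR (- (c / 2 * (N * s t ^+ 2))).
  by rewrite [leLHS]mulrAC [leRHS]mulrAC ler_pM2r ?invr_gt0// hB.
have BE0 : 0 <= B / N ^+ j.+1 * expR (- (c / 2 * (N * s t ^+ 2))).
  by rewrite mulr_ge0 ?expR_ge0// divr_ge0// ltW.
rewrite kE.
(* The domain is symmetric in z, so outside it both integrand values vanish and only the main term
   is left. There [s ^+ 2 >= 1], whence [s ^+ (2 * j) <= (N * s ^+ 2) ^+ j.+1 / N ^+ j.+1]. *)
have [Dt|Dt] := pselect (tdom (x, t)); last first.
  have DNt : ~ tdom (x, oppt t) by move/DN; rewrite opptK.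
  rewrite !F0// add0r sub0r normrN.
  rewrite mulrCA normrM (ger0_norm Ex0) ler_wpM2l// normrM (ger0_norm (_ : 0
    <= 2))//.
  rewrite ler_pM2l// (le_trans _ hBt)// normrM (ger0_norm (expR_ge0 _)).
  rewrite ler_pM ?expR_ge0 ?ler_expR//.
  have r1 : 1 <= s t ^+ 2 by rewrite s2; exact: rho_out.
  rewrite (le_trans (g_lead _ x0))// -/(s t) ler_pdivlMr//.
  rewrite (@le_trans _ _ (CC * (N * s t ^+ 2) ^+ j.+1))//.
    rewrite (le_trans (ler_wpM2r (ltW Nj0) (CE _ t)))// -mulrA ler_wpM2l//.
    rewrite exprM; move: (s t ^+ 2) r1 => S r1.
    rewrite exprMn mulrC ler_wpM2l ?(ltW Nj0)// exprS ler_peMl//.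
    by rewrite exprn_ge0// (le_trans ler01).
  by rewrite -addrA lerDl addr_ge0// mulr_ge0 ?exprn_ge0// mulr_ge0 ?exprn_ge0.
have DNt := DN t Dt.
rewrite !FE//.
have -> : expR (N * f 0) * x ^+ m * (g (pt x (rowt t)) * expR (u t)) +
   expR (N * f 0) * x ^+ m * (g (pt x (rowt (oppt t))) * expR (u (oppt t))) -
   2 * (expR (N * f 0) * x ^+ m * (P t * expR (w t)))
  = expR (N * f 0) * x ^+ m * (g (pt x (rowt t)) * expR (u t)
     + g (pt x (- rowt t)) * expR (u (oppt t)) - 2 * (P t * expR (w t))).
  by rewrite rowt_oppt; ring.
rewrite normrM (ger0_norm Ex0) ler_wpM2l//.
rewrite (@le_trans _ _ (B / N ^+ j.+1 * expR (- (c / 2 * (N * s t ^+ 2)))))//;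
  last first.
  by rewrite ler_peMl// ler1n.
rewrite (le_trans _ hBt)//.
have [x01 /cubeP z01] := Dt.
have [_ /cubeP zN01] := DNt.
rewrite /= in x01 z01 zN01.
have [e1 e2] := fexp _ _ x01 z01.
have [e1N _] := fexp _ _ x01 zN01.
rewrite !phase_taylor2 rowt_oppt phaseN rhoN -?/(s t) in e1 e1N e2.
apply: weighted_exp_difference => //.
- exact: ule.
- by rewrite -sN; exact: ule.
- rewrite /u /w -mulrBr normrM (gtr0_norm N0) ler_pM2l//.
  by rewrite -addrA -opprD; exact: le_trans e1 (CfE 3%N t).
- rewrite /u /w -mulrBr normrM (gtr0_norm N0) ler_pM2l//.
  by rewrite rowt_oppt -addrA -opprD; exact: le_trans e1N (CfE 3%N t).
- have -> : u t + u (oppt t) - 2 * w t = N * (f (pt x (rowt t))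
  + f (pt x (- rowt t))
      - (f 0 + phase x (rowt t) + (f 0 + phase x (rowt t)))).
    by rewrite /u /w rowt_oppt; ring.
  by rewrite normrM (gtr0_norm N0) ler_pM2l// (le_trans _ (CfE 4%N t)).
- by rewrite (le_trans _ (CE _ t))// g_lead.
- by rewrite (le_trans _ (CE _ t))// g_approx.
- rewrite (le_trans _ (CE _ t))// /P -(qformN G) -[s t]sN /s rowt_oppt
  g_approx//.
  by rewrite rowt_oppt in zN01.
- by rewrite (le_trans _ (CE _ t))// g_sym.
Qed.

Lemma laplace_estimate : exists B b : R, 0 < b /\ forall N, 1 <= N ->
  `|laplace_int m f g N
    - expR (N * f 0) * ((c0 + \tr (G *m invmx (N *: A))) * gaussian_mass (N *:
      A))
      * (m`!%:R / (N * a) ^+ m.+1)|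
  <= expR (N * f 0) * (B / N ^+ j.+1) * Num.sqrt ((pi / (N * b)) ^+ n)
     * (m`!%:R / (N * b) ^+ m.+1).
Proof.
have [B [b [M [b0 est]]]] := fiber_estimate.
exists B, b; split => // N N1; have N0 : 0 < N := lt_le_trans ltr01 N1.
rewrite laplace_int_fiber; apply: outer_estimate.
- by rewrite mulr_gt0.
- by rewrite mulr_gt0.
- exact: measurable_fiber.
move=> x x0; have [FM FB] := est N N1 x x0.
have mF : measurable_fun [set: n.-tuple R] (fun t => (integrand N \_ tdom) (x,
  t)).
  exact: (measurableT_comp (measurable_integrand N) (measurable_pair1 x)).
have Nb0 : 0 < N * b by rewrite mulr_gt0.
have [_ +] := symmetrized_gaussian_estimate (As_scale N) (Apos_scale N0) Nb0 mF
  FM FB.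
rewrite -/(fiber N x) => h.
rewrite [X in `|_ - X|](_ : _ = expR (N * f 0) * (x ^+ m * expR (- (N * a * x)))
   * ((c0 + \tr (G *m invmx (N *: A))) * gaussian_mass (N *: A))); last by ring.
by rewrite (le_trans h)// le_eqVlt; apply/orP; left; apply/eqP; ring.
Qed.

End Core.

Section Powers.
Variable R : realType.

Lemma sqrt_exprn (y : R) n : 0 <= y -> Num.sqrt (y ^+ n) = y `^ (n%:R / 2).
Proof.
by move=> y0; rewrite powRrM powR_mulrn// powR12_sqrt// exprn_ge0.
Qed.

Lemma powR_exponent (N : R) (m n k : nat) : 0 < N ->
  N `^ (- m%:R - n%:R / 2 - k%:R) = (N `^ (n%:R / 2))^-1 / N ^+ (m + k).
Proof.
move=> N0; have -> : - m%:R - n%:R / 2 - k%:R = - (n%:R / 2) + - (m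
  + k)%:R :> R.
  by rewrite natrD; ring.
rewrite powRD; last by rewrite (gt_eqF N0) implybT.
by rewrite !powRN powR_mulrn// ltW.
Qed.

End Powers.

(** * From the explicit estimate to Landau's notation *)

Section LaplaceBigO.
Variables (R : realType) (n m : nat) (f g : 'rV[R]_(1 + n) -> R).
Variable K : set 'rV[R]_(1 + n).
Hypothesis K_compact : compact K.
Hypothesis K_nbhd : closure (@dom R n) `<=` interior K.
Hypothesis f_analytic : forall p, K p -> analytic_at f p.
Hypothesis g_analytic : forall p, K p -> analytic_at g p.
Hypothesis f_max : unique_max_at (closure (@dom R n)) f 0.
Hypothesis f_hess : neg_definite (hess_z f 0).
Hypothesis f_dx : diff_x f 0 < 0.
Implicit Types (N x : R) (z : 'rV[R]_n).

Let D0 : closure (@dom R n) 0 := f_max.1.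
Let a := - diff_x f 0.
Let H := hess_z f 0.
Let a0 : 0 < a. Proof. by rewrite oppr_gt0. Qed.
Let det0 : 0 < \det (- H).
Proof.
apply: det_posdef; last exact: neg_hess_pos.
by rewrite linearN/= (hess_sym K_nbhd D0 f_analytic).
Qed.

Let detE : \det (- H) = `|\det H|.
Proof. by rewrite -[LHS]gtr0_norm// -scaleN1r detZ normrM normrX normrN1 expr1n
  mul1r. Qed.

Lemma gaussian_mass_scale N : 0 < N -> gaussian_mass (N *: - H)
  = (2 * pi) `^ (n%:R / 2) / (N `^ (n%:R / 2)) / Num.sqrt `|\det H|.
Proof.
move=> N0; rewrite /gaussian_mass detZ -detE -!sqrt_exprn ?mulr_ge0 ?pi_ge0
  ?(ltW N0)//.
have p0 : 0 <= (2 * pi : R) ^+ n by rewrite exprn_ge0// mulr_ge0// pi_ge0.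
have N0n : 0 <= N ^+ n by rewrite exprn_ge0// ltW.
rewrite invfM mulrA (sqrtrM _ (divr_ge0 p0 N0n)) (sqrtrM _ p0).
by rewrite !sqrtrV// ltW.
Qed.

(** The factor 1 / N is the additional power of N in the second part; the sign comes from passing
    from [- H] to [H]. *)
Lemma trace_scale N (G : 'M[R]_n) : 0 < N ->
  \tr (G *m invmx (N *: - H)) = \tr (- G *m invmx H) / N.
Proof.
move=> N0; have uH : - H \in unitmx by rewrite unitmxE unitfE gt_eqF.
rewrite invmxZ; last first.
  by rewrite unitmxE detZ unitrM unitfE expf_neq0 ?gt_eqF//= -unitmxE.
have -> : invmx (- H) = - invmx H.
  have uH' : H \in unitmx by rewrite -[H]opprK -scaleN1r unitmxZ ?unitrN1.
  apply: (can_inj (mulmxK uH')); rewrite mulNmx mulVmx//.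
  by apply/eqP; rewrite -eqr_oppLR -mulmxN mulVmx.
by rewrite -scalemxAr mulmxN -mulNmx mxtraceZ mulrC.
Qed.

(** Part (1) is [j = 0] with [c0 = g 0] and [G = 0]; part (2) is [j = 1] with [c0 = 0] and [G] half
    the Hessian of [g]. *)
Lemma laplace_bigO (j : nat) (c0 : R) (G : 'M[R]_n) (C : R) (T : R -> R) :
  0 <= C ->
  (forall x z, 0 < x -> `|c0 + qform G z| <= C * Num.sqrt (rho x z) ^+ (2 * j))
    ->
  (forall x z, 0 < x < 1 -> (forall i, -1 < z 0 i < 1) ->
    `|g (pt x z) - (c0 + qform G z)| <= C * Num.sqrt (rho x z) ^+ (2 * j).+1) ->
  (forall x z, 0 < x < 1 -> (forall i, -1 < z 0 i < 1) ->
    `|g (pt x z) + g (pt x (- z)) - 2 * (c0 + qform G z)|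
      <= C * Num.sqrt (rho x z) ^+ (2 * j).+2) ->
  (forall N, 1 <= N -> T N = expR (N * f 0)
     * ((c0 + \tr (- G *m invmx H) / N)
        * ((2 * pi) `^ (n%:R / 2) / (N `^ (n%:R / 2)) / Num.sqrt `|\det H|))
     * (m`!%:R / (N * a) ^+ m.+1)) ->
  laplace_int m f g = T
    +O_ (pinfty_nbhs R)
      (fun N => expR (N * f 0) * N `^ (- m%:R - n%:R / 2 - j.+2%:R)).
Proof.
move=> C0 gl ga gs TE; apply/eqaddOP/bigO_exP.
have [B [b [b0 est]]] := laplace_estimate m K_compact K_nbhd f_analytic
  g_analytic
  f_max f_hess f_dx C0 gl ga gs.
(* The error bound with its powers of [N] removed. The sign of [B] is unknown, whence [|B|], and the
   summand 1 makes [k] positive. *)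
pose k := `|B| * Num.sqrt ((pi / b) ^+ n) * (m`!%:R / b ^+ m.+1) + 1.
have k0 : 0 < k.
  by rewrite ltr_wpDl// mulr_ge0 ?divr_ge0 ?exprn_ge0 ?(ltW b0).
exists k => //; near=> N.
have N1 : 1 <= N by near: N; apply: nbhs_pinfty_ge; exact: num_real.
have N0 : 0 < N := lt_le_trans ltr01 N1.
have E0 : 0 <= expR (N * f 0) := expR_ge0 _.
have -> : (laplace_int m f g - T) N = laplace_int m f g N - T N by [].
rewrite (TE N N1) -trace_scale// -gaussian_mass_scale//.
apply: (le_trans (est N N1)).
have p0 : 0 < N `^ (n%:R / 2) by rewrite powR_gt0.
rewrite [leRHS](_ : _ = expR (N * f 0) * (k * N `^ (- m%:R - n%:R / 2 -
  j.+2%:R))).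
  2: by rewrite ger0_norm ?mulr_ge0 ?powR_ge0//; ring.
rewrite -!mulrA ler_wpM2l// powR_exponent//.
have -> : Num.sqrt ((pi / (N * b)) ^+ n)
    = Num.sqrt ((pi / b) ^+ n) / N `^ (n%:R / 2).
  rewrite -sqrt_exprn ?(ltW N0)// -sqrtrV ?exprn_ge0 ?(ltW N0)//.
  rewrite -sqrtrM ?exprn_ge0 ?divr_ge0 ?pi_ge0 ?(ltW b0)//; congr Num.sqrt.
  by rewrite -exprVn -exprMn; congr (_ ^+ _); field; rewrite !gt_eqF.
have -> : N ^+ (m + j.+2) = N ^+ j.+1 * N ^+ m.+1.
  by rewrite -exprD; congr (_ ^+ _); rewrite addnC !addSn addnS.
have q0 : 0 <= Num.sqrt ((pi / b) ^+ n) * (m`!%:R / b ^+ m.+1).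
  by rewrite mulr_ge0 ?sqrtr_ge0// divr_ge0// exprn_ge0// ltW.
have r0 : 0 <= (N `^ (n%:R / 2))^-1 * (N ^+ j.+1 * N ^+ m.+1)^-1.
  by rewrite mulr_ge0 ?invr_ge0 ?(ltW p0)// mulr_ge0 ?exprn_ge0 ?(ltW N0).
rewrite [leLHS](_ : _ = B * (Num.sqrt ((pi / b) ^+ n) * (m`!%:R / b ^+ m.+1))
    * ((N `^ (n%:R / 2))^-1 * (N ^+ j.+1 * N ^+ m.+1)^-1)); last first.
  by rewrite [(N * b) ^+ _]exprMn !invfM; ring.
rewrite ler_wpM2r// /k -mulrA (@le_trans _ _ (`|B| * (Num.sqrt ((pi / b) ^+ n)
  * (m`!%:R / b ^+ m.+1))))//.
  by rewrite ler_wpM2r// ler_norm.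
by rewrite lerDl.
Unshelve. all: by end_near. Qed.

End LaplaceBigO.

Theorem theorem2 (R : realType) (n m : nat) (f g : 'rV[R]_(1 + n) -> R)
    (K : set 'rV[R]_(1 + n))
    (K_compact : compact K)
    (K_nbhd : closure (@dom R n) `<=` interior K)
    (f_analytic : forall p, K p -> analytic_at f p)
    (g_analytic : forall p, K p -> analytic_at g p)
    (f_max : unique_max_at (closure (@dom R n)) f (pt 0 0))
    (f_hess : neg_definite (hess_z f (pt 0 0)))
    (f_dx : diff_x f (pt 0 0) < 0) :
  (g (pt 0 0) != 0 ->
    laplace_int m f g =
      (fun N : R =>
        g (pt 0 0) * m`!%:R * (2 * pi) `^ (n%:R / 2)
        * expR (N * f (pt 0 0)) * N `^ (- m%:R - n%:R / 2 - 1)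
        / (Num.sqrt `|\det (hess_z f (pt 0 0))|
           * (- diff_x f (pt 0 0)) ^+ m.+1))
    +O_ (pinfty_nbhs R)
      (fun N : R => expR (N * f (pt 0 0)) * N `^ (- m%:R - n%:R / 2 - 2)))
  /\
  (g (pt 0 0) = 0 -> diff_x g (pt 0 0) = 0 -> grad_z g (pt 0 0) = 0 ->
    laplace_int m f g =
      (fun N : R =>
        \tr (- hess_z g (pt 0 0) *m invmx (hess_z f (pt 0 0)))
          * m`!%:R * (2 * pi) `^ (n%:R / 2)
        / (2 * Num.sqrt `|\det (hess_z f (pt 0 0))|
           * (- diff_x f (pt 0 0)) ^+ m.+1)
        * expR (N * f (pt 0 0)) * N `^ (- m%:R - n%:R / 2 - 2))
    +O_ (pinfty_nbhs R)
      (fun N : R => expR (N * f (pt 0 0)) * N `^ (- m%:R - n%:R / 2 - 3))).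
Proof.
move: f_max f_hess f_dx; rewrite pt00 => {}f_max {}f_hess {}f_dx.
have D0 : closure (@dom R n) 0 := f_max.1.
have [Cg Cg0 gexp] := global_expansion K_compact K_nbhd D0 g_analytic.
have a0 : - diff_x f 0 != 0 by rewrite oppr_eq0 lt_eqF.
have s_ge0 x (z : 'rV[R]_n) : 0 <= Num.sqrt (rho x z) by exact: sqrtr_ge0.
have s2 x (z : 'rV[R]_n) : 0 < x -> Num.sqrt (rho x z) ^+ 2 = x + normsq z.
  by move=> x0; rewrite sqr_sqrtr// rho_ge0// ltW.
split=> [_|g0 gx gz].
  (* [S] bounds both [rho] and its root on the domain, so a surplus power of [s] can be traded for a
     constant: here only orders [s] and [s ^+ 2] are wanted. *)
  pose S : R := n.+1%:R.
  have S1 : 1 <= S by rewrite ler1n.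
  have sS x (z : 'rV[R]_n) : 0 < x < 1 -> (forall i, -1 < z 0 i < 1) ->
      Num.sqrt (rho x z) ^+ 2 <= S /\ Num.sqrt (rho x z) <= S.
    move=> /andP[x0 x1] z01.
    have rS : rho x z <= S.
      rewrite /S -natr1 addrC lerD ?(ltW x1)//.
      by apply: normsq_le => i; rewrite ler_norml; have /andP[] := z01 i; lra.
    rewrite s2//; split => //.
    rewrite -[S]ger0_norm ?(le_trans ler01)// -sqrtr_sqr ler_wsqrtr//.
    by rewrite (le_trans rS)// expr2 ler_peMr// (le_trans ler01).
  pose b0 := abs_sum (hess_z g 0).
  have b0_ge0 : 0 <= b0 := abs_sum_ge0 _.
  pose b1 := \sum_i `|grad_z g 0 0 i|.
  have b1_ge0 : 0 <= b1 by exact: sumr_ge0.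
  pose C := Cg * S + 2 * `|diff_x g 0| * S + b1 + b0 * S + `|g 0|.
  have x_le x (z : 'rV[R]_n) : 0 < x -> `|x * diff_x g 0|
    <= `|diff_x g 0| * Num.sqrt (rho x z) ^+ 2.
    move=> x0; rewrite normrM mulrC ler_wpM2l// s2// gtr0_norm// lerDl.
    exact: normsq_ge0.
  have h_le x (z : 'rV[R]_n) : 0 < x -> `|qform (hess_z g 0) z|
    <= b0 * Num.sqrt (rho x z) ^+ 2.
    move=> x0; rewrite (le_trans (normr_qform_le _ _))// ler_wpM2l// s2// lerDr.
    exact: ltW.
  have q0 z : g 0 + qform 0 z = g 0 :> R.
    by rewrite /qform mulmx0 mul0mx mxE addr0.
  have d0 : 0 <= `|diff_x g 0| by [].
  have := @laplace_bigO R n m f g K K_compact K_nbhd f_analytic g_analytic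
    f_max f_hess f_dx 0 (g 0) 0 C.
  apply => //.
  - by rewrite /C !addr_ge0// !mulr_ge0.
  - by move=> x z x0; rewrite q0 muln0 expr0 mulr1 /C lerDr !addr_ge0//
    !mulr_ge0.
  - move=> x z x01 z01; have [x0 x1] := andP x01;
    have [e1 _] := gexp _ _ x01 z01.
    have [S2 Ss] := sS x z x01 z01.
    rewrite q0 muln0 expr1; move: e1 (x_le x z x0) (h_le x z x0) S2 Ss.
    have g1 : `|\sum_i z 0 i * grad_z g 0 0 i| <= b1 * Num.sqrt (rho x z).
      rewrite (le_trans (ler_norm_sum _ _ _))// /b1 mulr_suml ler_sum// => i _.
      rewrite normrM mulrC ler_wpM2l// -sqrtr_sqr ler_wsqrtr//.
      by rewrite (le_trans (le_normsq z i))// lerDr ltW.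
    move: g1; rewrite /taylor2; move: (s_ge0 x z).
    set s := Num.sqrt _; set u := \sum_i _; set v := x * _; set w := qform _ _.
    move=> sge g1 e1 v1 w1 S2 Ss.
    have s3 : Cg * s ^+ 3 <= Cg * (S * s).
      by rewrite ler_wpM2l// exprSr ler_wpM2r.
    have t2 : s ^+ 2 <= S * s by rewrite expr2 ler_wpM2r.
    have v2 : `|diff_x g 0| * s ^+ 2 <= `|diff_x g 0| * (S * s)
      by rewrite ler_wpM2l.
    have w2 : b0 * s ^+ 2 <= b0 * (S * s) by rewrite ler_wpM2l.
    have -> : g (pt x z) - g 0 = (g (pt x z) - (g 0 + v + u + w / 2)) + v + u
      + w / 2.
      by ring.
    rewrite (le_trans (ler_normD _ _))//.
    rewrite (le_trans (lerD (ler_normD _ _) (lexx _)))//.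
    rewrite (le_trans (lerD (lerD (ler_normD _ _) (lexx _)) (lexx _)))//.
    have w3 : `|w / 2| <= `|w|.
      by rewrite normrM (ger0_norm (_ : 0 <= 2^-1))// ler_pdivrMr//;
        have := normr_ge0 w; lra.
    have g3 : 0 <= `|g 0| * s by rewrite mulr_ge0.
    have d3 : 0 <= `|diff_x g 0| * (S * s) by rewrite !mulr_ge0//
      (le_trans ler01).
    by rewrite /C; lra.
  - move=> x z x01 z01; have [x0 x1] := andP x01;
    have [_ e1] := gexp _ _ x01 z01.
    have [S2 Ss] := sS x z x01 z01.
    rewrite q0 muln0; move: e1 (x_le x z x0) (h_le x z x0) S2.
    (* Symmetrizing removes the gradient of [g], the only contribution of order [s]. *)
    rewrite taylor2N; move: (s_ge0 x z).
    set s := Num.sqrt _; set v := x * _; set w := qform _ _.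
    move=> sge e1 v1 w1 S2; have t0 : 0 <= s ^+ 2 by rewrite sqr_ge0.
    have s4 : Cg * s ^+ 4 <= Cg * (S * s ^+ 2).
      by rewrite ler_wpM2l// (exprD _ 2 2) ler_wpM2r.
    have -> : g (pt x z) + g (pt x (- z)) - 2 * g 0
      = (g (pt x z) + g (pt x (- z)) - 2 * (g 0 + v + w / 2)) + (2 * v) + w
        by field.
    rewrite (le_trans (ler_normD _ _))//.
    rewrite (le_trans (lerD (ler_normD _ _) (lexx _)))//.
    rewrite [`|2 * v|]normrM (ger0_norm (_ : 0 <= 2))//.
    have g3 : 0 <= `|g 0| * s ^+ 2 by rewrite mulr_ge0.
    have b3 : 0 <= b1 * s ^+ 2 by rewrite mulr_ge0.
    have d3 : `|diff_x g 0| * s ^+ 2 <= `|diff_x g 0| * S * s ^+ 2.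
      by rewrite ler_wpM2r// ler_peMr.
    have b4 : b0 * s ^+ 2 <= b0 * S * s ^+ 2 by rewrite ler_wpM2r// ler_peMr.
    by rewrite /C; lra.
  - move=> N N1; have N0 : 0 < N := lt_le_trans ltr01 N1.
    rewrite oppr0 mul0mx mxtrace0 mul0r addr0 -[1 in LHS]/(1%:R)
      powR_exponent//.
    by rewrite addn1 exprMn !invfM; ring.
have G0 z : 0 + qform (2^-1 *: hess_z g 0) z = qform (hess_z g 0) z / 2 :> R.
  by rewrite add0r qformZ mulrC.
(* With value and first derivatives zero, the Taylor polynomial is the leading part itself, and
   [global_expansion] gives the required bounds directly. *)
have T2 x (z : 'rV[R]_n) : taylor2 g x z = qform (hess_z g 0) z / 2.
  rewrite /taylor2 g0 gx gz mulr0 !add0r big1 ?add0r// => i _.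
  by rewrite mxE mulr0.
pose C := Cg + abs_sum (hess_z g 0).
have b0 : 0 <= abs_sum (hess_z g 0) := abs_sum_ge0 _.
have := @laplace_bigO R n m f g K K_compact K_nbhd f_analytic g_analytic f_max
  f_hess f_dx 1 0 (2^-1 *: hess_z g 0) C.
apply => //.
- by rewrite addr_ge0.
- move=> x z x0; rewrite G0 muln1 s2//.
  rewrite (@le_trans _ _ (abs_sum (hess_z g 0) * normsq z))//.
    rewrite normrM (ger0_norm (_ : 0 <= 2^-1))// ler_pdivrMr//.
    rewrite (le_trans (normr_qform_le _ _))// ler_peMr// ?ler1n//.
    by rewrite mulr_ge0// normsq_ge0.
  have z0 := normsq_ge0 z; rewrite /C.
  by rewrite ler_pM// ?lerDr// ltW.
- move=> x z x01 z01; have [+ _] := gexp _ _ x01 z01.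
  rewrite T2 G0 muln1 => h; apply: (le_trans h).
  by rewrite ler_wpM2r ?exprn_ge0// lerDl.
- move=> x z x01 z01; have [_ +] := gexp _ _ x01 z01.
  rewrite !T2 qformN G0 muln1 mulr_natl mulr2n => h; apply: (le_trans h).
  by rewrite ler_wpM2r ?exprn_ge0// lerDl.
- move=> N N1; have N0 : 0 < N := lt_le_trans ltr01 N1.
  rewrite powR_exponent// add0r -scalerN -scalemxAl mxtraceZ.
  rewrite addnS addn1 exprMn [N ^+ m.+2]exprS !invfM; ring.
Qed.
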